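(* Let $k$ be an algebraically closed field of characteristic $p>5$. Let $\mathscr{G}$ be a finite super algebraic $k$-group with $\mathscr{G}\neq\underline{\mathscr{G}}$ such that $H=H(\mathscr{G})$ has finite representation type, and let $y$ be a nonzero element of the (one-dimensional) space $V_H=P(H)_1$ of odd primitive elements of $H$. If $[y,y]=0$, then $\underline{H}=\underline{H}(\mathscr{G})$ is semisimple.
   Context: A finite super algebraic $k$-group $\mathscr{G}$ is an affine super group scheme over $k$ represented by a finite-dimensional super commutative super Hopf algebra $\mathcal{O}(\mathscr{G})$ (super = $\mathbb{Z}_2$-graded, with the usual sign rule). Its algebra of measures is $H=H(\mathscr{G})=\mathcal{O}(\mathscr{G})^{*}$, a finite-dimensional super cocommutative Hopf algebra $H=H_0\oplus H_1$. $\underline{H}:=\Delta^{-1}(H_0\otimes H_0)$ is the largest ordinary (purely even) cocommutative sub Hopf algebra of $H$, and $\underline{\mathscr{G}}$ is the ordinary finite algebraic $k$-group with $H(\underline{\mathscr{G}})=\underline{H}$. The primitive elements $P(H)=\mathrm{Lie}(\mathscr{G})$ form a restricted Lie superalgebra with $[a,b]=ab-(-1)^{|a||b|}ba$ for homogeneous $a,b$; in particular $[y,y]=2y^2$ for odd $y$. Under the stated assumptions ($\mathscr{G}\ne\underline{\mathscr{G}}$ and $H$ of finite representation type) it is known that $V_H=P(H)_1$ is one-dimensional, so $V_H=ky$. A finite-dimensional algebra has finite representation type if it has only finitely many isomorphism classes of (finite-dimensional) indecomposable modules; modules are ordinary (ungraded) modules. *)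

(* Defs.v *)
From HB Require Import structures.
From mathcomp Require Import all_boot all_order all_algebra all_field.

Set Implicit Arguments.
Unset Strict Implicit.
Unset Printing Implicit Defensive.

Import GRing.Theory.

Local Open Scope ring_scope.

(******************************************************************************)
(* Tensor products of finite-dimensional vector spaces.                       *)
(* The tensor product of U and V is the space of matrices of coordinates on   *)
(* the pure tensors of the vectors of the canonical bases of U and V.         *)
(*   tens u v      == the pure tensor of u and v                              *)
(*   tlift f       == the linear map induced by f; for bilinear f it is the   *)
(*                    unique linear map sending tens u v to f u v (tlift_tens)*)
(*   tensv A B     == the subspace A (x) B of U (x) V                         *)
(* With t = Delta h, tlift (fun u v => E) t is what Sweedler's notation writes*)
(* as E with u = h_(1), v = h_(2), summation being understood.                *)
(******************************************************************************)

Section Tensor.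

Variables (k : fieldType) (U V : vectType k).

Definition tensor : vectType k := 'M[k]_(\dim {:U}, \dim {:V}).

Definition tens (u : U) (v : V) : tensor :=
  \matrix_(i, j) (coord (vbasis {:U}) i u * coord (vbasis {:V}) j v).

Definition tlift (W : lmodType k) (f : U -> V -> W) (t : tensor) : W :=
  \sum_i \sum_j (t : 'M_(_, _)) i j *: f (vbasis {:U})`_i (vbasis {:V})`_j.

Definition tensv (A : {vspace U}) (B : {vspace V}) : {vspace tensor} :=
  <<[seq tens u v | u <- vbasis A, v <- vbasis B]>>%VS.

Definition bilin (W : lmodType k) (f : U -> V -> W) : Prop :=
  (forall v, linear (f^~ v)) /\ (forall u, linear (f u)).

Lemma tlift_is_linear (W : lmodType k) (f : U -> V -> W) : linear (tlift f).
Proof.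
move=> a s t; rewrite /tlift scaler_sumr -big_split /=; apply: eq_bigr => i _.
rewrite scaler_sumr -big_split /=; apply: eq_bigr => j _.
by rewrite !mxE scalerDl scalerA.
Qed.

HB.instance Definition _ (W : lmodType k) (f : U -> V -> W) :=
  GRing.isSemilinear.Build k tensor W _ (tlift f)
    (GRing.semilinear_linear (tlift_is_linear f)).

Lemma eq_tlift (W : lmodType k) (f g : U -> V -> W) :
  (forall u v, f u v = g u v) -> tlift f =1 tlift g.
Proof.
by move=> fg t; apply: eq_bigr => i _; apply: eq_bigr => j _; rewrite fg.
Qed.

Lemma bilin_sum (W : lmodType k) (f : U -> V -> W) (m n : nat)
    (a : 'I_m -> k) (x : 'I_m -> U) (b : 'I_n -> k) (y : 'I_n -> V) :
  bilin f ->
  f (\sum_i a i *: x i) (\sum_j b j *: y j) =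
  \sum_i \sum_j (a i * b j) *: f (x i) (y j).
Proof.
case=> fl fr.
have fl0 v : f 0 v = 0.
  by have := fl v (-1) 0 0; rewrite !scaleN1r oppr0 addr0 addNr.
have fr0 u : f u 0 = 0.
  by have := fr u (-1) 0 0; rewrite !scaleN1r oppr0 addr0 addNr.
have flD v u1 u2 : f (u1 + u2) v = f u1 v + f u2 v.
  by have := fl v 1 u1 u2; rewrite !scale1r.
have frD u v1 v2 : f u (v1 + v2) = f u v1 + f u v2.
  by have := fr u 1 v1 v2; rewrite !scale1r.
rewrite (big_morph (f^~ _) (flD _) (fl0 _)); apply: eq_bigr => i _.
rewrite (big_morph (f _) (frD _) (fr0 _)); apply: eq_bigr => j _.
have := fr (a i *: x i) (b j) (y j) 0; rewrite addr0 fr0 addr0 => ->.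
have := fl (y j) (a i) (x i) 0; rewrite /= addr0 fl0 addr0 => ->.
by rewrite scalerA mulrC.
Qed.

Lemma tlift_tens (W : lmodType k) (f : U -> V -> W) :
  bilin f -> forall u v, tlift f (tens u v) = f u v.
Proof.
move=> bf u v.
rewrite {2}(coord_vbasis (memvf u)) {2}(coord_vbasis (memvf v)) bilin_sum //.
by apply: eq_bigr => i _; apply: eq_bigr => j _; rewrite mxE.
Qed.

Lemma tens_bilin : bilin tens.
Proof.
split=> [v a u1 u2|u a v1 v2]; apply/matrixP=> i j; rewrite !mxE linearP /=.
  by rewrite mulrDl mulrA.
by rewrite mulrDr mulrCA.
Qed.

Lemma tlift_id t : tlift tens t = t.
Proof.
have cb (T : vectType k) (a b : 'I_(\dim {:T})) :
    coord (vbasis {:T}) a (vbasis {:T})`_b = (a == b)%:R.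
  by rewrite (coord_free _ _ (basis_free (vbasisP {:T}))) eq_sym.
rewrite [RHS]matrix_sum_delta; apply: eq_bigr => i _; apply: eq_bigr => j _.
by congr (_ *: _); apply/matrixP=> a b; rewrite !mxE !cb -natrM mulnb.
Qed.

Lemma linear_tlift (W X : lmodType k) (L : {linear W -> X})
    (f : U -> V -> W) t :
  L (tlift f t) = tlift (fun u v => L (f u v)) t.
Proof.
rewrite linear_sum; apply: eq_bigr => i _; rewrite linear_sum.
by apply: eq_bigr => j _; rewrite linearZ.
Qed.

Lemma tliftD (W : lmodType k) (f g : U -> V -> W) t :
  tlift (fun u v => f u v + g u v) t = tlift f t + tlift g t.
Proof.
rewrite -big_split; apply: eq_bigr => i _ /=; rewrite -big_split.
by apply: eq_bigr => j _; rewrite scalerDr.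
Qed.

Lemma tlift_sum (W : lmodType k) (I : finType) (f : I -> U -> V -> W) t :
  tlift (fun u v => \sum_i f i u v) t = \sum_i tlift (f i) t.
Proof.
rewrite exchange_big; apply: eq_bigr => i _ /=; rewrite exchange_big.
by apply: eq_bigr => j _; rewrite scaler_sumr.
Qed.

Lemma tliftZ (W : lmodType k) a (f : U -> V -> W) t :
  tlift (fun u v => a *: f u v) t = a *: tlift f t.
Proof.
rewrite scaler_sumr; apply: eq_bigr => i _ /=; rewrite scaler_sumr.
by apply: eq_bigr => j _; rewrite !scalerA mulrC.
Qed.

Lemma tlift_mull (A : algType k) (a : A) (f : U -> V -> A) t :
  a * tlift f t = tlift (fun u v => a * f u v) t.
Proof.
rewrite mulr_sumr; apply: eq_bigr => i _ /=; rewrite mulr_sumr.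
by apply: eq_bigr => j _; rewrite scalerAr.
Qed.

Lemma tlift_mulr (A : algType k) (a : A) (f : U -> V -> A) t :
  tlift f t * a = tlift (fun u v => f u v * a) t.
Proof.
rewrite mulr_suml; apply: eq_bigr => i _ /=; rewrite mulr_suml.
by apply: eq_bigr => j _; rewrite scalerAl.
Qed.

Lemma memv_tens (A : {vspace U}) (B : {vspace V}) u v :
  u \in A -> v \in B -> tens u v \in tensv A B.
Proof.
move=> /coord_vbasis-> /coord_vbasis->; rewrite (bilin_sum _ _ _ _ tens_bilin).
apply: memv_suml => i _; apply: memv_suml => j _; rewrite memvZ // memv_span //.
by apply/allpairsP; exists ((vbasis A)`_i, (vbasis B)`_j); rewrite !memt_nth.
Qed.

Lemma tensvP (A : {vspace U}) (B : {vspace V}) (W : vectType k)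
    (L : {linear tensor -> W}) (X : {vspace W}) :
  (forall u v, u \in A -> v \in B -> L (tens u v) \in X) ->
  forall t, t \in tensv A B -> L t \in X.
Proof.
move=> LX t /(memv_img (linfun L)); rewrite lfunE => Lt.
suff /subvP/(_ _ Lt) : (linfun L @: tensv A B <= X)%VS by [].
rewrite limg_span; apply/span_subvP=> w /mapP[x /allpairsP[[u v] /= []]].
by move=> /vbasis_mem uA /vbasis_mem vB -> ->; rewrite lfunE LX.
Qed.

Lemma tlift_memv (W : vectType k) (f : U -> V -> W) (X : {vspace W}) t :
  (forall u v, f u v \in X) -> tlift f t \in X.
Proof.
by move=> fX; apply: memv_suml => i _; apply: memv_suml => j _; rewrite memvZ.
Qed.

(* Pure tensors of separating families of linear forms are separating. *)
Lemma tens_sep (I J : Type) (phi : I -> {linear U -> k^o})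
    (psi : J -> {linear V -> k^o}) :
  (forall u, (forall i, phi i u = 0) -> u = 0) ->
  (forall v, (forall j, psi j v = 0) -> v = 0) ->
  forall s t : tensor,
  (forall i j, tlift (fun u v => phi i u * psi j v) s =
               tlift (fun u v => phi i u * psi j v) t) -> s = t.
Proof.
move=> sphi spsi s t est; apply/eqP; rewrite -subr_eq0; apply/eqP.
have {est}: forall i j, tlift (fun u v => phi i u * psi j v) (s - t) = 0.
  by move=> i j; rewrite linearB /= est subrr.
move: (s - t) => {s t} r r0; apply/matrixP=> a b; rewrite [RHS]mxE.
have frU := basis_free (vbasisP {:U}); have frV := basis_free (vbasisP {:V}).
suff /freeP/(_ (fun c => (r : 'M_(_, _)) c b)) : free (vbasis {:U}).
  apply; apply: sphi => i; rewrite linear_sum /=.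
  suff /freeP/(_ (fun d => \sum_c (r : 'M_(_, _)) c d * phi i (vbasis {:U})`_c)) :
      free (vbasis {:V}).
    move=> /(_ _ b) h; rewrite -[RHS]h; last first.
      apply: spsi => j; rewrite linear_sum -[RHS](r0 i j) /tlift exchange_big.
      apply: eq_bigr => d _; rewrite linearZ /= /GRing.scale /= mulr_suml.
      by apply: eq_bigr => c _; rewrite mulrA.
    by apply: eq_bigr => c _; rewrite linearZ.
  exact: frV.
exact: frU.
Qed.

End Tensor.

Lemma tlift_exchange (k : fieldType) (U V U' V' : vectType k) (W : lmodType k)
    (f : U -> V -> U' -> V' -> W) s t :
  tlift (fun a b => tlift (fun c d => f a b c d) t) s =
  tlift (fun c d => tlift (fun a b => f a b c d) s) t.
Proof.
rewrite [RHS]/tlift; under [in LHS]eq_tlift do rewrite /tlift.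
rewrite tlift_sum; apply: eq_bigr => i _.
by rewrite tlift_sum; apply: eq_bigr => j _; rewrite tliftZ.
Qed.

(* The parity false is even, true is odd. *)
Section Grading.

Variables (k : fieldType) (V : vectType k) (E : bool -> {vspace V}).

Definition is_grading : Prop :=
  (E false + E true)%VS = fullv /\ (E false :&: E true)%VS = 0%VS.

Definition hproj (i : bool) : 'End(V) := daddv_pi (E i) (E (~~ i)).

Hypothesis gE : is_grading.

Let cap0 i : (E i :&: E (~~ i) = 0)%VS.
Proof. by case: gE; case: i => //= _; rewrite capvC. Qed.

Let sumT i : (E i + E (~~ i) = fullv)%VS.
Proof. by case: gE; case: i => //=; rewrite addvC. Qed.

Lemma hproj_mem i x : hproj i x \in E i.
Proof. exact: memv_pi. Qed.

Lemma hproj_add x : hproj false x + hproj true x = x.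
Proof.
by rewrite (daddv_pi_add (cap0 false)) // (sumT false) memvf.
Qed.

Lemma hproj_addN i x : hproj i x + hproj (~~ i) x = x.
Proof. by case: i; rewrite ?hproj_add // addrC hproj_add. Qed.

Lemma hproj_id i x : x \in E i -> hproj i x = x.
Proof. by move=> xE; rewrite daddv_pi_id. Qed.

Lemma hproj_neg0 i x : x \in E i -> hproj (~~ i) x = 0.
Proof.
move=> xE; have := hproj_add x; have := hproj_id xE.
by case: i {xE} => /= -> => [/(canRL (addrK _))|/(canRL (addKr _))] ->;
   rewrite ?subrr ?addNr.
Qed.

Lemma hprojE i j x : hproj i (hproj j x) = if i == j then hproj j x else 0.
Proof.
case: eqP => [->|]; first by rewrite hproj_id ?hproj_mem.
by move: (hproj_neg0 (hproj_mem j x)); case: i; case: j.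
Qed.

Lemma homog_hproj i x : (x \in E i) = (hproj (~~ i) x == 0).
Proof.
apply/idP/eqP => [/hproj_neg0 //|x0].
have := hproj_add x; case: i x0 => /= ->; rewrite ?add0r ?addr0 => <-;
  exact: hproj_mem.
Qed.

End Grading.

(* The product (a (x) b)(c (x) d) = (-1)^(|b||c|) ac (x) bd of A (x) A. *)
Definition tmul (k : fieldType) (A : falgType k) (E : bool -> {vspace A})
    (s t : tensor A A) : tensor A A :=
  tlift (fun a b => tlift (fun c d =>
    \sum_(i : bool) \sum_(j : bool)
      (-1) ^+ (i && j) *: tens (a * hproj E j c) (hproj E i b * d)) t) s.

(* The symmetry u (x) v |-> (-1)^(|u||v|) v (x) u of super vector spaces. *)
Definition tswap (k : fieldType) (V : vectType k) (E : bool -> {vspace V})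
    (t : tensor V V) : tensor V V :=
  tlift (fun u v => \sum_(i : bool) \sum_(j : bool)
    (-1) ^+ (i && j) *: tens (hproj E j v) (hproj E i u)) t.

Record superHopfAlgebra (k : fieldType) := SuperHopfAlgebra {
  sh_sort :> falgType k;
  homog : bool -> {vspace sh_sort};
  comul : 'Hom(sh_sort, tensor sh_sort sh_sort);
  counit : 'Hom(sh_sort, k^o);
  antipode : 'End(sh_sort);
  homog_grading : is_grading homog;
  homog1 : 1 \in homog false;
  homogM : forall i j a b,
    a \in homog i -> b \in homog j -> a * b \in homog (i (+) j);
  comul_homog : forall i h, h \in homog i ->
    comul h \in (\sum_(j : bool) tensv (homog j) (homog (j (+) i)))%VS;
  counit_homog : forall h, h \in homog true -> counit h = 0;
  antipode_homog : forall i h, h \in homog i -> antipode h \in homog i;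
  comulA : forall h,
    tlift (fun u v => tens u (comul v)) (comul h) =
    tlift (fun u v => tlift (fun u1 u2 => tens u1 (tens u2 v)) (comul u))
      (comul h);
  counitl : forall h, tlift (fun u v => counit u *: v) (comul h) = h;
  counitr : forall h, tlift (fun u v => counit v *: u) (comul h) = h;
  comul1 : comul 1 = tens 1 1;
  comulM : forall a b, comul (a * b) = tmul homog (comul a) (comul b);
  counit1 : counit 1 = 1;
  counitM : forall a b, counit (a * b) = counit a * counit b;
  antipodel : forall h,
    tlift (fun u v => antipode u * v) (comul h) = counit h *: 1;
  antipoder : forall h,
    tlift (fun u v => u * antipode v) (comul h) = counit h *: 1
}.

Arguments homog {k} s i.
Arguments comul {k} s.
Arguments counit {k} s.
Arguments antipode {k} s.

Definition supercommutative (k : fieldType) (A : superHopfAlgebra k) : Prop :=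
  forall i j (a b : A), a \in homog A i -> b \in homog A j ->
  b * a = (-1) ^+ (i && j) *: (a * b).

Definition supercocommutative (k : fieldType) (H : superHopfAlgebra k) : Prop :=
  forall h : H, tswap (homog H) (comul H h) = comul H h.

(******************************************************************************)
(* The dual super Hopf algebra, for the pairing                               *)
(*   <f (x) g, x (x) y> = f x * g y                                           *)
(* (no sign): product f * g = (f (x) g) o Delta, coproduct determined by      *)
(* <Delta f, x (x) y> = f (x * y).                                            *)
(******************************************************************************)

Section Dual.

Variables (k : fieldType) (O : superHopfAlgebra k).

Definition sdual : Type := 'Hom(O, k^o).

HB.instance Definition _ := Vector.on sdual.

Implicit Types (f g h : sdual) (x y z : O).

Definition sd_mul f g : sdual :=
  linfun (tlift (fun a b => f a * g b : k^o) \o comul O).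

Definition sd_one : sdual := counit O.

Lemma sd_mulE f g x :
  sd_mul f g x = tlift (fun a b => f a * g b : k^o) (comul O x).
Proof. by rewrite lfunE. Qed.

Lemma bilin_form (U V : vectType k) (f : {linear U -> k^o})
  (g : {linear V -> k^o}) : bilin (fun a b => f a * g b : k^o).
Proof.
split=> [v a u1 u2|u a v1 v2]; rewrite linearP /= /GRing.scale /=.
  by rewrite mulrDl mulrA.
by rewrite mulrDr mulrCA.
Qed.

Lemma sd_mulA : associative sd_mul.
Proof.
move=> f g h; apply/lfunP => x; rewrite !sd_mulE.
pose psi : {linear tensor O O -> k^o} := tlift (fun c d => g c * h d : k^o).
pose Psi : {linear tensor O (tensor O O) -> k^o} :=
  tlift (fun a w => f a * psi w : k^o).
have psiE c d : psi (tens c d) = g c * h d by apply: tlift_tens; apply: bilin_form.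
have PsiE a w : Psi (tens a w) = f a * psi w by apply: tlift_tens; apply: bilin_form.
have /(congr1 Psi) := comulA x; rewrite !linear_tlift.
rewrite (eq_tlift (g := fun a b => f a * sd_mul g h b : k^o)) => [->|u v].
  apply: eq_tlift => u v; rewrite sd_mulE linear_tlift.
  rewrite tlift_mulr; apply: eq_tlift => a b.
  by rewrite PsiE psiE mulrA.
by rewrite PsiE sd_mulE.
Qed.

Lemma sd_mul1l : left_id sd_one sd_mul.
Proof.
move=> f; apply/lfunP => x; rewrite sd_mulE -[in RHS](counitl x) linear_tlift.
by apply: eq_tlift => u v; rewrite linearZ.
Qed.

Lemma sd_mul1r : right_id sd_one sd_mul.
Proof.
move=> f; apply/lfunP => x; rewrite sd_mulE -[in RHS](counitr x) linear_tlift.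
by apply: eq_tlift => u v; rewrite linearZ mulrC.
Qed.

Lemma sd_mulDl : left_distributive sd_mul +%R.
Proof.
move=> f g h; apply/lfunP => x; rewrite add_lfunE !sd_mulE -tliftD.
by apply: eq_tlift => u v; rewrite add_lfunE mulrDl.
Qed.

Lemma sd_mulDr : right_distributive sd_mul +%R.
Proof.
move=> f g h; apply/lfunP => x; rewrite add_lfunE !sd_mulE -tliftD.
by apply: eq_tlift => u v; rewrite add_lfunE mulrDr.
Qed.

Lemma sd_one_neq0 : sd_one != 0.
Proof.
apply/eqP => /lfunP/(_ 1); rewrite lfunE /= counit1 => /eqP.
by rewrite oner_eq0.
Qed.

HB.instance Definition _ := GRing.Zmodule_isNzRing.Build sdual
  sd_mulA sd_mul1l sd_mul1r sd_mulDl sd_mulDr sd_one_neq0.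

Lemma sd_scaleAl (c : k) f g : c *: (f * g) = (c *: f) * g.
Proof.
apply/lfunP => x; rewrite scale_lfunE [in LHS]sd_mulE [RHS]sd_mulE -tliftZ.
by apply: eq_tlift => u v; rewrite scale_lfunE /GRing.scale /= mulrA.
Qed.

HB.instance Definition _ := GRing.Lmodule_isLalgebra.Build k sdual sd_scaleAl.

Lemma sd_scaleAr (c : k) f g : c *: (f * g) = f * (c *: g).
Proof.
apply/lfunP => x; rewrite scale_lfunE [in LHS]sd_mulE [RHS]sd_mulE -tliftZ.
by apply: eq_tlift => u v; rewrite scale_lfunE /GRing.scale /= mulrCA.
Qed.

HB.instance Definition _ := GRing.Lalgebra_isAlgebra.Build k sdual sd_scaleAr.
HB.instance Definition _ := Algebra_isFalgebra.Build k sdual.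

Definition sd_restr (i : bool) f : sdual := (f \o hproj (homog O) i)%VF.

Lemma sd_restr_is_linear i : linear (sd_restr i).
Proof.
by move=> a f g; apply/lfunP=> x; rewrite !(comp_lfunE, add_lfunE, scale_lfunE).
Qed.

HB.instance Definition _ i := GRing.isSemilinear.Build k sdual sdual _
  (sd_restr i) (GRing.semilinear_linear (sd_restr_is_linear i)).

(* The forms vanishing on the component of parity ~~ i, see sd_homogP. *)
Definition sd_homog (i : bool) : {vspace sdual} := lker (linfun (sd_restr (~~ i))).

Lemma sd_homogP i f :
  reflect (forall x, x \in homog O (~~ i) -> f x = 0) (f \in sd_homog i).
Proof.
rewrite memv_ker lfunE; apply: (iffP eqP) => [f0 x xO|f0].
  have /lfunP/(_ x) := f0; rewrite comp_lfunE lfunE /= => <-.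
  by rewrite (hproj_id (homog_grading O) xO).
by apply/lfunP => x; rewrite comp_lfunE lfunE /= f0 ?hproj_mem.
Qed.

Lemma sd_restrD f : sd_restr false f + sd_restr true f = f.
Proof.
apply/lfunP => x; rewrite add_lfunE !comp_lfunE -linearD.
by rewrite (hproj_add (homog_grading O)).
Qed.

Lemma sd_restr_mem i f : sd_restr i f \in sd_homog i.
Proof.
apply/sd_homogP => x xO; rewrite comp_lfunE.
have := hproj_neg0 (homog_grading O) xO; rewrite negbK => ->.
by rewrite linear0.
Qed.

Lemma sd_grading : is_grading sd_homog.
Proof.
split; apply/eqP; rewrite eqEsubv ?subvf ?sub0v /= ?andbT.
  apply/subvP => f _; rewrite -(sd_restrD f).
  by rewrite memv_add // sd_restr_mem.
apply/subvP => f; rewrite memv_cap => /andP[/sd_homogP f0 /sd_homogP f1].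
rewrite memv0; apply/eqP/lfunP => x; rewrite lfunE /=.
rewrite -(hproj_add (homog_grading O) x) linearD /=.
by rewrite f1 ?f0 ?addr0 // ?hproj_mem.
Qed.

Lemma sd_hprojE i f x : hproj sd_homog i f x = f (hproj (homog O) i x).
Proof.
have -> : hproj sd_homog i f = sd_restr i f; last by rewrite comp_lfunE.
rewrite -[in LHS](sd_restrD f) linearD /=.
have g := sd_grading.
case: i; rewrite (hproj_id g (sd_restr_mem _ f)).
  by rewrite (hproj_neg0 g (sd_restr_mem false f)) add0r.
by rewrite (hproj_neg0 g (sd_restr_mem true f)) addr0.
Qed.

Definition sd_ev x f : k^o := f x.

Lemma sd_ev_is_linear x : linear (sd_ev x).
Proof. by move=> a f g; rewrite /sd_ev add_lfunE scale_lfunE. Qed.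

HB.instance Definition _ x := GRing.isSemilinear.Build k sdual k^o _
  (sd_ev x) (GRing.semilinear_linear (sd_ev_is_linear x)).

Definition sd_pair x y : tensor sdual sdual -> k^o :=
  tlift (fun f g => sd_ev x f * sd_ev y g).

HB.instance Definition _ x y := GRing.Linear.on (sd_pair x y).

Lemma sd_pair_tens x y f g : sd_pair x y (tens f g) = f x * g y.
Proof. by apply: tlift_tens; apply: bilin_form. Qed.

Lemma sd_ev_sep f : (forall x, sd_ev x f = 0) -> f = 0.
Proof. by move=> f0; apply/lfunP => x; rewrite lfunE /=; apply: f0. Qed.

Lemma sd_pair_inj s t : (forall x y, sd_pair x y s = sd_pair x y t) -> s = t.
Proof. by move=> st; apply: (tens_sep sd_ev_sep sd_ev_sep). Qed.

Lemma sd_pair3_inj (s t : tensor sdual (tensor sdual sdual)) :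
  (forall x y z, tlift (fun u w => sd_ev x u * sd_pair y z w) s =
                 tlift (fun u w => sd_ev x u * sd_pair y z w) t) -> s = t.
Proof.
move=> st; apply: (tens_sep (psi := fun yz => sd_pair yz.1 yz.2) sd_ev_sep).
  by move=> v v0; apply: sd_pair_inj => x y; rewrite linear0 (v0 (x, y)).
by move=> x [y z]; apply: st.
Qed.

Definition sd_coord i : sdual := linfun (coord (vbasis {:O}) i : O -> k^o).

Definition sd_comul_fun f : tensor sdual sdual :=
  \sum_(i < \dim {:O}) \sum_(j < \dim {:O}) f ((vbasis {:O})`_i * (vbasis {:O})`_j) *:
     tens (sd_coord i) (sd_coord j).

Lemma sd_comul_is_linear : linear sd_comul_fun.
Proof.
move=> a f g; rewrite /sd_comul_fun scaler_sumr -big_split; apply: eq_bigr => i _.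
rewrite scaler_sumr -big_split; apply: eq_bigr => j _ /=.
by rewrite add_lfunE scale_lfunE scalerDl scalerA.
Qed.

HB.instance Definition _ := GRing.isSemilinear.Build k sdual _ _
  sd_comul_fun (GRing.semilinear_linear sd_comul_is_linear).

Definition sd_comul : 'Hom(sdual, tensor sdual sdual) := linfun sd_comul_fun.

Lemma sd_comulE x y f : sd_pair x y (sd_comul f) = f (x * y).
Proof.
rewrite [in RHS](coord_vbasis (memvf x)) [in RHS](coord_vbasis (memvf y)).
have bm : bilin (fun a b : O => a * b).
  split=> [v a u1 u2|u a v1 v2] /=; first by rewrite mulrDl scalerAl.
  by rewrite mulrDr scalerAr.
rewrite (bilin_sum _ _ _ _ bm) linear_sum lfunE linear_sum.
apply: eq_bigr => i _; rewrite !linear_sum; apply: eq_bigr => j _.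
by rewrite !linearZ /= sd_pair_tens !lfunE /= /GRing.scale /= mulrC.
Qed.

Definition sd_counit : 'Hom(sdual, k^o) := linfun (sd_ev 1).

Lemma sd_counitE f : sd_counit f = f 1.
Proof. by rewrite lfunE. Qed.

Definition sd_antipode_fun f : sdual := (f \o antipode O)%VF.

Lemma sd_antipode_is_linear : linear sd_antipode_fun.
Proof.
by move=> a f g; apply/lfunP=> x; rewrite !(comp_lfunE, add_lfunE, scale_lfunE).
Qed.

HB.instance Definition _ := GRing.isSemilinear.Build k sdual sdual _
  sd_antipode_fun (GRing.semilinear_linear sd_antipode_is_linear).

Definition sd_antipode : 'End(sdual) := linfun sd_antipode_fun.

Lemma sd_antipodeE f x : sd_antipode f x = f (antipode O x).
Proof. by rewrite lfunE comp_lfunE. Qed.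

Lemma sd_homog1 : 1 \in sd_homog false.
Proof. by apply/sd_homogP => x /counit_homog. Qed.

Lemma sd_hproj_homog i f x : f \in sd_homog i ->
  f x = f (hproj (homog O) i x).
Proof.
by move=> fi; rewrite -[in LHS](hproj_id sd_grading fi) sd_hprojE.
Qed.

Lemma sd_homogM i j f g : f \in sd_homog i -> g \in sd_homog j ->
  f * g \in sd_homog (i (+) j).
Proof.
move=> /sd_homogP fi /sd_homogP gj; apply/sd_homogP => x /comul_homog xO.
rewrite [LHS]sd_mulE; move: xO => /memv_sumP[t tO ->].
pose L : {linear tensor O O -> k^o} := tlift (fun a b => f a * g b : k^o).
have LE a b : L (tens a b) = f a * g b by apply: tlift_tens; apply: bilin_form.
rewrite -/(L _) linear_sum big1 //= => l _.
apply/eqP; rewrite -memv0; apply: (tensvP (L := L)) (tO l isT) => u v uO vO.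
rewrite memv0 LE; apply/eqP.
case: (l =P ~~ i) => [li|/eqP nli].
  by rewrite fi ?mul0r // -li.
rewrite gj ?mulr0 //; suff -> : ~~ j = l (+) ~~ (i (+) j) by [].
by move: nli; case: (i) (j) (l) => [] [] [].
Qed.

Lemma sd_comul_homog i f : f \in sd_homog i ->
  sd_comul f \in (\sum_(j : bool) tensv (sd_homog j) (sd_homog (j (+) i)))%VS.
Proof.
move=> fi.
suff -> : sd_comul f = \sum_(j : bool) tlift (fun u v =>
    tens (hproj sd_homog j u) (hproj sd_homog (j (+) i) v)) (sd_comul f).
  apply: memv_sumr => j _; apply: tlift_memv => u v.
  by apply: memv_tens; apply: hproj_mem.
apply: sd_pair_inj => x y; rewrite sd_comulE linear_sum /=.
transitivity (\sum_(j : bool)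
    f (hproj (homog O) j x * hproj (homog O) (j (+) i) y)); last first.
  apply: eq_bigr => j _; rewrite -sd_comulE linear_tlift; apply: eq_tlift => u v.
  by rewrite /= sd_pair_tens !sd_hprojE.
have fE j : f (hproj (homog O) j x * y) =
            f (hproj (homog O) j x * hproj (homog O) (j (+) i) y).
  rewrite -[in LHS](hproj_addN (homog_grading O) (j (+) i) y).
  rewrite mulrDr linearD /=; move/sd_homogP: fi => fi.
  rewrite [X in _ + X]fi ?addr0 //.
  suff <- : j (+) ~~ (j (+) i) = ~~ i by apply: homogM; apply: hproj_mem.
  by case: (i) (j) => [] [].
rewrite -[in LHS](hproj_add (homog_grading O) x) mulrDl linearD /= !fE.
by rewrite big_bool addrC.
Qed.

Lemma sd_counit_homog f : f \in sd_homog true -> sd_counit f = 0.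
Proof. by move=> /sd_homogP f0; rewrite sd_counitE f0 ?homog1. Qed.

Lemma sd_antipode_homog i f : f \in sd_homog i -> sd_antipode f \in sd_homog i.
Proof.
move=> /sd_homogP f0; apply/sd_homogP => x xO.
by rewrite sd_antipodeE f0 ?antipode_homog.
Qed.

Lemma sd_comulA f :
  tlift (fun u v => tens u (sd_comul v)) (sd_comul f) =
  tlift (fun u v => tlift (fun u1 u2 => tens u1 (tens u2 v)) (sd_comul u))
    (sd_comul f).
Proof.
apply: sd_pair3_inj => x y z.
pose L : {linear tensor sdual (tensor sdual sdual) -> k^o} :=
  tlift (fun u w => sd_ev x u * sd_pair y z w).
rewrite -[LHS]/(L _) -[RHS]/(L _).
have LE u w : L (tens u w) = u x * sd_pair y z w.
  by apply: tlift_tens; apply: bilin_form.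
transitivity (f (x * (y * z))).
  rewrite linear_tlift -sd_comulE; apply: eq_tlift => u v.
  by rewrite [LHS]LE sd_comulE.
rewrite mulrA linear_tlift -sd_comulE; apply: eq_tlift => u v.
rewrite linear_tlift /sd_ev -sd_comulE tlift_mulr; apply: eq_tlift => u1 u2.
by rewrite [RHS]LE sd_pair_tens mulrA.
Qed.

Lemma sd_counitl f : tlift (fun u v => sd_counit u *: v) (sd_comul f) = f.
Proof.
apply/lfunP => x; rewrite -[in RHS](mul1r x) -sd_comulE.
rewrite -[LHS]/(sd_ev x _) linear_tlift; apply: eq_tlift => u v.
by rewrite linearZ /= sd_counitE.
Qed.

Lemma sd_counitr f : tlift (fun u v => sd_counit v *: u) (sd_comul f) = f.
Proof.
apply/lfunP => x; rewrite -[in RHS](mulr1 x) -sd_comulE.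
rewrite -[LHS]/(sd_ev x _) linear_tlift; apply: eq_tlift => u v.
by rewrite linearZ /= sd_counitE mulrC.
Qed.

Lemma sd_comul1 : sd_comul 1 = tens 1 1.
Proof.
apply: sd_pair_inj => x y; rewrite sd_comulE sd_pair_tens.
exact: counitM.
Qed.

Lemma sd_comulM f g : sd_comul (f * g) = tmul sd_homog (sd_comul f) (sd_comul g).
Proof.
apply: sd_pair_inj => x y; rewrite sd_comulE.
rewrite [LHS]sd_mulE comulM.
have LE a b : tlift (fun a b => f a * g b : k^o) (tens a b) = f a * g b.
  by apply: tlift_tens; apply: bilin_form.
rewrite [LHS]linear_tlift [RHS]linear_tlift.
pose F i j (f1 f2 g1 g2 : sdual) (x1 x2 y1 y2 : O) : k^o :=
  (-1) ^+ (i && j) *: (f1 x1 * f2 (hproj (homog O) i y1) *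
                       (g1 (hproj (homog O) j x2) * g2 y2) : k^o).
transitivity (tlift (fun x1 x2 => tlift (fun y1 y2 =>
  tlift (fun f1 f2 => tlift (fun g1 g2 => \sum_(i : bool) \sum_(j : bool)
    F i j f1 f2 g1 g2 x1 x2 y1 y2)
     (sd_comul g)) (sd_comul f)) (comul O y)) (comul O x)).
  apply: eq_tlift => x1 x2; rewrite linear_tlift; apply: eq_tlift => y1 y2.
  rewrite linear_sum; under eq_bigr do rewrite linear_sum.
  rewrite exchange_big /=.
  under [RHS]eq_tlift do rewrite tlift_sum.
  rewrite tlift_sum; apply: eq_bigr => i _.
  under [RHS]eq_tlift do rewrite tlift_sum.
  rewrite tlift_sum; apply: eq_bigr => j _.
  transitivity ((-1) ^+ (j && i) *: (f (x1 * hproj (homog O) i y1) *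
                                     g (hproj (homog O) j x2 * y2) : k^o)).
    by rewrite linearZ; apply: (congr1 (fun z : k^o => _ *: z) (LE _ _)).
  rewrite -!sd_comulE /sd_pair tlift_mulr -tliftZ.
  apply: eq_tlift => f1 f2; rewrite tlift_mull -tliftZ.
  by apply: eq_tlift => g1 g2; rewrite andbC.
under eq_tlift do rewrite tlift_exchange.
rewrite tlift_exchange; apply: eq_tlift => f1 f2.
under eq_tlift do rewrite tlift_exchange.
rewrite tlift_exchange linear_tlift; apply: eq_tlift => g1 g2.
rewrite linear_sum /=.
under eq_tlift do rewrite tlift_sum.
rewrite tlift_sum; apply: eq_bigr => i _; rewrite linear_sum.
under eq_tlift do rewrite tlift_sum.
rewrite tlift_sum; apply: eq_bigr => j _; rewrite linearZ /= sd_pair_tens.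
rewrite [(f1 * _) x]sd_mulE [(_ * g2) y]sd_mulE tlift_mulr -tliftZ.
apply: eq_tlift => x1 x2; rewrite tlift_mull -tliftZ; apply: eq_tlift => y1 y2.
by rewrite /F !sd_hprojE !mulrA; congr (_ *: (_ * _)); rewrite mulrAC.
Qed.

Lemma sd_counit1 : sd_counit 1 = 1.
Proof. by rewrite sd_counitE; apply: counit1. Qed.

Lemma sd_counitM f g : sd_counit (f * g) = sd_counit f * sd_counit g.
Proof.
rewrite !sd_counitE [LHS]sd_mulE comul1.
by apply: tlift_tens; apply: bilin_form.
Qed.

Lemma sd_antipodel f :
  tlift (fun u v => sd_antipode u * v) (sd_comul f) = sd_counit f *: 1.
Proof.
apply/lfunP => x; rewrite -[LHS]/(sd_ev x _) linear_tlift scale_lfunE sd_counitE.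
transitivity (f (counit O x *: 1)); last by rewrite linearZ /= [LHS]mulrC.
rewrite -antipodel linear_tlift.
transitivity (tlift (fun u v : sdual => tlift (fun a b => u (antipode O a) * v b : k^o)
    (comul O x)) (sd_comul f)).
  apply: eq_tlift => u v; rewrite [LHS]sd_mulE.
  by apply: eq_tlift => a b; rewrite sd_antipodeE.
rewrite tlift_exchange; apply: eq_tlift => x1 x2.
by rewrite [RHS]/= -sd_comulE.
Qed.

Lemma sd_antipoder f :
  tlift (fun u v => u * sd_antipode v) (sd_comul f) = sd_counit f *: 1.
Proof.
apply/lfunP => x; rewrite -[LHS]/(sd_ev x _) linear_tlift scale_lfunE sd_counitE.
transitivity (f (counit O x *: 1)); last by rewrite linearZ /= [LHS]mulrC.
rewrite -antipoder linear_tlift.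
transitivity (tlift (fun u v : sdual => tlift (fun a b => u a * v (antipode O b) : k^o)
    (comul O x)) (sd_comul f)).
  apply: eq_tlift => u v; rewrite [LHS]sd_mulE.
  by apply: eq_tlift => a b; rewrite sd_antipodeE.
rewrite tlift_exchange; apply: eq_tlift => x1 x2.
by rewrite [RHS]/= -sd_comulE.
Qed.

Definition dual : superHopfAlgebra k :=
  SuperHopfAlgebra sd_grading sd_homog1 sd_homogM sd_comul_homog
    sd_counit_homog sd_antipode_homog sd_comulA sd_counitl sd_counitr
    sd_comul1 sd_comulM sd_counit1 sd_counitM sd_antipodel sd_antipoder.

End Dual.

Lemma dual_supercocommutative (k : fieldType) (O : superHopfAlgebra k) :
  supercommutative O -> supercocommutative (dual O).
Proof.
move=> cO f; apply: sd_pair_inj => x y; rewrite sd_comulE.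
rewrite /tswap linear_tlift.
pose F i j (u v : sdual O) : k^o :=
  (-1) ^+ (i && j) *: (u (hproj (homog O) i y) * v (hproj (homog O) j x) : k^o).
rewrite (eq_tlift (g := fun u v => \sum_(i : bool) \sum_(j : bool) F i j u v)).
  rewrite tlift_sum.
  transitivity (\sum_(i : bool) \sum_(j : bool)
      f (hproj (homog O) j x * hproj (homog O) i y)).
    apply: eq_bigr => i _; rewrite tlift_sum; apply: eq_bigr => j _.
    rewrite (cO i j) ?hproj_mem // linearZ /= tliftZ; congr (_ *: _).
    exact: sd_comulE.
  rewrite exchange_big /=.
  transitivity (\sum_(j : bool) f (hproj (homog O) j x * y)).
    apply: eq_bigr => j _; rewrite -[in RHS](hproj_add (homog_grading O) y).
    by rewrite mulrDr linearD big_bool [LHS]addrC.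
  rewrite -[in RHS](hproj_add (homog_grading O) x).
  by rewrite mulrDl linearD big_bool [LHS]addrC.
move=> u v; rewrite linear_sum; apply: eq_bigr => i _.
rewrite linear_sum; apply: eq_bigr => j _.
by rewrite linearZ /= sd_pair_tens !sd_hprojE mulrC.
Qed.

(* A finite super algebraic group is given by its coordinate algebra. *)
Record finSuperGroup (k : fieldType) := FinSuperGroup {
  coordAlg : superHopfAlgebra k;
  coordAlg_comm : supercommutative coordAlg
}.

Definition measures (k : fieldType) (G : finSuperGroup k) : superHopfAlgebra k :=
  dual (coordAlg G).

Section SuperHopfTheory.

Variables (k : fieldType) (H : superHopfAlgebra k).

Lemma tmul_bilin : bilin (tmul (homog H)).
Proof.
split=> [t a s1 s2|s a t1 t2]; rewrite /tmul; first by rewrite linearP.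
rewrite -tliftZ -tliftD; apply: eq_tlift => u v.
by rewrite linearP.
Qed.

Lemma tmul_tens (a b c d : H) : tmul (homog H) (tens a b) (tens c d) =
  \sum_(i : bool) \sum_(j : bool)
    (-1) ^+ (i && j) *: tens (a * hproj (homog H) j c) (hproj (homog H) i b * d).
Proof.
have [tl tr] := tens_bilin H H.
rewrite /tmul tlift_tens; first rewrite tlift_tens //.
  split=> [v e u1 u2|u e v1 v2]; rewrite scaler_sumr -big_split;
  apply: eq_bigr => i _; rewrite scaler_sumr -big_split; apply: eq_bigr => j _ /=.
    rewrite linearP mulrDr -scalerAr tl scalerDr; congr (_ + _).
    by rewrite !scalerA mulrC.
  rewrite mulrDr -scalerAr tr scalerDr; congr (_ + _).
  by rewrite !scalerA mulrC.
split=> [v e u1 u2|u e v1 v2]; rewrite -tliftZ -tliftD; apply: eq_tlift => c' d';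
  rewrite scaler_sumr -big_split; apply: eq_bigr => i _;
  rewrite scaler_sumr -big_split; apply: eq_bigr => j _ /=.
  rewrite mulrDl -scalerAl tl scalerDr; congr (_ + _).
  by rewrite !scalerA mulrC.
rewrite linearP mulrDl -scalerAl tr scalerDr; congr (_ + _).
by rewrite !scalerA mulrC.
Qed.

Let T0 := tensv (homog H false) (homog H false).

Lemma tmul_even s t : s \in T0 -> t \in T0 -> tmul (homog H) s t \in T0.
Proof.
move=> sT tT; have [tl tr] := tmul_bilin.
pose Ls : {linear tensor H H -> tensor H H} := tlift (fun a b => tlift (fun c d =>
    \sum_(i : bool) \sum_(j : bool)
      (-1) ^+ (i && j) *: tens (a * hproj (homog H) j c) (hproj (homog H) i b * d)) t).
apply: (tensvP (L := Ls)) sT => a b aH bH; rewrite -[Ls _]/(tmul _ _ _).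
pose Lt := GRing.isSemilinear.Build k (tensor H H) (tensor H H) _
  (tmul (homog H) (tens a b)) (GRing.semilinear_linear (tr (tens a b))).
pose Lt' : {linear tensor H H -> tensor H H} := HB.pack (tmul (homog H) (tens a b)) Lt.
apply: (tensvP (L := Lt')) tT => c d cH dH; rewrite -[Lt' _]/(tmul _ _ _) tmul_tens.
apply: memv_suml => i _; apply: memv_suml => j _; apply: memvZ.
have even_proj (x : H) l : x \in homog H false -> hproj (homog H) l x \in homog H false.
  case: l => xH; last exact: hproj_mem.
  by rewrite (hproj_neg0 (homog_grading H) xH) mem0v.
by apply: memv_tens; apply: (@homogM _ H false false); rewrite ?even_proj.
Qed.

Lemma underline_is_aspace : is_aspace (comul H @^-1: T0)%VS.
Proof.
apply/andP; split.
  apply: has_algid1; rewrite -memv_preim comul1.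
  by apply: memv_tens; apply: homog1.
apply/prodvP => a b; rewrite -!memv_preim => aT bT.
by rewrite comulM tmul_even.
Qed.

(* The largest purely even sub Hopf algebra, Delta^-1 (H_0 (x) H_0). *)
Definition underline : {aspace H} := ASpace underline_is_aspace.

Definition prim_defect (h : H) : tensor H H := comul H h - (tens h 1 + tens 1 h).

Lemma prim_defect_is_linear : linear prim_defect.
Proof.
have [tl tr] := tens_bilin H H.
move=> a x y; rewrite /prim_defect linearP tl tr scalerBr scalerDr.
by rewrite [X in - X]addrACA opprD addrACA.
Qed.

HB.instance Definition _ := GRing.isSemilinear.Build k H (tensor H H) _
  prim_defect (GRing.semilinear_linear prim_defect_is_linear).

Definition primitives : {vspace H} := lker (linfun prim_defect).

Lemma primitivesP h :
  reflect (comul H h = tens h 1 + tens 1 h) (h \in primitives).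
Proof. by rewrite memv_ker lfunE subr_eq0; apply: eqP. Qed.

Definition odd_primitives : {vspace H} := (primitives :&: homog H true)%VS.

(* [a, b] = a b - (-1)^(|a||b|) b a for homogeneous a and b. *)
Definition superbracket (a b : H) : H :=
  \sum_(i : bool) \sum_(j : bool)
    (hproj (homog H) i a * hproj (homog H) j b -
     (-1) ^+ (i && j) *: (hproj (homog H) j b * hproj (homog H) i a)).

Lemma superbracket_homog i j a b : a \in homog H i -> b \in homog H j ->
  superbracket a b = a * b - (-1) ^+ (i && j) *: (b * a).
Proof.
move=> ai bj; have g := homog_grading H; rewrite /superbracket !big_bool /=.
have := (hproj_neg0 g ai, hproj_neg0 g bj, hproj_id g ai, hproj_id g bj).
by case: i {ai} => /=; case: j {bj} => /= -[[[-> ->] ->] ->];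
  rewrite !(mul0r, mulr0, scaler0, oppr0, add0r, addr0).
Qed.

End SuperHopfTheory.

Arguments underline {k} H.
Arguments odd_primitives {k} H.

(* Left modules, ungraded even when A carries a grading. *)
Record fdmod (k : fieldType) (A : falgType k) := FdMod {
  mod_sort :> vectType k;
  act : A -> 'End(mod_sort);
  act_linear : linear act;
  act1 : act 1 = \1%VF;
  actM : forall a b, act (a * b) = (act a \o act b)%VF
}.

Section Modules.

Variables (k : fieldType) (A : falgType k).

Definition submod (M : fdmod A) (U : {vspace M}) : Prop :=
  forall a u, u \in U -> act M a u \in U.

Definition indecomposable (M : fdmod A) : Prop :=
  (fullv : {vspace M}) <> 0%VS /\
  forall U W : {vspace M}, submod U -> submod W ->
    (U + W)%VS = fullv -> (U :&: W)%VS = 0%VS -> U = 0%VS \/ W = 0%VS.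

Definition mod_iso (M N : fdmod A) : Prop :=
  exists2 f : 'Hom(M, N), bijective f &
    forall a u, f (act M a u) = act N a (f u).

Definition finite_rep_type : Prop :=
  exists (n : nat) (L : 'I_n -> fdmod A),
  forall M : fdmod A, indecomposable M -> exists i, mod_iso M (L i).

Definition simple_submod (M : fdmod A) (U : {vspace M}) : Prop :=
  [/\ submod U, U <> 0%VS &
      forall W : {vspace M}, submod W -> (W <= U)%VS -> W = 0%VS \/ W = U].

Definition semisimple_mod (M : fdmod A) : Prop :=
  exists (n : nat) (S : 'I_n -> {vspace M}),
  [/\ forall i, simple_submod (S i), directv (\sum_i S i) &
      (\sum_i S i)%VS = fullv].

Lemma amull_comp (a b : A) : amull (a * b) = (amull a \o amull b)%VF.
Proof. by apply/lfunP => x; rewrite comp_lfunE !lfunE /= mulrA. Qed.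

Definition regular_mod : fdmod A :=
  FdMod (@amull_is_linear k A) (amull1 A) amull_comp.

Definition semisimple : Prop := semisimple_mod regular_mod.

End Modules.

(* Main.v *)
(* Let A be the bosonization of H by the parity automorphism and call a module
   acyclic when ker y = im y. Finite representation type provides a weakly
   initial pair (K, kappa) among the acyclic A-modules with a chosen invariant.
   Since Hom(K, Y) is acyclic for every module Y, comparing (K, kappa) with a
   suitable acyclic submodule of K + Hom(K^*, F), F free, shows that kappa is a
   sum of terms Lambda_j v_j with Lambda_j left integrals of A.
   Write U for the underlying ordinary Hopf algebra of H. Being self-injective,
   U is a U-linear retract of H, and an even form on H which restricts to the
   counit on U is a unit of H^*, because even forms vanishing on U are nilpotent.
   Hence the U-invariant forms on H are an acyclic module, with invariant the
   counit of H. Mapping kappa to it yields a left integral l of H and a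
   U-invariant form f with f(l) <> 0. The retraction, twisted by f, carries l to
   a left integral of U on which the counit does not vanish, and Maschke's theorem
   applies. *)

Require Import Defs.
From HB Require Import structures.
From Stdlib Require Classical_Prop.
From mathcomp Require Import all_boot all_order all_algebra all_field.

Set Implicit Arguments.
Unset Strict Implicit.
Unset Printing Implicit Defensive.

Import GRing.Theory.

Local Open Scope ring_scope.

(** * Ordinary Hopf algebras and convolution *)

(** Semisimplicity asks for an integral, while the hypothesis speaks of modules. The link is a
    trace: an equivariant map from K to Hom(K^*, F) has a trace in F, which is an invariant, and an
    invariant of a free module is a family of left integrals. Such a map would come from a lift to F
    of v |-> (xi |-> v (x) xi), which need not exist. It is required only modulo the maps with image
    in <kappa>: the pairs of a vector and a partial lift form an acyclic module, to which (K, kappa)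
    can be mapped. The error is harmless: kappa = y w by acyclicity, so an equivariant map with
    image in <kappa> kills kappa. The trivial module is not acyclic, so the integrals cannot be
    tested on it; the U-invariant forms take its place. Their acyclicity rests on an odd U-invariant
    form with value 1 at y, built from the retraction of H onto U. Bosonization trades the sign rule
    for a skew-primitive y, so that modules of linear maps are the usual ones. The weakly initial
    pair is constructed over H and then induced to A. *)

Record hopfAlgebra (k : fieldType) := HopfAlgebra {
  ha_sort :> falgType k;
  hdelta : 'Hom(ha_sort, tensor ha_sort ha_sort);
  heps : 'Hom(ha_sort, k^o);
  hanti : 'End(ha_sort);
  hdeltaA : forall h,
    tlift (fun u v => tens u (hdelta v)) (hdelta h) =
    tlift (fun u v => tlift (fun u1 u2 => tens u1 (tens u2 v)) (hdelta u))
      (hdelta h);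
  hepsl : forall h, tlift (fun u v => heps u *: v) (hdelta h) = h;
  hepsr : forall h, tlift (fun u v => heps v *: u) (hdelta h) = h;
  hdelta1 : hdelta 1 = tens 1 1;
  hdeltaM : forall a b, hdelta (a * b) =
    tlift (fun a1 a2 => tlift (fun b1 b2 => tens (a1 * b1) (a2 * b2))
      (hdelta b)) (hdelta a);
  heps1 : heps 1 = 1;
  hepsM : forall a b, heps (a * b) = heps a * heps b;
  hantil : forall h, tlift (fun u v => hanti u * v) (hdelta h) = heps h *: 1;
  hantir : forall h, tlift (fun u v => u * hanti v) (hdelta h) = heps h *: 1
}.

Arguments hdelta {k} _.
Arguments heps {k} _.
Arguments hanti {k} _.

Section LinearHom.

Variables (k : fieldType) (U V : vectType k) (f : U -> V).

Definition linear_hom (fl : linear f) : 'Hom(U, V) :=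
  let fP := GRing.isSemilinear.Build k U V _ f (GRing.semilinear_linear fl) in
  let F : {linear U -> V} := HB.pack f fP in linfun F.

Lemma linear_homE (fl : linear f) u : linear_hom fl u = f u.
Proof. by rewrite lfunE. Qed.

End LinearHom.

Lemma linear_tlift_param (k : fieldType) (U V : vectType k) (X W : lmodType k)
    (F : X -> U -> V -> W) t :
  (forall u v, linear (fun x => F x u v)) -> linear (fun x => tlift (F x) t).
Proof.
move=> lF c x y; rewrite -tliftZ -tliftD; apply: eq_tlift => u v.
exact: lF.
Qed.

Lemma tlift_eq0 (k : fieldType) (U V : vectType k) (W : lmodType k)
    (f : U -> V -> W) t : (forall u v, f u v = 0) -> tlift f t = 0.
Proof.
by move=> f0; rewrite /tlift big1 // => i _; rewrite big1 // => j _;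
  rewrite f0 scaler0.
Qed.

Lemma tlift_lfunE (k : fieldType) (U V X Y : vectType k)
    (f : U -> V -> 'Hom(X, Y)) t x :
  tlift f t x = tlift (fun u v => f u v x) t.
Proof.
rewrite /tlift sum_lfunE; apply: eq_bigr => i _; rewrite sum_lfunE.
by apply: eq_bigr => j _; rewrite scale_lfunE.
Qed.

Lemma bilin_comp_lfun (k : fieldType) (U V X Y Z : vectType k)
    (F : {linear U -> 'Hom(Y, Z)}) (G : {linear V -> 'Hom(X, Y)}) :
  bilin (fun u v => (F u \o G v)%VF).
Proof.
split=> [v c u1 u2|u c v1 v2] /=; rewrite linearP.
  by rewrite comp_lfunDl comp_lfunZl.
by rewrite comp_lfunDr comp_lfunZr.
Qed.

HB.instance Definition _ (k : fieldType) (A : falgType k) (M : fdmod A) :=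
  GRing.isSemilinear.Build k A _ _
  (act M) (GRing.semilinear_linear (act_linear M)).

Lemma act_comp (k : fieldType) (A : falgType k) (M : fdmod A) a b x :
  act M (a * b) x = act M a (act M b x).
Proof. by rewrite actM comp_lfunE. Qed.

Lemma act_id (k : fieldType) (A : falgType k) (M : fdmod A) x : act M 1 x = x.
Proof. by rewrite act1 id_lfunE. Qed.

Section Convolution.

Variables (k : fieldType) (A : hopfAlgebra k).

Implicit Types X Y Z T : vectType k.

(** Composition of operator-valued maps along the coproduct. For this product [rho M] is invertible
    with inverse [rhoS M], so Sweedler computations with the antipode reduce to cancelling
    [rho M]. *)
Definition conv X Y Z (F : 'Hom(A, 'Hom(Y, Z))) (G : 'Hom(A, 'Hom(X, Y))) :
    'Hom(A, 'Hom(X, Z)) :=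
  linfun (tlift (fun u v => (F u \o G v)%VF) \o hdelta A).

Lemma convE X Y Z (F : 'Hom(A, 'Hom(Y, Z))) (G : 'Hom(A, 'Hom(X, Y))) a :
  conv F G a = tlift (fun u v => (F u \o G v)%VF) (hdelta A a).
Proof. by rewrite lfunE. Qed.

Lemma conv_apply X Y Z (F : 'Hom(A, 'Hom(Y, Z))) (G : 'Hom(A, 'Hom(X, Y))) a x :
  conv F G a x = tlift (fun u v => F u (G v x)) (hdelta A a).
Proof.
by rewrite convE tlift_lfunE; apply: eq_tlift => u v; rewrite comp_lfunE.
Qed.

Lemma convA X Y Z T (F : 'Hom(A, 'Hom(Z, T))) (G : 'Hom(A, 'Hom(Y, Z)))
    (H : 'Hom(A, 'Hom(X, Y))) : conv F (conv G H) = conv (conv F G) H.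
Proof.
apply/lfunP => a; rewrite !convE.
pose psi : {linear tensor A A -> 'Hom(X, Z)} :=
  tlift (fun c d => (G c \o H d)%VF).
pose Psi : {linear tensor A (tensor A A) -> 'Hom(X, T)} :=
  tlift (fun a w => (F a \o psi w)%VF).
have psiE c d : psi (tens c d) = (G c \o H d)%VF.
  by apply: tlift_tens; apply: bilin_comp_lfun.
have PsiE b w : Psi (tens b w) = (F b \o psi w)%VF.
  by apply: tlift_tens; apply: bilin_comp_lfun.
have /(congr1 Psi) := hdeltaA a; rewrite !linear_tlift => e.
transitivity (tlift (fun u v => Psi (tens u (hdelta A v))) (hdelta A a)).
  by apply: eq_tlift => u v; rewrite PsiE convE.
rewrite e; apply: eq_tlift => u v; rewrite linear_tlift convE.
apply/lfunP => x; rewrite tlift_lfunE comp_lfunE tlift_lfunE.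
by apply: eq_tlift => c d; rewrite PsiE psiE !comp_lfunE.
Qed.

Lemma cst_is_linear X Y (f : 'Hom(X, Y)) : linear (fun a : A => heps A a *: f).
Proof. by move=> c a b; rewrite linearP scalerDl scalerA. Qed.

Definition cst X Y (f : 'Hom(X, Y)) : 'Hom(A, 'Hom(X, Y)) :=
  linear_hom (cst_is_linear f).

Lemma cstE X Y (f : 'Hom(X, Y)) a : cst f a = heps A a *: f.
Proof. exact: linear_homE. Qed.

Lemma conv_cstl X Y Z (f : 'Hom(Y, Z)) (G : 'Hom(A, 'Hom(X, Y))) a :
  conv (cst f) G a = (f \o G a)%VF.
Proof.
apply/lfunP => x; rewrite conv_apply comp_lfunE -[in RHS](hepsl a).
rewrite linear_tlift tlift_lfunE linear_tlift; apply: eq_tlift => u v.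
by rewrite cstE scale_lfunE linearZ scale_lfunE linearZ.
Qed.

Lemma conv_cstr X Y Z (F : 'Hom(A, 'Hom(Y, Z))) (g : 'Hom(X, Y)) a :
  conv F (cst g) a = (F a \o g)%VF.
Proof.
apply/lfunP => x; rewrite conv_apply comp_lfunE -[in RHS](hepsr a).
rewrite linear_tlift tlift_lfunE; apply: eq_tlift => u v.
by rewrite cstE scale_lfunE !linearZ scale_lfunE.
Qed.

Lemma conv1r X Y (G : 'Hom(A, 'Hom(X, Y))) : conv G (cst \1%VF) = G.
Proof. by apply/lfunP => a; rewrite conv_cstr comp_lfun1r. Qed.

Definition rho (M : fdmod A) : 'Hom(A, 'End(M)) := linfun (act M).
Definition rhoS (M : fdmod A) : 'Hom(A, 'End(M)) := linfun (act M \o hanti A).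

Lemma rhoE M a : rho M a = act M a. Proof. by rewrite lfunE. Qed.
Lemma rhoSE M a : rhoS M a = act M (hanti A a). Proof. by rewrite lfunE. Qed.

Lemma act_eps (M : fdmod A) c : act M (c *: 1) = c *: \1%VF.
Proof. by rewrite linearZ /= act1. Qed.

Lemma rho_rhoS M : conv (rho M) (rhoS M) = cst \1%VF.
Proof.
apply/lfunP => a; rewrite convE cstE -act_eps -hantir linear_tlift.
by apply: eq_tlift => u v; rewrite rhoE rhoSE /= actM.
Qed.

Lemma rhoS_rho M : conv (rhoS M) (rho M) = cst \1%VF.
Proof.
apply/lfunP => a; rewrite convE cstE -act_eps -hantil linear_tlift.
by apply: eq_tlift => u v; rewrite rhoE rhoSE /= actM.
Qed.

Lemma conv_rho_canr (X : fdmod A) Y (F G : 'Hom(A, 'Hom(X, Y))) :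
  conv F (rho X) = G -> F = conv G (rhoS X).
Proof. by move=> <-; rewrite -convA rho_rhoS conv1r. Qed.

End Convolution.

(** * Modules of linear maps *)

Definition equivariant (k : fieldType) (A : falgType k) (M N : fdmod A)
    (f : 'Hom(M, N)) : Prop :=
  forall a x, f (act M a x) = act N a (f x).

Section SubModule.

Variables (k : fieldType) (A : falgType k) (M : fdmod A) (U : {vspace M}).
Hypothesis sU : submod U.

Lemma sub_rep_linear a : linear (fun u : subvs_of U => vsproj U (act M a (vsval u))).
Proof. by move=> c u v; rewrite !linearP. Qed.

Definition sub_rep a : 'End(subvs_of U) := linear_hom (sub_rep_linear a).

Lemma sub_repE a u : vsval (sub_rep a u) = act M a (vsval u).
Proof. by rewrite linear_homE vsprojK // sU // subvsP. Qed.

Lemma sub_repl : linear sub_rep.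
Proof.
move=> c a b; apply/lfunP => u; apply: (can_inj (@vsvalK _ _ U)).
by rewrite add_lfunE scale_lfunE !linearP /= !sub_repE act_linear /= add_lfunE scale_lfunE.
Qed.

Lemma sub_rep1 : sub_rep 1 = \1%VF.
Proof. by apply/lfunP => u; apply: (can_inj (@vsvalK _ _ U)); rewrite sub_repE act1 !id_lfunE. Qed.

Lemma sub_repM a b : sub_rep (a * b) = (sub_rep a \o sub_rep b)%VF.
Proof.
by apply/lfunP => u; apply: (can_inj (@vsvalK _ _ U)); rewrite comp_lfunE !sub_repE actM comp_lfunE.
Qed.

Definition sub_mod : fdmod A := FdMod sub_repl sub_rep1 sub_repM.

Lemma sub_modE a (u : sub_mod) : vsval (act sub_mod a u) = act M a (vsval u).
Proof. exact: sub_repE. Qed.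

End SubModule.

Lemma bilin_mul (k : fieldType) (A : falgType k) (f g : {linear A -> A}) :
  bilin (fun a b : A => f a * g b).
Proof.
split=> [v c a b|u c a b] /=; rewrite linearP.
  by rewrite mulrDl scalerAl.
by rewrite mulrDr scalerAr.
Qed.

Section HopfModules.

Variables (k : fieldType) (A : hopfAlgebra k).

(** Cancellation of [rho] for the regular module, read off at 1. *)
Lemma hanti_canr (f g : 'End(A)) :
  (forall a, tlift (fun u v => f u * v) (hdelta A a) = g a) ->
  forall a, f a = tlift (fun u v => g u * hanti A v) (hdelta A a).
Proof.
move=> fg a; pose R := regular_mod A.
pose F (h : 'End(A)) : 'Hom(A, 'Hom(R, R)) := linfun (@amull _ A \o h).
have FE h b x : F h b x = h b * x by rewrite lfunE /= lfunE.
have RE b x : act R b x = b * x by rewrite lfunE.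
have e : conv (F f) (rho R) = F g.
  apply/lfunP=> b; apply/lfunP=> x; rewrite conv_apply FE -fg tlift_mulr.
  by apply: eq_tlift => u v; rewrite FE rhoE RE mulrA.
have /lfunP/(_ a)/lfunP/(_ 1) := conv_rho_canr e.
rewrite conv_apply FE mulr1 => ->; apply: eq_tlift => u v.
by rewrite FE rhoSE RE mulr1.
Qed.

(** Two cancellations by [hanti_canr]: S(a_1 b_1) a_2 b_2 = eps(ab) gives S(a_1 b) a_2 = eps(a) S(b)
    on cancelling b, then S(ab) = S(b) S(a) on cancelling a. *)
Lemma hantiM a b : hanti A (a * b) = hanti A b * hanti A a.
Proof.
pose S := hanti A.
have lf a0 : linear (fun b0 => tlift (fun a1 a2 => S (a1 * b0) * a2) (hdelta A a0)).
  apply: linear_tlift_param => u v c b1 b2.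
  by rewrite mulrDr -scalerAr linearP mulrDl scalerAl.
have lg (c : k) : linear (fun b0 : A => (c * heps A b0) *: (1 : A)).
  by move=> d b1 b2; rewrite linearP mulrDr scalerDl scalerA mulrCA.
have e1 a0 b0 : tlift (fun a1 a2 => S (a1 * b0) * a2) (hdelta A a0) =
    heps A a0 *: S b0.
  rewrite -(linear_homE (lf a0)) (@hanti_canr (linear_hom (lf a0)) (linear_hom (lg (heps A a0)))).
    rewrite -[in RHS](hepsl b0) linear_tlift -(tliftZ _ (W := A)); apply: eq_tlift => u v /=.
    by rewrite linear_homE -scalerAl mul1r linearZ scalerA.
  move=> b1; rewrite linear_homE -hepsM -hantil hdeltaM linear_tlift.
  under [LHS]eq_tlift do rewrite linear_homE tlift_mulr.
  rewrite tlift_exchange; apply: eq_tlift => u v.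
  rewrite linear_tlift; apply: eq_tlift => c d /=; rewrite -mulrA.
  rewrite (tlift_tens (f := fun x y => S x * y)) //.
  exact: (bilin_mul (hanti A) idfun).
have lf' : linear (fun a0 => S (a0 * b)).
  by move=> c u v; rewrite mulrDl -scalerAl linearP.
have lg' : linear (fun a0 => heps A a0 *: S b).
  by move=> c u v; rewrite linearP scalerDl scalerA.
rewrite -/S -(linear_homE lf') (@hanti_canr (linear_hom lf') (linear_hom lg')).
  rewrite -[in RHS](hepsl a) linear_tlift tlift_mull; apply: eq_tlift => u v /=.
  by rewrite linear_homE linearZ -scalerAl -scalerAr.
move=> a0; rewrite linear_homE -e1; apply: eq_tlift => u v.
by rewrite linear_homE.
Qed.

Lemma hanti1 : hanti A 1 = 1.
Proof.
have := hantil (1 : A); rewrite hdelta1 heps1 scale1r.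
rewrite (tlift_tens (f := fun u v => hanti A u * v)) ?mulr1 //.
exact: (bilin_mul (hanti A) idfun).
Qed.

Lemma heps_anti a : heps A (hanti A a) = heps A a.
Proof.
have := congr1 (heps A) (hantil a); rewrite linearZ /= heps1 [RHS]mulr1 => <-.
rewrite -[in LHS](hepsr a) linear_tlift /= !linear_tlift; apply: eq_tlift => u v.
by rewrite /= !linearZ hepsM mulrC.
Qed.

Section HomModule.

Variables X Y : fdmod A.

Definition hom_act (a : A) (f : 'Hom(X, Y)) : 'Hom(X, Y) :=
  tlift (fun u v => (act Y u \o f \o act X (hanti A v))%VF) (hdelta A a).

Lemma hom_actE a f : hom_act a f = conv (rho Y) (conv (cst A f) (rhoS X)) a.
Proof.
rewrite convE; apply: eq_tlift => u v.
by rewrite conv_cstl rhoE rhoSE comp_lfunA.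
Qed.

Lemma hom_act_apply a f x :
  hom_act a f x = tlift (fun u v => act Y u (f (act X (hanti A v) x))) (hdelta A a).
Proof.
by rewrite tlift_lfunE; apply: eq_tlift => u v; rewrite !comp_lfunE.
Qed.

Lemma hom_act_linearr a : linear (hom_act a).
Proof.
move=> c f g; apply/lfunP => x; rewrite add_lfunE scale_lfunE !hom_act_apply.
rewrite -tliftZ -tliftD; apply: eq_tlift => u v.
by rewrite add_lfunE scale_lfunE linearP.
Qed.

Definition hom_rep a : 'End('Hom(X, Y)) := linear_hom (hom_act_linearr a).

Lemma hom_rep_linear : linear hom_rep.
Proof.
move=> c a b; apply/lfunP => f; rewrite add_lfunE scale_lfunE !linear_homE.
by rewrite /hom_act !linearP.
Qed.

Lemma hom_rep1 : hom_rep 1 = \1%VF.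
Proof.
apply/lfunP => f; rewrite linear_homE id_lfunE; apply/lfunP => x.
rewrite hom_act_apply hdelta1.
rewrite (tlift_tens (f := fun u v => act Y u (f (act X (hanti A v) x)))).
  by rewrite hanti1 !act_id.
split=> [v c a b|u c a b] /=.
  by rewrite linearP add_lfunE scale_lfunE.
by rewrite !linearP add_lfunE scale_lfunE !linearP.
Qed.

Lemma hom_repM a b : hom_rep (a * b) = (hom_rep a \o hom_rep b)%VF.
Proof.
apply/lfunP => f; rewrite comp_lfunE !linear_homE; apply/lfunP => x.
rewrite !hom_act_apply hdeltaM linear_tlift; apply: eq_tlift => a1 a2.
rewrite hom_act_apply !linear_tlift; apply: eq_tlift => b1 b2 /=.
rewrite (tlift_tens (f := fun u v => act Y u (f (act X (hanti A v) x)))).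
  by rewrite hantiM !act_comp.
split=> [v c u w|u c v w] /=.
  by rewrite linearP add_lfunE scale_lfunE.
by rewrite !linearP add_lfunE scale_lfunE !linearP.
Qed.

Definition hom_mod : fdmod A := FdMod hom_rep_linear hom_rep1 hom_repM.

Lemma hom_modE a (f : hom_mod) : act hom_mod a f = hom_act a f.
Proof. exact: linear_homE. Qed.

End HomModule.

Definition is_invariant (M : fdmod A) (m : M) : Prop :=
  forall a, act M a m = heps A a *: m.

(** The action on Hom(X, Y) is the only family with (a_1 f)(a_2 x) = a f(x). This criterion contains
    no antipode, which keeps the equivariance checks short. *)
Lemma hom_act_canr (X Y : fdmod A) (G : 'Hom(A, 'Hom(X, Y))) f :
  conv G (rho X) = conv (rho Y) (cst A f) -> forall a, G a = hom_act a f.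
Proof.
by move=> e a; rewrite hom_actE (conv_rho_canr e) convA.
Qed.

Lemma hom_act_canl (X Y : fdmod A) (f : 'Hom(X, Y)) (G : 'Hom(A, 'Hom(X, Y))) :
  (forall a, G a = hom_act a f) -> conv G (rho X) = conv (rho Y) (cst A f).
Proof.
move=> e; have -> : G = conv (rho Y) (conv (cst A f) (rhoS X)).
  by apply/lfunP => a; rewrite e hom_actE.
by rewrite -!convA rhoS_rho conv1r.
Qed.

Lemma invariant_hom (X Y : fdmod A) (f : hom_mod X Y) :
  is_invariant f <-> equivariant (f : 'Hom(X, Y)).
Proof.
have e : conv (cst A f) (rho X) = conv (rho Y) (cst A f) <-> equivariant (f : 'Hom(X, Y)).
  split=> [e a x|fe].
    have /lfunP/(_ a)/lfunP/(_ x) := e.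
    by rewrite conv_cstl conv_cstr rhoE rhoE !comp_lfunE.
  apply/lfunP => a; rewrite conv_cstl conv_cstr !rhoE.
  by apply/lfunP => x; rewrite !comp_lfunE.
split=> [fi|/e h].
  by apply/e; apply: hom_act_canl => a; rewrite -hom_modE fi cstE.
by move=> a; rewrite hom_modE -(hom_act_canr h) cstE.
Qed.

Lemma hom_act_inv (X Y : fdmod A) (f : 'Hom(X, Y)) (x : X) a :
  is_invariant x -> hom_act a f x = act Y a (f x).
Proof.
move=> xi; rewrite hom_act_apply -[in RHS](hepsr a) linear_tlift /= tlift_lfunE.
apply: eq_tlift => u v /=.
by rewrite xi heps_anti !linearZ /= scale_lfunE.
Qed.

Lemma triv_linear : linear (fun a : A => heps A a *: (\1%VF : 'End(k^o))).
Proof. by move=> c a b; rewrite linearP scalerDl scalerA. Qed.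

Lemma triv1 : heps A 1 *: (\1%VF : 'End(k^o)) = \1%VF.
Proof. by rewrite heps1 scale1r. Qed.

Lemma trivM a b : heps A (a * b) *: (\1%VF : 'End(k^o)) =
  ((heps A a *: \1) \o (heps A b *: \1))%VF.
Proof. by rewrite hepsM -comp_lfunZl -comp_lfunZr comp_lfun1l scalerA. Qed.

Definition triv_mod : fdmod A := FdMod triv_linear triv1 trivM.

Lemma triv_modE a (c : triv_mod) : act triv_mod a c = heps A a *: c.
Proof. by rewrite scale_lfunE id_lfunE. Qed.

End HopfModules.

(** * Acyclic modules and left integrals *)

Section RankOne.

Variable k : fieldType.

Lemma rank1_linear (X Y : vectType k) (xi : 'Hom(X, k^o)) (v : Y) :
  linear (fun u => (xi u : k) *: v).
Proof. by move=> c u w; rewrite linearP scalerDl scalerA. Qed.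

Definition rank1 (X Y : vectType k) (v : Y) (xi : 'Hom(X, k^o)) : 'Hom(X, Y) :=
  linear_hom (rank1_linear xi v).

Lemma rank1E (X Y : vectType k) (v : Y) (xi : 'Hom(X, k^o)) u :
  rank1 v xi u = (xi u : k) *: v.
Proof. exact: linear_homE. Qed.

Lemma rank1_is_linear (X Y : vectType k) (v : Y) :
  linear (fun xi : 'Hom(X, k^o) => rank1 v xi).
Proof.
move=> c a b; apply/lfunP => u; rewrite add_lfunE scale_lfunE !rank1E.
by rewrite add_lfunE scale_lfunE scalerDl scalerA.
Qed.

(** Coevaluation v |-> (xi |-> v (x) xi), with v (x) xi read as an operator of rank at most one. *)
Definition rank1_hom (X Y : vectType k) (v : Y) : 'Hom('Hom(X, k^o), 'Hom(X, Y)) :=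
  linear_hom (rank1_is_linear v).

Lemma rank1_homE (X Y : vectType k) (v : Y) (xi : 'Hom(X, k^o)) u :
  rank1_hom X v xi u = (xi u : k) *: v.
Proof. by rewrite linear_homE rank1E. Qed.

Lemma rank1_hom_linear (X Y : vectType k) : linear (@rank1_hom X Y).
Proof.
move=> c v w; apply/lfunP => xi; apply/lfunP => u.
rewrite !(add_lfunE, scale_lfunE) !rank1_homE.
by rewrite scalerDr !scalerA mulrC.
Qed.

Lemma rank1_hom0 (X Y : vectType k) : rank1_hom X (0 : Y) = 0.
Proof.
by apply/lfunP => xi; apply/lfunP => u; rewrite rank1_homE scaler0 !zero_lfunE.
Qed.

Definition dual_basis (V : vectType k) (i : 'I_(\dim {:V})) : 'Hom(V, k^o) :=
  linfun (coord (vbasis {:V}) i : V -> k^o).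

Arguments dual_basis V i : clear implicits.

Lemma dual_basisE (V : vectType k) i (v : V) :
  dual_basis V i v = coord (vbasis {:V}) i v.
Proof. by rewrite lfunE. Qed.

(** The canonical element of V (x) V^* absorbs an operator on either side, so T passes from the dual
    basis to the basis. *)
Lemma dual_basis_comp (V W : vectType k) (B : 'Hom(V, 'Hom('Hom(V, k^o), W)))
    (T : 'End(V)) :
  \sum_(i < \dim {:V}) B (vbasis {:V})`_i (dual_basis V i \o T)%VF =
  \sum_(i < \dim {:V}) B (T (vbasis {:V})`_i) (dual_basis V i).
Proof.
have eT i : (dual_basis V i \o T)%VF =
    \sum_(l < \dim {:V}) coord (vbasis {:V}) i (T (vbasis {:V})`_l) *: dual_basis V l.
  apply/lfunP => u; rewrite comp_lfunE sum_lfunE dual_basisE.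
  rewrite {1}(coord_vbasis (memvf u)) !linear_sum; apply: eq_bigr => l _ /=.
  by rewrite !linearZ /= scale_lfunE dual_basisE mulrC.
under eq_bigr => i _ do rewrite eT linear_sum.
rewrite exchange_big; apply: eq_bigr => l _ /=.
rewrite [in RHS](coord_vbasis (memvf (T _))) linear_sum sum_lfunE.
by apply: eq_bigr => i _; rewrite !linearZ scale_lfunE.
Qed.

End RankOne.

Arguments dual_basis {k} V i.

Section ProductModule.

Variables (k : fieldType) (A : falgType k) (M N : fdmod A).

Lemma prod_act_linear a :
  linear (fun z : M * N => (act M a z.1, act N a z.2) : M * N).
Proof. by move=> c z w; rewrite /= !linearP. Qed.

Definition prod_act a : 'End((M * N)%type) := linear_hom (prod_act_linear a).

Lemma prod_actE a z : prod_act a z = (act M a z.1, act N a z.2).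
Proof. exact: linear_homE. Qed.

Lemma prod_actl : linear prod_act.
Proof.
move=> c a b; apply/lfunP => z; rewrite add_lfunE scale_lfunE !prod_actE.
by rewrite !act_linear !add_lfunE !scale_lfunE.
Qed.

Lemma prod_act1 : prod_act 1 = \1%VF.
Proof.
by apply/lfunP => -[u v]; rewrite prod_actE !act1 !id_lfunE.
Qed.

Lemma prod_actM a b : prod_act (a * b) = (prod_act a \o prod_act b)%VF.
Proof.
by apply/lfunP => z; rewrite comp_lfunE !prod_actE !actM !comp_lfunE.
Qed.

Definition prod_mod : fdmod A := FdMod prod_actl prod_act1 prod_actM.

Lemma prod_mod1 a (z : prod_mod) : (act prod_mod a z).1 = act M a z.1.
Proof. by rewrite prod_actE. Qed.

Lemma prod_mod2 a (z : prod_mod) : (act prod_mod a z).2 = act N a z.2.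
Proof. by rewrite prod_actE. Qed.

End ProductModule.

Section FreeModule.

Variables (k : fieldType) (A : falgType k) (d : nat).

Lemma free_act_linear a :
  linear (fun z : {ffun 'I_d -> A} => [ffun j => a * z j]).
Proof.
by move=> c z w; apply/ffunP => j; rewrite !ffunE mulrDr scalerAr.
Qed.

Definition free_act a : 'End({ffun 'I_d -> A}) := linear_hom (free_act_linear a).

Lemma free_actE a z : free_act a z = [ffun j => a * z j].
Proof. exact: linear_homE. Qed.

Lemma free_actl : linear free_act.
Proof.
move=> c a b; apply/lfunP => z; rewrite add_lfunE scale_lfunE !free_actE.
by apply/ffunP => j; rewrite !ffunE mulrDl scalerAl.
Qed.

Lemma free_act1 : free_act 1 = \1%VF.
Proof.
by apply/lfunP => z; rewrite free_actE id_lfunE; apply/ffunP => j; rewrite ffunE mul1r.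
Qed.

Lemma free_actM a b : free_act (a * b) = (free_act a \o free_act b)%VF.
Proof.
apply/lfunP => z; rewrite comp_lfunE !free_actE.
by apply/ffunP => j; rewrite !ffunE mulrA.
Qed.

Definition free_mod : fdmod A := FdMod free_actl free_act1 free_actM.

Lemma free_modE a (z : free_mod) j : act free_mod a z j = a * z j.
Proof. by rewrite free_actE ffunE. Qed.

End FreeModule.

(** The other inclusion, im y in ker y, comes from y * y = 0. *)
Definition acyclic (k : fieldType) (A : falgType k) (y : A) (M : fdmod A) : Prop :=
  forall m, act M y m = 0 -> exists m', m = act M y m'.

Section Acyclic.

Variables (k : fieldType) (A : hopfAlgebra k) (s y : A).
Hypotheses (k2 : 2%:R != 0 :> k) (ss : s * s = 1) (sy : s * y = - (y * s)).
Hypotheses (yy : y * y = 0) (ds : hdelta A s = tens s s).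
Hypothesis dy : hdelta A y = tens y 1 + tens s y.

Lemma heps_s : heps A s = 1.
Proof.
have bf : bilin (fun u v : A => heps A u *: v).
  split=> [v c a b|u c a b] /=; first by rewrite linearP scalerDl scalerA.
  by rewrite scalerDr !scalerA mulrC.
have e : (heps A s - 1 : k) *: s = 0.
  by rewrite scalerBl scale1r -[X in _ - X]hepsl ds tlift_tens ?subrr.
move: e => /eqP; rewrite scaler_eq0 subr_eq0 => /orP[/eqP //|/eqP s0].
by move: ss; rewrite s0 mul0r => /esym/eqP; rewrite oner_eq0.
Qed.

Lemma heps_y : heps A y = 0.
Proof.
have bf : bilin (fun u v : A => heps A u *: v).
  split=> [v c a b|u c a b] /=; first by rewrite linearP scalerDl scalerA.
  by rewrite scalerDr !scalerA mulrC.
have := hepsl y; rewrite dy linearD /= !tlift_tens // heps_s scale1r.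
move/(canRL (addrK _)); rewrite subrr => /eqP.
by rewrite scaler_eq0 oner_eq0 orbF => /eqP.
Qed.

Lemma hanti_s : hanti A s = s.
Proof.
have := hantil s; rewrite ds (tlift_tens (f := fun u v => hanti A u * v)).
  by rewrite heps_s scale1r => /(congr1 ( *%R^~ s)); rewrite -mulrA ss mulr1 mul1r.
exact: (bilin_mul (hanti A) idfun).
Qed.

Lemma hanti_y : hanti A y = - (s * y).
Proof.
have := hantil y; rewrite dy linearD /= !(tlift_tens (f := fun u v => hanti A u * v)).
- by rewrite heps_y scale0r mulr1 hanti_s => /eqP; rewrite addr_eq0 => /eqP.
- exact: (bilin_mul (hanti A) idfun).
exact: (bilin_mul (hanti A) idfun).
Qed.

Lemma hom_act_bilin (X Y : fdmod A) (f : 'Hom(X, Y)) :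
  bilin (fun u v => (act Y u \o f \o act X (hanti A v))%VF).
Proof.
split=> [v c a b|u c a b] /=.
  by rewrite linearP !comp_lfunDl !comp_lfunZl.
by rewrite !linearP comp_lfunDr comp_lfunZr.
Qed.

Lemma hom_act_y (X Y : fdmod A) (f : 'Hom(X, Y)) x :
  hom_act y f x = act Y y (f x) - act Y s (f (act X s (act X y x))).
Proof.
rewrite /hom_act dy linearD /= !tlift_tens; [|exact: hom_act_bilin..].
rewrite hanti1 act1 comp_lfun1r hanti_y linearN /= comp_lfunNr.
by rewrite add_lfunE opp_lfunE !comp_lfunE act_comp.
Qed.

Section Involution.

Variable M : fdmod A.

Lemma act_ss m : act M s (act M s m) = m.
Proof. by rewrite -act_comp ss act_id. Qed.

Lemma act_yy m : act M y (act M y m) = 0.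
Proof. by rewrite -act_comp yy linear0 lfunE. Qed.

Lemma act_sy m : act M s (act M y m) = - act M y (act M s m).
Proof. by rewrite -!act_comp sy linearN opp_lfunE. Qed.

End Involution.

(** Over a field an exact operator has a contracting homotopy. As s anticommutes with y, the
    homotopy can be antisymmetrized under conjugation by s. *)
Lemma odd_contraction (M : fdmod A) : acyclic y M ->
  exists c : 'End(M), (forall m, act M y (c m) + c (act M y m) = m) /\
                      (forall m, act M s (c m) = - c (act M s m)).
Proof.
move=> ay; pose Y := act M y; pose g := (Y^-1)%VF.
have gK m : Y m = 0 -> Y (g m) = m.
  by move=> /ay[m' ->]; rewrite limg_lfunVK // memv_img // memvf.
have YgY m : Y (g (Y m)) = Y m by apply: gK; apply: act_yy.
(* [g] inverts Y on its image only. With the correction, Y g is applied to m - g(Y m) alone, which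
   lies in ker Y. *)
pose c0 := (g - (g \o g \o Y))%VF.
have c0E m : c0 m = g m - g (g (Y m)).
  by rewrite /c0 add_lfunE opp_lfunE !comp_lfunE.
have Yc0 m : Y (c0 m) = m - g (Y m).
  rewrite c0E -linearB gK // linearB /= YgY subrr //.
have c0Y m : c0 (Y m) = g (Y m).
  by rewrite c0E [Y (Y m)]act_yy !linear0 ?subr0 ?addr0.
pose S := act M s.
(* Both c0 and - S c0 S are contractions, whence the factor 1/2 in their mean, which anticommutes
   with S. *)
exists (2%:R^-1 *: (c0 - (S \o c0 \o S)))%VF.
have cE m : (2%:R^-1 *: (c0 - (S \o c0 \o S)))%VF m = 2%:R^-1 *: (c0 m - S (c0 (S m))).
  by rewrite scale_lfunE add_lfunE opp_lfunE !comp_lfunE.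
have SY m : S (Y m) = - Y (S m) := act_sy m.
have SS m : S (S m) = m := act_ss m.
have YS m : Y (S m) = - S (Y m) by rewrite SY opprK.
split=> m; rewrite !cE -/S -/Y.
  have e1 : Y (c0 m - S (c0 (S m))) = m - g (Y m) + (m - S (g (Y (S m)))).
    by rewrite linearB /= [Y (S (c0 _))]YS opprK !Yc0 linearB /= SS.
  have e2 : c0 (Y m) - S (c0 (S (Y m))) = g (Y m) + S (g (Y (S m))).
    by rewrite c0Y SY linearN /= c0Y linearN opprK.
  rewrite linearZ /= e1 e2 -scalerDr addrACA !subrK.
  rewrite -{1 2}(scale1r m) -scalerDl scalerA.
  by rewrite (_ : 1 + 1 = 2%:R) // mulVf // scale1r.
by rewrite linearZ linearB /= !SS -scalerN opprB.
Qed.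

(** The endomorphism t = s c depends on X alone, and the preimage of f arises from f by composition
    with s and t. It therefore stays in any class of maps stable under these compositions, which
    [lifts_acyclic] needs beyond the acyclicity of Hom(X, Y). *)
Lemma hom_contraction (X : fdmod A) : acyclic y X ->
  exists t : 'End(X), forall (Y : fdmod A) (f : 'Hom(X, Y)),
    hom_act y f = 0 -> f = hom_act y (act Y s \o f \o t)%VF.
Proof.
case/odd_contraction=> c [yc sc]; exists (act X s \o c)%VF => Y f /lfunP yf0.
have yf z : act Y y (f z) = act Y s (f (act X s (act X y z))).
  by have := yf0 z; rewrite hom_act_y zero_lfunE => /eqP; rewrite subr_eq0 => /eqP.
apply/lfunP => x; rewrite hom_act_y !comp_lfunE act_ss.
rewrite -[act Y y _]opprK -act_sy yf act_ss act_sy act_ss sc act_ss !linearN opprK /=.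
by rewrite opprK -linearD yc.
Qed.

Lemma hom_acyclic (X Y : fdmod A) : acyclic y X -> acyclic y (hom_mod X Y).
Proof.
case/hom_contraction=> t tE f; rewrite hom_modE => /tE ->.
by eexists; rewrite hom_modE.
Qed.

Lemma hom_triv_act (X : fdmod A) (xi : 'Hom(X, triv_mod A)) a u :
  hom_act a xi u = xi (act X (hanti A a) u).
Proof.
rewrite hom_act_apply -[in RHS](hepsl a) !linear_tlift /= tlift_lfunE linear_tlift.
apply: eq_tlift => b c /=; rewrite triv_modE !linearZ /=.
by rewrite scale_lfunE linearZ.
Qed.

(** Equivariance of coevaluation. By [hom_act_canr] it amounts to b (v (x) xi) = b_1 v (x) b_2
    xi. *)
Lemma rank1_hom_act (X Y : fdmod A) a (v : Y) :
  rank1_hom X (act Y a v) =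
  hom_act (X := hom_mod X (triv_mod A)) (Y := hom_mod X Y) a (rank1_hom X v).
Proof.
have lG : linear (fun a => rank1_hom X (act Y a v)).
  by move=> c b1 b2; rewrite act_linear add_lfunE scale_lfunE rank1_hom_linear.
rewrite -(linear_homE lG a).
apply: (@hom_act_canr _ _ (hom_mod X (triv_mod A)) (hom_mod X Y)).
apply/lfunP => b; apply/lfunP => xi; apply/lfunP => u.
rewrite conv_apply conv_cstr comp_lfunE !rhoE hom_modE hom_act_apply tlift_lfunE.
apply: eq_tlift => b1 b2; rewrite linear_homE rhoE hom_modE !rank1_homE.
by rewrite hom_triv_act linearZ.
Qed.

(** * Left integrals from a weakly initial pair *)

Section Core.

Variables (K : fdmod A) (kap : K).
Hypotheses (Kac : acyclic y K) (kinv : is_invariant kap).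
Hypothesis Kuniv : forall (N : fdmod A) (n : N), acyclic y N -> is_invariant n ->
  exists2 phi : 'Hom(K, N), equivariant phi & phi kap = n.

Let D := hom_mod K (triv_mod A).
Let E := hom_mod K K.
Let d := \dim {:'End(K)}.
Let F := free_mod A d.

(** A free cover of End K, with one generator per basis vector. Its section [sec] below is linear
    only; that suffices in [lifts_acyclic]. *)
Definition free_to_end (z : F) : E := \sum_j hom_act (z j) (vbasis {:'End(K)})`_j.

Lemma free_to_end_linear : linear free_to_end.
Proof.
move=> c z w; rewrite /free_to_end scaler_sumr -big_split; apply: eq_bigr => j _ /=.
by rewrite !ffunE -!hom_modE act_linear add_lfunE scale_lfunE.
Qed.

Let p : 'Hom(F, E) := linear_hom free_to_end_linear.

Let pE z : p z = \sum_j hom_act (z j) (vbasis {:'End(K)})`_j.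
Proof. exact: linear_homE. Qed.

Let p_eq : equivariant p.
Proof.
move=> a z; rewrite !pE linear_sum; apply: eq_bigr => j _.
by rewrite free_modE -!hom_modE act_comp.
Qed.

Let sec_linear : linear (fun g : 'End(K) =>
  [ffun j => coord (vbasis {:'End(K)}) j g *: 1] : F).
Proof. by move=> c f g; apply/ffunP => j; rewrite !ffunE linearP scalerDl scalerA. Qed.

Let sec : 'Hom('End(K), F) := linear_hom sec_linear.

Let psec g : p (sec g) = g.
Proof.
rewrite pE [RHS](coord_vbasis (memvf g)); apply: eq_bigr => j _.
rewrite linear_homE ffunE -hom_modE linearZ scale_lfunE.
by congr (_ *: _); exact: act_id.
Qed.

Let pc : 'End(K) := (\1 - projv <[kap]>)%VF.

Let pc0 u : pc u = 0 <-> exists c, u = c *: kap.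
Proof.
rewrite /pc add_lfunE opp_lfunE id_lfunE; split.
  by move/eqP; rewrite subr_eq0 => /eqP e; apply/vlineP; rewrite e memv_proj.
by case=> c ->; rewrite projv_id ?subrr // memvZ // memv_line.
Qed.

Let inW (g : E) : Prop := forall u, exists c, (g : 'End(K)) u = c *: kap.

Let inW_act a g : inW g -> inW (act E a g).
Proof.
move=> gW u; rewrite hom_modE hom_act_apply.
apply/pc0; rewrite linear_tlift; apply: tlift_eq0 => b c /=; apply/pc0.
have [e ->] := gW (act K (hanti A c) u).
by exists (e * heps A b); rewrite linearZ /= kinv scalerA.
Qed.

Let pc_linear : linear (fun g : 'End(K) => (pc \o g)%VF).
Proof. by move=> c f g; rewrite comp_lfunDr comp_lfunZr. Qed.

Let pcL : 'End('End(K)) := linear_hom pc_linear.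

Let pcLE g : pcL g = (pc \o g)%VF.
Proof. exact: linear_homE. Qed.

Let P := prod_mod K (hom_mod D F).

Let obstr_fun (z : P) : 'Hom(D, 'End(K)) :=
  (pcL \o (p \o z.2 - rank1_hom K z.1))%VF.

Let obstr_linear : linear obstr_fun.
Proof.
move=> c z w; apply/lfunP => xi; rewrite /obstr_fun /= rank1_hom_linear.
rewrite !(add_lfunE, scale_lfunE, comp_lfunE, opp_lfunE) -linearP; congr (pcL _).
by rewrite linearP scalerBr opprD addrACA.
Qed.

(* The pairs [(v, f)] such that [f] lifts [xi |-> v (x) xi], from K^* to End K,
   through the free cover [p], modulo the endomorphisms with image in <kap>. *)
Let lifts : {vspace P} := lker (linear_hom obstr_linear).

Let liftsP z : z \in lifts <-> forall xi, inW (p (z.2 xi) - rank1_hom K z.1 xi).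
Proof.
have e xi u : obstr_fun z xi u = pc ((p (z.2 xi) - rank1_hom K z.1 xi) u).
  by rewrite comp_lfunE pcLE comp_lfunE !add_lfunE !opp_lfunE comp_lfunE.
rewrite memv_ker linear_homE; split.
  move/eqP/lfunP=> z0 xi u; apply/pc0; have /lfunP/(_ u) := z0 xi.
  by rewrite e !zero_lfunE.
move=> zW; apply/eqP/lfunP => xi; apply/lfunP => u; have /pc0 := zW xi u.
by rewrite e !zero_lfunE.
Qed.

Let lifts_sub : submod lifts.
Proof.
move=> a z /liftsP zl; apply/liftsP => xi; rewrite prod_mod1 prod_mod2 hom_modE.
rewrite rank1_hom_act -/D -/E.
have -> : p (hom_act a z.2 xi) - hom_act (X := D) (Y := E) a (rank1_hom K z.1) xi =
  tlift (fun b c => act E b (p (z.2 (act D (hanti A c) xi)) -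
                             rank1_hom K z.1 (act D (hanti A c) xi))) (hdelta A a).
  rewrite !hom_act_apply linear_tlift.
  have -> (t1 t2 : E) : t1 - t2 = (-1) *: t2 + t1 by rewrite scaleN1r addrC.
  rewrite -tliftZ -tliftD; apply: eq_tlift => b c /=.
  by rewrite linearB /= p_eq scaleN1r addrC.
move=> u; apply/pc0; rewrite tlift_lfunE linear_tlift; apply: tlift_eq0 => b c /=.
by apply/pc0; apply: inW_act.
Qed.

Let Dac : acyclic y D := @hom_acyclic K (triv_mod A) Kac.

(** A cycle is treated in two steps without leaving [lifts]: a boundary removes its first component,
    and the remaining cycle lives in Hom(K^*, F) alone, where [hom_contraction] applies. *)
Let lifts_acyclic : acyclic y (sub_mod lifts_sub).
Proof.
move=> m ym0; set z := vsval m; have zl : z \in lifts by apply: subvsP.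
have yz : act P y z = 0 by rewrite -sub_modE ym0 linear0.
have yz1 : act K y z.1 = 0 by rewrite -prod_mod1 yz.
have yz2 : hom_act (X := D) (Y := F) y z.2 = 0.
  by rewrite -hom_modE -prod_mod2 yz.
have [w z1E] := Kac yz1.
(* [sec] lifts each w (x) xi exactly, so this pair lies in [lifts] with zero error. *)
pose z1 : P := (w, (sec \o rank1_hom K w)%VF).
have z1l : z1 \in lifts.
  by apply/liftsP => xi u; exists 0; rewrite comp_lfunE psec subrr zero_lfunE scale0r.
have [t tE] := hom_contraction Dac.
pose z2 := z - act P y z1.
have z2l : z2 \in lifts by rewrite memvB // lifts_sub.
have z21 : z2.1 = 0.
  by rewrite [z2.1](_ : _ = z.1 - (act P y z1).1) // prod_mod1 z1E subrr.
have z22 : hom_act (X := D) (Y := F) y z2.2 = 0.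
  rewrite [z2.2](_ : _ = z.2 - (act P y z1).2) // prod_mod2.
  by rewrite -hom_modE linearB [X in _ - X]act_yy subr0 [LHS]hom_modE yz2.
(* Both compositions respect [lifts]: its condition ranges over all xi, hence survives
   precomposition with t, and [inW] is stable under s. *)
pose f := (act F s \o z2.2 \o t)%VF.
pose z3 : P := (0, f).
have z3l : z3 \in lifts.
  apply/liftsP => xi; rewrite /= rank1_hom0 zero_lfunE subr0 !comp_lfunE p_eq.
  apply: inW_act; have /liftsP/(_ (t xi)) := z2l.
  by rewrite z21 rank1_hom0 zero_lfunE subr0.
exists (vsproj lifts (z1 + z3)); apply: (can_inj (@vsvalK _ _ lifts)).
rewrite [RHS]sub_modE vsprojK ?memvD //.
have -> : act P y (z1 + z3) = act P y z1 + act P y z3 by rewrite linearD.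
rewrite -[LHS](subrK (act P y z1)) addrC -/z2; congr (_ + _).
apply: injective_projections; rewrite [RHS](prod_mod1, prod_mod2).
  by rewrite z21 linear0.
by rewrite hom_modE -(tE F _ z22).
Qed.

Let contract (B : 'Hom(K, 'Hom(D, F))) : F :=
  \sum_(i < \dim {:K}) B (vbasis {:K})`_i (dual_basis K i).

(** By equivariance a_1 acts on the basis and S(a_2) on the dual basis; [dual_basis_comp] brings
    them together as a_1 S(a_2) = eps(a). *)
Let contract_inv (B : 'Hom(K, 'Hom(D, F))) :
  (forall a v, B (act K a v) = act (hom_mod D F) a (B v)) ->
  is_invariant (contract B).
Proof.
move=> Beq a.
have Beq' v xi : act F a (B v xi) =
    tlift (fun b c => B (act K b v) (act D c xi)) (hdelta A a).
  have lG : linear (fun a => B (act K a v)).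
    by move=> c b1 b2; rewrite act_linear add_lfunE scale_lfunE linearP.
  have e := @hom_act_canl _ _ D F (B v) (linear_hom lG) _.
  have /lfunP/(_ a)/lfunP/(_ xi) := e (fun b => etrans (linear_homE lG b)
    (etrans (Beq b v) (hom_modE b (B v)))).
  rewrite conv_cstr comp_lfunE rhoE conv_apply => <-.
  by apply: eq_tlift => b c; rewrite linear_homE rhoE.
rewrite /contract linear_sum.
under eq_bigr => i _ do rewrite /= Beq'.
rewrite -tlift_sum.
pose Q b := \sum_(i < \dim {:K}) B (act K b (vbasis {:K})`_i) (dual_basis K i).
have lQ : linear Q.
  move=> c b1 b2; rewrite /Q scaler_sumr -big_split; apply: eq_bigr => i _ /=.
  by rewrite act_linear add_lfunE scale_lfunE linearP add_lfunE scale_lfunE.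
transitivity (tlift (fun b c => linear_hom lQ (b * hanti A c)) (hdelta A a)).
  apply: eq_tlift => b c; rewrite linear_homE /Q.
  have lB : linear (fun v => B (act K b v)) by move=> e v w; rewrite !linearP.
  have := @dual_basis_comp k K F (linear_hom lB) (act K (hanti A c)).
  under eq_bigr => i _ do rewrite linear_homE.
  under [in RHS]eq_bigr => i _ do rewrite linear_homE.
  move=> e; transitivity (\sum_(i < \dim {:K}) B (act K b (vbasis {:K})`_i)
      (dual_basis K i \o act K (hanti A c))%VF).
    apply: eq_bigr => i _; congr (B _ _); apply/lfunP => u.
    by rewrite hom_modE hom_triv_act comp_lfunE.
  by rewrite e; apply: eq_bigr => i _; rewrite act_comp.
rewrite -linear_tlift hantir linearZ /= linear_homE /Q; congr (_ *: _).
by apply: eq_bigr => i _; rewrite act_id.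
Qed.

(* The component [sg] of the map from K to [lifts] fixes [kap] and the other one, traced,
   gives an invariant of End K, i.e. an A-endomorphism [p z]. As [p z - sg] is
   A-linear with image in <kap> and [kap = y w], it kills [kap], so that
   [kap = p z kap]; [z] is a family of left integrals since it is an invariant
   of a free module. *)
Lemma univ_trace : exists n (L : 'I_n -> A) (v : 'I_n -> K),
  (forall i a, a * L i = heps A a *: L i) /\ kap = \sum_i act K (L i) (v i).
Proof.
(* This is what working modulo <kap> buys: kap (x) xi has its image in <kap>, so the zero map is a
   lift for kap. *)
have z0l : ((kap, 0) : P) \in lifts.
  apply/liftsP => xi u; exists (- xi u); rewrite zero_lfunE linear0 sub0r opp_lfunE.
  by rewrite rank1_homE scaleNr.
have [|phi phi_eq phik] :=
  @Kuniv (sub_mod lifts_sub) (vsproj lifts (kap, 0)) lifts_acyclic.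
  move=> a; apply: (can_inj (@vsvalK _ _ lifts)); rewrite sub_modE vsprojK //.
  transitivity (heps A a *: ((kap, 0) : P)); last by rewrite linearZ /= vsprojK.
  by apply: injective_projections; rewrite ?prod_mod1 ?prod_mod2 ?kinv // linear0 [RHS]scaler0.
have lsg : linear (fun v => (vsval (phi v)).1 : K).
  by move=> c u v; rewrite !linearP.
have lB : linear (fun v => (vsval (phi v)).2 : hom_mod D F).
  by move=> c u v; rewrite !linearP.
pose sg := linear_hom lsg; pose B := linear_hom lB.
have sgE v : sg v = (vsval (phi v)).1 := linear_homE lsg v.
have BE v : B v = (vsval (phi v)).2 := linear_homE lB v.
have sg_eq : equivariant sg.
  by move=> a u; rewrite !sgE phi_eq sub_modE prod_mod1.
have B_eq a v : B (act K a v) = act (hom_mod D F) a (B v).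
  by rewrite !BE phi_eq sub_modE prod_mod2.
have z_inv := contract_inv B_eq; set z := contract B in z_inv.
have pz_eq : equivariant (p z : 'End(K)).
  apply: (proj1 (@invariant_hom k A K K (p z))) => a.
  by rewrite -p_eq z_inv linearZ.
(* Modulo the maps with image in <kap>, p z is the sum of the sg(v_i) (x) v_i^*, which is sg
   itself. *)
have pz_sg u : exists c, (p z - sg)%VF u = c *: kap.
  have -> : p z - sg = \sum_(i < \dim {:K}) (p (B (vbasis {:K})`_i (dual_basis K i)) -
      rank1_hom K (sg (vbasis {:K})`_i) (dual_basis K i)).
    rewrite sumrB linear_sum; congr (_ - _); apply/lfunP => v.
    rewrite sum_lfunE {1}(coord_vbasis (memvf v)) linear_sum.
    by apply: eq_bigr => i _; rewrite rank1_homE dual_basisE linearZ.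
  rewrite sum_lfunE; apply/pc0; rewrite linear_sum big1 // => i _; apply/pc0.
  have := subvsP (phi (vbasis {:K})`_i) => /liftsP/(_ (dual_basis K i) u).
  by rewrite BE sgE.
have [w kw] : exists w, kap = act K y w.
  by apply: Kac; rewrite kinv heps_y scale0r.
have pzk : (p z : 'End(K)) kap = kap.
  have : (p z - sg)%VF kap = 0.
    have [c cE] := pz_sg w; rewrite kw.
    have -> : (p z - sg)%VF (act K y w) = act K y ((p z - sg)%VF w).
      by rewrite !add_lfunE !opp_lfunE pz_eq sg_eq linearB.
    by rewrite cE linearZ /= kinv heps_y scale0r scaler0.
  rewrite add_lfunE opp_lfunE sgE phik vsprojK //= => /eqP.
  by rewrite subr_eq0 => /eqP.
exists d, z, (fun j => ((vbasis {:'End(K)})`_j : 'End(K)) kap); split.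
  by move=> j a; rewrite -free_modE z_inv ffunE.
rewrite -[LHS]pzk pE sum_lfunE; apply: eq_bigr => j _.
by rewrite hom_act_inv.
Qed.

End Core.

End Acyclic.

(** * Maschke's theorem and self-injectivity *)

(** Stated for a bare map D, so that it serves [comul], [hdelta], and the coproduct of U before U is
    known to be a Hopf algebra. *)
Lemma coassoc_trilinear (k : fieldType) (V : vectType k) (W : lmodType k)
    (D : V -> tensor V V) (F : V -> V -> V -> W) h :
  (forall b c, linear (fun a => F a b c)) -> (forall a, bilin (F a)) ->
  tlift (fun u v => tens u (D v)) (D h) =
  tlift (fun u v => tlift (fun u1 u2 => tens u1 (tens u2 v)) (D u)) (D h) ->
  tlift (fun a b => tlift (fun c d => F a c d) (D b)) (D h) =
  tlift (fun a b => tlift (fun c d => F c d b) (D a)) (D h).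
Proof.
move=> lF bF.
pose Psi : {linear tensor V (tensor V V) -> W} := tlift (fun a => tlift (F a)).
have PsiE a w : Psi (tens a w) = tlift (F a) w.
  apply: tlift_tens; split=> [v c u1 u2|u c v1 v2] /=; last by rewrite linearP.
  exact: linear_tlift_param.
move=> /(congr1 Psi); rewrite !linear_tlift.
rewrite (eq_tlift (g := fun a b => tlift (F a) (D b))) => [->|a b].
  apply: eq_tlift => a b; rewrite linear_tlift; apply: eq_tlift => c d /=.
  by rewrite PsiE tlift_tens.
exact: PsiE.
Qed.

Lemma hdelta_coassoc (k : fieldType) (A : hopfAlgebra k) (W : lmodType k)
    (F : A -> A -> A -> W) h :
  (forall b c, linear (fun a => F a b c)) -> (forall a, bilin (F a)) ->
  tlift (fun a b => tlift (fun c d => F a c d) (hdelta A b)) (hdelta A h) =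
  tlift (fun a b => tlift (fun c d => F c d b) (hdelta A a)) (hdelta A h).
Proof. by move=> lF bF; apply: (coassoc_trilinear lF bF); apply: hdeltaA. Qed.

Section Maschke.

Variables (k : fieldType) (A : falgType k) (M : fdmod A).

Lemma submod_cap (U V : {vspace M}) : submod U -> submod V -> submod (U :&: V)%VS.
Proof.
by move=> sU sV a u; rewrite !memv_cap => /andP[/sU-> /sV->].
Qed.

Lemma exists_simple_submod (W : {vspace M}) : submod W -> W <> 0%VS ->
  exists2 S, simple_submod S & (S <= W)%VS.
Proof.
have [n] := ubnP (\dim W); elim: n W => // n IHn W ltn sW W0.
have [ex|nex] := Classical_Prop.classic
    (exists W' : {vspace M}, [/\ submod W', (W' <= W)%VS, W' <> 0%VS & W' <> W]).
  have [W' [sW' W'W W'0 W'nW]] := ex.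
  have [|S sS SW'] := IHn W' _ sW' W'0.
    move: ltn; rewrite ltnS; apply: leq_trans; rewrite ltn_neqAle dimvS // andbT.
    by apply/eqP => e; apply: W'nW; apply/eqP; rewrite eqEdim W'W e /=.
  by exists S => //; apply: subv_trans SW' W'W.
exists W; last exact: subvv.
split=> // W' sW' W'W.
have [|W'0] := Classical_Prop.classic (W' = 0%VS); first by left.
have [|W'nW] := Classical_Prop.classic (W' = W); first by right.
by case: nex; exists W'.
Qed.

Hypothesis compl : forall W : {vspace M}, submod W ->
  exists C : {vspace M}, [/\ submod C, (W + C)%VS = fullv & (W :&: C)%VS = 0%VS].

Lemma simple_decomposition (W : {vspace M}) : submod W ->
  exists (n : nat) (S : 'I_n -> {vspace M}),
    [/\ forall i, simple_submod (S i), directv (\sum_i S i) & (\sum_i S i)%VS = W].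
Proof.
have [m] := ubnP (\dim W); elim: m W => // m IHm W ltm sW.
have [->|/eqP W0] := eqVneq W 0%VS.
  exists 0%N, (fun _ => 0%VS); split=> [[]||] //; last by rewrite big_ord0.
  by rewrite directvE /= !big_ord0 dimv0.
have [S0 S0s S0W] := exists_simple_submod sW W0.
have [sS0 S00 _] := S0s.
have [C [sC S0C S0C0]] := compl sS0.
pose W' := (C :&: W)%VS.
have eW : (S0 + W')%VS = W.
  by rewrite /W' vspace_modl // S0C capfv.
have cap0 : (S0 :&: W')%VS = 0%VS by rewrite /W' capvA S0C0 cap0v.
have dW : \dim W = (\dim S0 + \dim W')%N by rewrite -eW dimv_disjoint_sum.
have [||n [S [Ss Sd SW]]] := IHm W'.
- move: ltm; rewrite ltnS; apply: leq_trans; rewrite dW -[X in (X < _)%N]add0n ltn_add2r.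
  by rewrite lt0n dimv_eq0; apply/eqP.
- exact: submod_cap.
exists n.+1, (fun i => if unlift ord0 i is Some j then S j else S0); split.
- by move=> i; case: unliftP.
- rewrite directvE /= !big_ord_recl unlift_none.
  under eq_bigr => i _ do rewrite liftK.
  under [X in _ == (_ + X)%N]eq_bigr => i _ do rewrite liftK.
  rewrite SW eW dW eqn_add2l; move: Sd; rewrite directvE /= => /eqP <-.
  by rewrite SW.
rewrite big_ord_recl unlift_none.
by under eq_bigr => i _ do rewrite liftK; rewrite SW.
Qed.

End Maschke.

Section IntegralSemisimple.

Variables (k : fieldType) (A : hopfAlgebra k) (L : A).
Hypotheses (LP : forall a, a * L = heps A a *: L) (L1 : heps A L = 1).

(** Maschke averaging: L turns the linear projection onto W into an equivariant map, and eps(L) = 1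
    keeps it the identity on W. The complement is its kernel. *)
Lemma integral_complement (M : fdmod A) (W : {vspace M}) : submod W ->
  exists C : {vspace M}, [/\ submod C, (W + C)%VS = fullv & (W :&: C)%VS = 0%VS].
Proof.
move=> sW; pose q : 'End(M) := hom_act (X := M) (Y := M) L (projv W).
have qE x : q x = tlift (fun u v => act M u (projv W (act M (hanti A v) x))) (hdelta A L).
  exact: hom_act_apply.
have q_eq : equivariant q.
  apply: (proj1 (@invariant_hom k A M M q)) => a.
  by rewrite /q -hom_modE -act_comp LP linearZ scale_lfunE.
have qW x : q x \in W.
  rewrite qE; apply: tlift_memv => u v.
  by apply: sW; apply: memv_proj.
have qid x : x \in W -> q x = x.
  move=> xW; rewrite -[RHS]act_id -[in RHS](scale1r 1) -L1 -hantir linear_tlift.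
  rewrite [RHS]tlift_lfunE qE; apply: eq_tlift => u v /=.
  by rewrite act_comp projv_id // sW.
exists (lker q); split.
- by move=> a u; rewrite !memv_ker q_eq => /eqP->; rewrite linear0.
- apply/eqP; rewrite eqEsubv subvf; apply/subvP => x _.
  rewrite -(subrK (q x) x) addrC memv_add // memv_ker linearB /= [q (q x)]qid ?subrr //.
apply/eqP; rewrite eqEsubv sub0v andbT; apply/subvP => x; rewrite memv_cap memv_ker memv0.
by case/andP=> xW; rewrite qid.
Qed.

Lemma integral_semisimple : semisimple A.
Proof.
apply: simple_decomposition => [W|]; first exact: integral_complement.
by move=> a u _; apply: memvf.
Qed.

End IntegralSemisimple.

(** * Self-injectivity of a cocommutative Hopf algebra *)

Section SelfInjective.

Variables (k : fieldType) (A : hopfAlgebra k).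
Hypothesis coc : forall a, tlift (fun u v => tens v u) (hdelta A a) = hdelta A a.

Lemma hdelta_sym (W : lmodType k) (F : A -> A -> W) a : bilin F ->
  tlift (fun u v => F v u) (hdelta A a) = tlift F (hdelta A a).
Proof.
move=> bF; rewrite -[in RHS]coc linear_tlift; apply: eq_tlift => u v.
by rewrite /= tlift_tens.
Qed.

Variables (M : fdmod A) (m0 : M) (P0 : 'Hom(M, A)).
Hypothesis P0m0 : forall a, P0 (act M a m0) = a.

Let R := regular_mod A.
Let RE a x : act R a x = a * x.
Proof. by rewrite lfunE. Qed.

(** The standard action z |-> z_1 f(z_2) of the dual algebra on A. *)
Let cut_fun (f : 'Hom(A, k^o)) : A -> A :=
  tlift (fun u v => (f v : k) *: u) \o hdelta A.

Let cut (f : 'Hom(A, k^o)) : 'Hom(R, R) := linfun (cut_fun f).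

Let cutE f z : cut f z = tlift (fun u v => (f v : k) *: u) (hdelta A z).
Proof. by rewrite lfunE. Qed.

Let cut_linear : linear cut.
Proof.
move=> c f g; apply/lfunP => z; rewrite add_lfunE scale_lfunE !cutE.
apply: (linear_tlift_param (F := fun (f : 'Hom(A, k^o)) u v => (f v : k) *: u)).
by move=> u v e f1 f2; rewrite add_lfunE scale_lfunE scalerDl scalerA.
Qed.

Let cut1 f : cut f 1 = (f 1 : k) *: 1.
Proof.
rewrite cutE hdelta1 (tlift_tens (f := fun u v => (f v : k) *: u)) //.
split=> [v c a b|u c a b] /=; first by rewrite scalerDr !scalerA mulrC.
by rewrite linearP scalerDl scalerA.
Qed.

Let twist_linear (f : 'Hom(A, k^o)) :
  linear (fun a => cut (f \o amull (hanti A a))%VF).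
Proof.
move=> c a b; rewrite !linearP -cut_linear; congr (cut _).
by rewrite comp_lfunDr comp_lfunZr.
Qed.

(* [w * (z_1 f(z_2)) = (w_2 z)_1 f(S(w_1) (w_2 z)_2)], by cocommutativity. *)
Let cut_conv (f : 'Hom(A, k^o)) :
  conv (rho R) (cst A (cut f)) = conv (linear_hom (twist_linear f)) (rho R).
Proof.
apply/lfunP => w; apply/lfunP => z.
rewrite conv_cstr comp_lfunE rhoE RE cutE tlift_mull conv_apply.
pose H z1 z2 (x y t : A) : A := (f (hanti A x * (y * z2)) : k) *: (t * z1).
have H1 z1 z2 y t : linear (fun x => H z1 z2 x y t).
  by move=> c x x'; rewrite /H linearP mulrDl -scalerAl linearP scalerDl scalerA.
have H2 z1 z2 x t : linear (fun y => H z1 z2 x y t).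
  move=> c y y'; rewrite /H mulrDl mulrDr -scalerAl -scalerAr linearP.
  by rewrite scalerDl scalerA.
have H3 z1 z2 x y : linear (fun t => H z1 z2 x y t).
  move=> c t t'; rewrite /H mulrDl -scalerAl scalerDr !scalerA.
  by rewrite mulrC.
have e w1 w2 : linear_hom (twist_linear f) w1 (rho R w2 z) =
    tlift (fun c1 c2 => tlift (fun z1 z2 => H z1 z2 w1 c2 c1) (hdelta A z)) (hdelta A w2).
  rewrite linear_homE rhoE RE cutE hdeltaM linear_tlift; apply: eq_tlift => c1 c2.
  rewrite linear_tlift; apply: eq_tlift => z1 z2 /=.
  rewrite (tlift_tens (f := fun u v => ((f \o amull (hanti A w1))%VF v : k) *: u)).
    by rewrite comp_lfunE lfunE.
  split=> [v c a b|u c a b] /=; first by rewrite scalerDr !scalerA mulrC.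
  by rewrite linearP scalerDl scalerA.
under [RHS]eq_tlift => w1 w2 do rewrite e tlift_exchange.
rewrite tlift_exchange; apply: eq_tlift => z1 z2.
(* The summand is f(S(w_1) w_3 z_2) w_2 z_1. Cocommutativity exchanges w_1 and w_2, after which
   S(w_2) w_3 collapses. *)
rewrite (hdelta_coassoc (F := fun a c d => H z1 z2 a d c)); first last.
- by move=> a; split=> *; [apply: H3 | apply: H2].
- by move=> *; apply: H1.
transitivity (tlift (fun a b => tlift (fun c d => H z1 z2 d b c) (hdelta A a)) (hdelta A w)).
  rewrite -(hdelta_coassoc (F := fun c d b => H z1 z2 d b c)); first last.
  - by move=> a; split=> *; [apply: H1 | apply: H2].
  - by move=> *; apply: H3.
  rewrite -[in LHS](hepsr w) tlift_mulr; apply: eq_tlift => u v /=.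
  have lL : linear (fun x => (f (x * z2) : k) *: (u * z1)).
    by move=> c x x'; rewrite mulrDl -scalerAl linearP scalerDl scalerA.
  transitivity (tlift (fun c d => linear_hom lL (hanti A c * d)) (hdelta A v)).
    rewrite -linear_tlift hantil linearZ /= linear_homE mul1r.
    by rewrite -scalerAl -scalerAr.
  by apply: eq_tlift => c d; rewrite linear_homE /H mulrA.
apply: eq_tlift => a b.
by rewrite (hdelta_sym (F := fun c d => H z1 z2 c b d)).
Qed.

Let hom_act_cut w f (g : 'Hom(M, R)) :
  hom_act (X := M) (Y := R) w (cut f \o g)%VF =
  tlift (fun w1 w2 => (cut (f \o amull (hanti A w1)) \o
                       hom_act (X := M) (Y := R) w2 g)%VF) (hdelta A w).
Proof.
have e : cst A (cut f \o g)%VF = conv (cst A (cut f)) (cst A g).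
  by apply/lfunP => a; rewrite conv_cstl !cstE comp_lfunZr.
rewrite hom_actE e -(convA (cst A (cut f))) convA cut_conv -convA convE.
by apply: eq_tlift => w1 w2; rewrite linear_homE -hom_actE.
Qed.

Let N := hom_mod M R.

Lemma self_injective : exists2 r : 'Hom(M, A),
  (forall a x, r (act M a x) = a * r x) & r m0 = 1.
Proof.
pose r : 'Hom(M, R) := \sum_(j < \dim {:A})
  (cut (dual_basis A j) \o act N (vbasis {:A})`_j P0)%VF.
have lQ (f : 'Hom(A, k^o)) : linear (fun a => (cut f \o act N a P0)%VF).
  move=> c a b; rewrite act_linear add_lfunE scale_lfunE comp_lfunDr.
  by rewrite -comp_lfunZr.
have lQ' (a : A) : linear (fun f : 'Hom(A, k^o) => (cut f \o act N a P0)%VF).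
  by move=> c f g; rewrite cut_linear comp_lfunDl -comp_lfunZl.
have r_inv : @is_invariant _ _ N r.
  move=> w; rewrite hom_modE.
  pose Q a := \sum_(j < \dim {:A})
    (cut (dual_basis A j) \o act N (a * (vbasis {:A})`_j) P0)%VF.
  have lQs : linear Q.
    move=> c a b; rewrite /Q scaler_sumr -big_split; apply: eq_bigr => j _ /=.
    have -> : (c *: a + b) * (vbasis {:A})`_j =
        c *: (a * (vbasis {:A})`_j) + b * (vbasis {:A})`_j by rewrite mulrDl scalerAl.
    exact: lQ.
  have e w1 w2 : \sum_(j < \dim {:A}) (cut (dual_basis A j \o amull (hanti A w1)) \o
      act N (w2 * (vbasis {:A})`_j) P0)%VF = linear_hom lQs (w2 * hanti A w1).
    have lB1 (u : A) : linear (fun f : 'Hom(A, k^o) => (cut f \o act N (w2 * u) P0)%VF).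
      exact: lQ'.
    have lB : linear (fun u => linear_hom (lB1 u)).
      move=> c u v; apply/lfunP => f; rewrite add_lfunE scale_lfunE.
      rewrite (linear_homE (lB1 (c *: u + v))) (linear_homE (lB1 u)) (linear_homE (lB1 v)).
      have -> : w2 * (c *: u + v) = c *: (w2 * u) + w2 * v by rewrite mulrDr scalerAr.
      exact: lQ.
    have := dual_basis_comp (linear_hom lB) (amull (hanti A w1)).
    under eq_bigr => j _ do rewrite (linear_homE lB) (linear_homE (lB1 _)).
    under [in RHS]eq_bigr => j _ do rewrite (linear_homE lB) (linear_homE (lB1 _)).
    move=> ->; rewrite (linear_homE lQs); apply: eq_bigr => j _.
    have -> : amull (hanti A w1) (vbasis {:A})`_j = hanti A w1 * (vbasis {:A})`_j.
      by rewrite lfunE.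
    by rewrite mulrA.
  transitivity (tlift (fun w1 w2 => linear_hom lQs (w2 * hanti A w1)) (hdelta A w)).
    rewrite -hom_modE linear_sum.
    transitivity (\sum_(j < \dim {:A}) tlift (fun w1 w2 =>
      (cut (dual_basis A j \o amull (hanti A w1)) \o
      act N (w2 * (vbasis {:A})`_j) P0)%VF) (hdelta A w)).
      apply: eq_bigr => j _; rewrite [LHS]hom_modE hom_act_cut.
      by apply: eq_tlift => w1 w2; rewrite -hom_modE -/N act_comp.
    by rewrite -tlift_sum; apply: eq_tlift => w1 w2; rewrite e.
  rewrite (hdelta_sym (F := fun w1 w2 => linear_hom lQs (w1 * hanti A w2))); last first.
    split=> [v c a b|u c a b] /=.
      by rewrite mulrDl -scalerAl linearP.
    by rewrite linearP mulrDr -scalerAr linearP.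
  rewrite -linear_tlift hantir linearZ /= (linear_homE lQs); congr (_ *: _).
  by apply: eq_bigr => j _; rewrite mul1r.
exists r.
  have r_eq := proj1 (@invariant_hom k A M R r) r_inv.
  by move=> a x; rewrite r_eq RE.
rewrite sum_lfunE.
transitivity (heps A 1 *: (1 : A)); last by rewrite heps1 scale1r.
have := congr1 (heps A) (coord_vbasis (memvf (1 : A))); rewrite linear_sum => ->.
rewrite scaler_suml.
apply: eq_bigr => j _; rewrite comp_lfunE hom_modE hom_act_apply.
transitivity (cut (dual_basis A j) (heps A (vbasis {:A})`_j *: 1)).
  congr (cut _ _); rewrite -hantir; apply: eq_tlift => u v.
  by rewrite RE P0m0.
by rewrite linearZ /= cut1 dual_basisE scalerA linearZ mulrC.
Qed.

End SelfInjective.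

(** * Bosonization *)

Section SuperSigns.

Variables (k : fieldType) (H : superHopfAlgebra k).

Let gH := homog_grading H.

Local Notation "x ^: i" := (hproj (homog H) i x) (at level 2, format "x ^: i").

(** The i-th power of the parity automorphism. *)
Definition sig (i : bool) : 'End(H) :=
  (hproj (homog H) false + (-1) ^+ i *: hproj (homog H) true)%VF.

Lemma sigE i x : sig i x = x^:false + (-1) ^+ i *: x^:true.
Proof. by rewrite add_lfunE scale_lfunE. Qed.

Lemma sig0 x : sig false x = x.
Proof. by rewrite sigE expr0 scale1r hproj_add. Qed.

Lemma hproj_sig j i x : (sig i x)^:j = (-1) ^+ (i && j) *: x^:j.
Proof.
rewrite sigE linearD linearZ /= !hprojE //.
by case: j; rewrite ?andbT ?andbF /= ?add0r ?scaler0 ?addr0 ?scale1r.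
Qed.

Lemma sig_homog i j x : x \in homog H j -> sig i x = (-1) ^+ (i && j) *: x.
Proof.
move=> xj; rewrite -(hproj_addN gH j (sig i x)) !hproj_sig.
by rewrite (hproj_id gH xj) (hproj_neg0 gH xj) scaler0 addr0.
Qed.

Lemma sig_hproj i j x : sig i (x^:j) = (-1) ^+ (i && j) *: x^:j.
Proof. exact/sig_homog/hproj_mem. Qed.

Lemma sig_sig i j x : sig i (sig j x) = sig (i (+) j) x.
Proof.
rewrite (sigE j) linearD linearZ /= !sig_hproj sigE andbF andbT scale1r scalerA.
by congr (_ + _ *: _); rewrite signr_addb mulrC.
Qed.

Lemma hproj1 i : (1 : H)^:i = if i then 0 else 1.
Proof.
by case: i; [apply: (hproj_neg0 gH (homog1 H)) | apply: (hproj_id gH (homog1 H))].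
Qed.

Lemma sig1 i : sig i 1 = 1.
Proof. by rewrite (sig_homog _ (homog1 H)) andbF scale1r. Qed.

Lemma sigM i a b : sig i (a * b) = sig i a * sig i b.
Proof.
have e j l : sig i (a^:j * b^:l) = sig i (a^:j) * sig i (b^:l).
  rewrite !sig_hproj -scalerAl -scalerAr scalerA.
  rewrite (@sig_homog _ (j (+) l)); last by apply: homogM; apply: hproj_mem.
  by congr (_ *: _); case: (i); case: (j); case: (l);
    rewrite /= ?expr1 ?mulr1 ?mul1r ?mulrNN ?mulr1.
rewrite -{1}(hproj_add gH a) -{1}(hproj_add gH b) mulrDl !mulrDr !linearD /= !e.
by rewrite -!mulrDr -!mulrDl -!linearD /= !hproj_add.
Qed.

Lemma hprojM i j a b : (a^:i * b)^:j = a^:i * b^:(i (+) j).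
Proof.
rewrite -{1}(hproj_addN gH (i (+) j) b) mulrDr linearD /=.
rewrite [X in X + _](hproj_id gH); last first.
  have := @homogM _ H i (i (+) j) (a^:i) (b^:(i (+) j)).
  by rewrite addbA addbb; apply; apply: hproj_mem.
have h : a^:i * b^:(~~ (i (+) j)) \in homog H (~~ j).
  suff -> : ~~ j = i (+) ~~ (i (+) j) by apply: homogM; apply: hproj_mem.
  by case: (i); case: (j).
by have := hproj_neg0 gH h; rewrite negbK => ->; rewrite addr0.
Qed.

Lemma counit_hproj i x : counit H (x^:i) = if i then 0 else counit H x.
Proof.
case: i; first by apply: counit_homog; apply: hproj_mem.
rewrite -[in RHS](hproj_add gH x) linearD /= (counit_homog (hproj_mem _ true x)).
by rewrite addr0.
Qed.

Lemma counit_sig i x : counit H (sig i x) = counit H x.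
Proof. by rewrite sigE linearD linearZ /= !counit_hproj scaler0 addr0. Qed.

(** The projection of H (x) H onto total parity i. *)
Definition tproj (i : bool) : tensor H H -> tensor H H :=
  tlift (fun u v => \sum_(j : bool) tens (u^:(j (+) i)) (v^:j)).

Lemma bilin_tproj i : bilin (fun u v : H => \sum_(j : bool) tens (u^:(j (+) i)) (v^:j)).
Proof.
have [tl tr] := tens_bilin H H.
split=> [v c a b|u c a b] /=; rewrite scaler_sumr -big_split; apply: eq_bigr => j _ /=.
  by rewrite linearP tl.
by rewrite linearP tr.
Qed.

Lemma comul_hproj i h : comul H (h^:i) = tproj i (comul H h).
Proof.
have [tl tr] := tens_bilin H H.
have e j l x : x \in homog H l -> tproj j (comul H x) = (j == l)%:R *: comul H x.
  move=> /comul_homog/memv_sumP[t tH ->].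
  rewrite scaler_sumr /tproj linear_sum; apply: eq_bigr => m _ /=.
  pose L : 'End(tensor H H) := (linfun (tproj j) - (j == l)%:R *: \1)%VF.
  have LE w : L w = tproj j w - (j == l)%:R *: w.
    by rewrite /L add_lfunE opp_lfunE scale_lfunE id_lfunE lfunE.
  apply/eqP; rewrite -subr_eq0 -memv0 -LE.
  apply: (tensvP (L := L)) (tH m isT) => u v uH vH /=.
  rewrite memv0 LE /tproj tlift_tens; last exact: bilin_tproj.
  have t0l w : tens (0 : H) w = 0 :> tensor H H.
    by have := tl w (-1) 0 0; rewrite !scaleN1r oppr0 addr0 addNr.
  have t0r w : tens w (0 : H) = 0 :> tensor H H.
    by have := tr w (-1) 0 0; rewrite !scaleN1r oppr0 addr0 addNr.
  rewrite (bigD1 (m (+) l)) //= big1 => [|n nml]; last first.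
    have -> : n = ~~ (m (+) l) by move: nml; case: (n); case: (m); case: (l).
    by rewrite (hproj_neg0 gH vH) t0r.
  rewrite (hproj_id gH vH) addr0 subr_eq0; case: (j =P l) => [->|/eqP jl].
    by rewrite -addbA addbb addbF (hproj_id gH uH) scale1r.
  have -> : m (+) l (+) j = ~~ m by move: jl; case: (j); case: (l); case: (m).
  by rewrite (hproj_neg0 gH uH) t0l scale0r.
rewrite -[in RHS](hproj_addN gH i h) !linearD /= /tproj linearD /=.
rewrite -![tlift _ _]/(tproj _ _) !(e _ _ _ (hproj_mem _ _ _)) eqxx scale1r.
by rewrite (_ : i == ~~ i = false) ?scale0r ?addr0 //; case: (i).
Qed.

Lemma sweedler_hproj (W : lmodType k) (F : H -> H -> W) i h : bilin F ->
  tlift F (comul H (h^:i)) =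
  \sum_(j : bool) tlift (fun u v => F (u^:(j (+) i)) (v^:j)) (comul H h).
Proof.
move=> bF; rewrite comul_hproj /tproj linear_tlift -tlift_sum.
by apply: eq_tlift => u v /=; rewrite linear_sum; apply: eq_bigr => j _ /=; rewrite tlift_tens.
Qed.

Lemma sweedler_sig (W : lmodType k) (F : H -> H -> W) i h : bilin F ->
  tlift F (comul H (sig i h)) = tlift (fun u v => F (sig i u) (sig i v)) (comul H h).
Proof.
move=> bF; have [Fl Fr] := bF.
rewrite sigE linearD linearZ /= linearD linearZ /= !sweedler_hproj // !big_bool /= -!tliftD -tliftZ -tliftD.
apply: eq_tlift => u v; rewrite !sigE ![_ + _ *: _]addrC.
rewrite Fl !Fr !scalerDr !scalerA -signr_addb addbb scale1r.
by rewrite addrC [LHS]addrACA [RHS]addrACA; congr (_ + _); apply: addrC.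
Qed.

Lemma super_coassoc (W : lmodType k) (F : H -> H -> H -> W) h :
  (forall b c, linear (fun a => F a b c)) -> (forall a, bilin (F a)) ->
  tlift (fun a b => tlift (fun c d => F a c d) (comul H b)) (comul H h) =
  tlift (fun a b => tlift (fun c d => F c d b) (comul H a)) (comul H h).
Proof. by move=> lF bF; apply: (coassoc_trilinear lF bF); apply: comulA. Qed.

End SuperSigns.

Section Bosonization.

Variables (k : fieldType) (H : superHopfAlgebra k).

Local Notation "x ^: i" := (hproj (homog H) i x) (at level 2, format "x ^: i").

(* The smash product of H with the group algebra of Z/2 = <s>, where s acts on
   H by the parity automorphism: [z] stands for [z false + z true * s]. *)
Definition smash : Type := {ffun bool -> H}.

HB.instance Definition _ := Vector.on smash.

Implicit Types z w : smash.

Definition smash_mul z w : smash :=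
  [ffun m => \sum_(i : bool) z i * sig H i (w (i (+) m))].

Definition smash_one : smash := [ffun m : bool => if m then 0 else 1].

Lemma smash_mulA : associative smash_mul.
Proof.
move=> x y z; apply/ffunP => m; rewrite !ffunE !big_bool /= !ffunE !big_bool /=.
rewrite !linearD /= !sigM !sig_sig /= !mulrDr !mulrDl !mulrA ?addbT ?addbF ?negbK.
by rewrite [X in X + _ = _]addrC [LHS]addrACA.
Qed.

Lemma smash_mul1l : left_id smash_one smash_mul.
Proof.
move=> z; apply/ffunP => m; rewrite !ffunE big_bool /= !ffunE /=.
by rewrite mul0r add0r mul1r sig0.
Qed.

Lemma smash_mul1r : right_id smash_one smash_mul.
Proof.
move=> z; apply/ffunP => m; rewrite !ffunE big_bool /= !ffunE /=.
by case: m; rewrite /= linear0 sig1 mulr1 mulr0 ?addr0 ?add0r.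
Qed.

Lemma smash_mulDl : left_distributive smash_mul +%R.
Proof.
move=> x y z; apply/ffunP => m; rewrite !ffunE -big_split; apply: eq_bigr => i _ /=.
by rewrite !ffunE mulrDl.
Qed.

Lemma smash_mulDr : right_distributive smash_mul +%R.
Proof.
move=> x y z; apply/ffunP => m; rewrite !ffunE -big_split; apply: eq_bigr => i _ /=.
by rewrite !ffunE linearD /= mulrDr.
Qed.

Lemma smash_one_neq0 : smash_one != 0.
Proof.
by apply/eqP => /ffunP/(_ false)/eqP; rewrite !ffunE oner_eq0.
Qed.

HB.instance Definition _ := GRing.Zmodule_isNzRing.Build smash
  smash_mulA smash_mul1l smash_mul1r smash_mulDl smash_mulDr smash_one_neq0.

Lemma smash_mulE z w m : (z * w) m = \sum_(i : bool) z i * sig H i (w (i (+) m)).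
Proof. by rewrite ffunE. Qed.

Lemma smash_scaleAl (c : k) z w : c *: (z * w) = (c *: z) * w.
Proof.
apply/ffunP => m; rewrite [LHS]ffunE !smash_mulE scaler_sumr; apply: eq_bigr => i _.
by rewrite ffunE scalerAl.
Qed.

HB.instance Definition _ := GRing.Lmodule_isLalgebra.Build k smash smash_scaleAl.

Lemma smash_scaleAr (c : k) z w : c *: (z * w) = z * (c *: w).
Proof.
apply/ffunP => m; rewrite [LHS]ffunE !smash_mulE scaler_sumr; apply: eq_bigr => i _.
by rewrite ffunE linearZ scalerAr.
Qed.

HB.instance Definition _ := GRing.Lalgebra_isAlgebra.Build k smash smash_scaleAr.
HB.instance Definition _ := Algebra_isFalgebra.Build k smash.

(** The element a s^i. *)
Definition emb (i : bool) (a : H) : smash := [ffun j => if i == j then a else 0].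

Lemma emb_is_linear i : linear (emb i).
Proof.
move=> c a b; apply/ffunP => j; rewrite !ffunE.
by case: eqP; rewrite ?scaler0 ?addr0.
Qed.

HB.instance Definition _ i := GRing.isSemilinear.Build k H smash _
  (emb i) (GRing.semilinear_linear (emb_is_linear i)).

Lemma embM i j a b : emb i a * emb j b = emb (i (+) j) (a * sig H i b).
Proof.
apply/ffunP => m; rewrite smash_mulE (bigD1 i) //= big1 => [|l /negPf li].
  rewrite !ffunE eqxx addr0; case: (i); case: (j); case: (m);
  by rewrite /= ?linear0 ?mulr0.
by rewrite !ffunE eq_sym li mul0r.
Qed.

Lemma emb1 : emb false 1 = 1.
Proof. by apply/ffunP => m; rewrite !ffunE; case: m. Qed.

Lemma emb_add z : \sum_(i : bool) emb i (z i) = z.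
Proof.
apply/ffunP => m; rewrite sum_ffunE (bigD1 m) //= big1 => [|l /negPf li].
  by rewrite ffunE eqxx addr0.
by rewrite ffunE li.
Qed.

End Bosonization.

Section LinearTlift.

Variables (k : fieldType) (U V : vectType k).

Lemma tlift_linear (X W : lmodType k) (f : X -> W) (F : U -> V -> X) t :
  linear f -> f (tlift F t) = tlift (fun u v => f (F u v)) t.
Proof.
move=> fl; pose fP := GRing.isSemilinear.Build k X W _ f (GRing.semilinear_linear fl).
pose L : {linear X -> W} := HB.pack f fP.
exact: (linear_tlift L).
Qed.

Lemma tens0l (w : V) : tens (0 : U) w = 0.
Proof. by have := (tens_bilin U V).1 w (-1) 0 0; rewrite !scaleN1r oppr0 addr0 addNr. Qed.

Lemma tens0r (u : U) : tens u (0 : V) = 0.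
Proof. by have := (tens_bilin U V).2 u (-1) 0 0; rewrite !scaleN1r oppr0 addr0 addNr. Qed.

Lemma bilin_sum_fun (W : lmodType k) (I : finType) (f : I -> U -> V -> W) :
  (forall i, bilin (f i)) -> bilin (fun u v => \sum_i f i u v).
Proof.
move=> bf; split=> [v c a b|u c a b] /=; rewrite scaler_sumr -big_split;
  apply: eq_bigr => i _; [exact: (bf i).1 | exact: (bf i).2].
Qed.

Lemma bilin_precomp (U' V' : lmodType k) (W : lmodType k) (f : U -> V -> W)
    (g : U' -> U) (h : V' -> V) : linear g -> linear h -> bilin f ->
  (forall v, linear (fun u => f (g u) (h v))) /\
  (forall u, linear (fun v => f (g u) (h v))).
Proof.
move=> gl hl [fl fr]; split=> [v c a b|u c a b]; first by rewrite gl fl.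
by rewrite hl fr.
Qed.

End LinearTlift.

(** * Hopf structure of the bosonization *)

Section BosonizationHopf.

Variables (k : fieldType) (H : superHopfAlgebra k).

Local Notation "x ^: i" := (hproj (homog H) i x) (at level 2, format "x ^: i").
Local Notation A := (smash H).

Let gH := homog_grading H.

Lemma emb_ind (W : lmodType k) (f g : A -> W) : linear f -> linear g ->
  (forall i a, f (emb i a) = g (emb i a)) -> f =1 g.
Proof.
move=> fl gl fg z; rewrite -(emb_add z) big_bool.
by rewrite -[emb true _]scale1r fl gl !fg.
Qed.

(** Radford's coproduct of a s^i, namely a_1 s^(i + |a_2|) (x) a_2 s^i: an odd second factor leaves
    an s in the first, which replaces the sign rule. *)
Definition smash_delta_term (i : bool) (a : H) : tensor A A :=
  tlift (fun u v => \sum_(j : bool) tens (emb (i (+) j) u) (emb i v^:j)) (comul H a).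

Lemma smash_delta_linear :
  linear (fun z : A => \sum_(i : bool) smash_delta_term i (z i)).
Proof.
move=> c z w; rewrite scaler_sumr -big_split; apply: eq_bigr => i _ /=.
by rewrite /smash_delta_term !ffunE !linearP.
Qed.

Definition smash_delta : 'Hom(A, tensor A A) := linear_hom smash_delta_linear.

Lemma smash_delta_emb i a : smash_delta (emb i a) = smash_delta_term i a.
Proof.
rewrite linear_homE (bigD1 i) //= big1 => [|j /negPf ji].
  by rewrite ffunE eqxx addr0.
by rewrite ffunE eq_sym ji /smash_delta_term !linear0.
Qed.

Lemma sweedler_emb (W : lmodType k) (F : A -> A -> W) i a : bilin F ->
  tlift F (smash_delta (emb i a)) =
  tlift (fun u v => \sum_(j : bool) F (emb (i (+) j) u) (emb i v^:j)) (comul H a).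
Proof.
move=> bF; rewrite smash_delta_emb /smash_delta_term linear_tlift.
apply: eq_tlift => u v /=; rewrite linear_sum; apply: eq_bigr => j _ /=.
by rewrite tlift_tens.
Qed.

Lemma smash_delta_termE i a : smash_delta_term i a =
  tlift (fun u v => \sum_(j : bool) tens (emb (i (+) j) u) (emb i v^:j)) (comul H a).
Proof. by []. Qed.

Lemma emb_hproj_linear i j : linear (fun v : H => emb i v^:j).
Proof. by move=> c a b; rewrite !linearP. Qed.

Lemma emb_linear i : linear (@emb k H i).
Proof. exact: linearP. Qed.

Lemma bilin_delta_term i :
  bilin (fun u v : H => \sum_(j : bool) tens (emb (i (+) j) u) (emb i v^:j)).
Proof.
apply: bilin_sum_fun => j; apply: bilin_precomp (tens_bilin _ _).
  exact: emb_linear.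
exact: emb_hproj_linear.
Qed.

(** The common value of both sides of coassociativity: j is the parity of the last two factors
    together, l that of the last one. *)
Let Phi i (u p q : H) : tensor A (tensor A A) :=
  \sum_(j : bool) \sum_(l : bool)
    tens (emb (i (+) j) u) (tens (emb (i (+) l) p^:(l (+) j)) (emb i q^:l)).

Lemma smash_deltaA z :
  tlift (fun u v => tens u (smash_delta v)) (smash_delta z) =
  tlift (fun u v => tlift (fun u1 u2 => tens u1 (tens u2 v)) (smash_delta u))
    (smash_delta z).
Proof.
have [tl tr] := tens_bilin A A.
have [tl3 tr3] := tens_bilin A (tensor A A).
move: z; apply: emb_ind => [c x y|c x y|i a]; [by rewrite !linearP..|].
rewrite !sweedler_emb; first last.
- split=> [v c a1 a2|u c a1 a2] /=.
    by rewrite tl3.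
  by rewrite linearP tr3.
- split=> [v c a1 a2|u c a1 a2] /=.
    by rewrite !linearP.
  rewrite -tliftZ -tliftD; apply: eq_tlift => u1 u2.
  by rewrite tr tr3.
transitivity (tlift (fun u v => tlift (Phi i u) (comul H v)) (comul H a)).
  apply: eq_tlift => u v; rewrite [in RHS]/Phi tlift_sum; apply: eq_bigr => j _.
  rewrite smash_delta_emb smash_delta_termE sweedler_hproj; last exact: bilin_delta_term.
  rewrite -tlift_sum (tlift_linear _ _ (tr3 _)); apply: eq_tlift => p q.
  have e : \sum_(m : bool) \sum_(l : bool)
      tens (emb (i (+) l) p^:(m (+) j)) (emb i (q^:m)^:l) =
      \sum_(l : bool) tens (emb (i (+) l) p^:(l (+) j)) (emb i q^:l).
    by rewrite !big_bool /= !(hprojE gH) /= linear0 !tens0r !addr0 add0r.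
  rewrite e !big_bool /= addrC -[X in X + _]scale1r tr3 scale1r addrC.
  by [].
transitivity (tlift (fun u v => tlift (fun p q => Phi i p q v) (comul H u)) (comul H a)).
  apply: super_coassoc => [p q|u].
    move=> c x y; rewrite /Phi scaler_sumr -big_split; apply: eq_bigr => j _ /=.
    rewrite scaler_sumr -big_split; apply: eq_bigr => l _ /=.
    by rewrite linearP tl3.
  apply: bilin_sum_fun => j; apply: bilin_sum_fun => l.
  split=> [v c x y|v c x y].
    by rewrite !linearP tl tr3.
  by rewrite !linearP tr tr3.
apply: eq_tlift => u v; rewrite big_bool /=.
rewrite !sweedler_emb; first last.
- split=> [w c a1 a2|w c a1 a2] /=; first by rewrite tl3.
  by rewrite tl tr3.
- split=> [w c a1 a2|w c a1 a2] /=; first by rewrite tl3.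
  by rewrite tl tr3.
rewrite -tliftD; apply: eq_tlift => p q; rewrite /Phi !big_bool /=.
by rewrite -!addbA /= !addbF [LHS]addrACA [X in X + _ = _]addrC.
Qed.

Lemma smash_eps_linear :
  linear (fun z : A => \sum_(i : bool) counit H (z i) : k^o).
Proof.
move=> c z w; rewrite scaler_sumr -big_split; apply: eq_bigr => i _ /=.
by rewrite !ffunE linearP.
Qed.

Definition smash_eps : 'Hom(A, k^o) := linear_hom smash_eps_linear.

Lemma smash_eps_emb i a : smash_eps (emb i a) = counit H a.
Proof.
rewrite linear_homE (bigD1 i) //= big1 => [|j /negPf ji].
  by rewrite ffunE eqxx addr0.
by rewrite ffunE eq_sym ji linear0.
Qed.

Lemma smash_epsl z : tlift (fun u v => smash_eps u *: v) (smash_delta z) = z.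
Proof.
move: z; apply: emb_ind => [c x y|c x y|i a]; [by rewrite !linearP|by []|].
rewrite sweedler_emb; last first.
  split=> [v c x y|u c x y] /=; first by rewrite linearP scalerDl scalerA.
  by rewrite scalerDr !scalerA mulrC.
rewrite -[in RHS](counitl a) linear_tlift; apply: eq_tlift => u v.
rewrite !big_bool /= !smash_eps_emb -scalerDr -linearD /= addrC (hproj_add gH).
by rewrite linearZ.
Qed.

Lemma smash_epsr z : tlift (fun u v => smash_eps v *: u) (smash_delta z) = z.
Proof.
move: z; apply: emb_ind => [c x y|c x y|i a]; [by rewrite !linearP|by []|].
rewrite sweedler_emb; last first.
  split=> [v c x y|u c x y] /=; last by rewrite linearP scalerDl scalerA.
  by rewrite scalerDr !scalerA mulrC.
rewrite -[in RHS](counitr a) linear_tlift; apply: eq_tlift => u v.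
rewrite !big_bool /= !smash_eps_emb !counit_hproj scale0r add0r addbF.
by rewrite linearZ.
Qed.

Lemma smash_delta1 : smash_delta 1 = tens 1 1.
Proof.
rewrite -{1}emb1 smash_delta_emb smash_delta_termE comul1 tlift_tens.
  rewrite big_bool /= !hproj1 linear0 tens0r add0r.
  by rewrite -[tens _ _]/(tens (emb false 1) (emb false 1)) !emb1.
exact: bilin_delta_term.
Qed.

Lemma smash_eps1 : smash_eps 1 = 1.
Proof. by rewrite -emb1 smash_eps_emb counit1. Qed.

Lemma smash_epsM z w : smash_eps (z * w) = smash_eps z * smash_eps w.
Proof.
move: z; apply: emb_ind => [c x y|c x y|i a].
- by rewrite mulrDl -scalerAl linearP.
- by rewrite linearP /GRing.scale /= mulrDl mulrA.
move: w; apply: emb_ind => [c x y|c x y|j b].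
- by rewrite mulrDr -scalerAr linearP.
- by rewrite linearP /GRing.scale /= mulrDr mulrCA.
by rewrite embM !smash_eps_emb counitM counit_sig.
Qed.

(** The sign (-1)^(|a_2||b_1|) of the super product is what the s^(|a_2|) standing to the right of
    a_1 produces when it moves past b_1. *)
Lemma smash_deltaM z w : smash_delta (z * w) =
  tlift (fun a1 a2 => tlift (fun b1 b2 => tens (a1 * b1) (a2 * b2))
    (smash_delta w)) (smash_delta z).
Proof.
have [tl tr] := tens_bilin A A.
move: z; apply: emb_ind => [c x y|c x y|i a].
- by rewrite mulrDl -scalerAl linearP.
- by rewrite !linearP.
move: w; apply: emb_ind => [c x y|c x y|j b].
- by rewrite mulrDr -scalerAr linearP.
- have lR : linear (fun w => tlift (fun a1 a2 => tlift (fun b1 b2 =>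
      tens (a1 * b1) (a2 * b2)) (smash_delta w)) (smash_delta (emb i a))).
    by apply: linear_tlift_param => u v e x' y'; rewrite !linearP.
  exact: lR.
rewrite embM smash_delta_emb smash_delta_termE comulM /tmul linear_tlift.
rewrite sweedler_emb; last first.
  split=> [v c x y|u c x y] /=; rewrite -tliftZ -tliftD; apply: eq_tlift => b1 b2.
    by rewrite mulrDl -scalerAl tl.
  by rewrite mulrDl -scalerAl tr.
apply: eq_tlift => a1 a2 /=; rewrite linear_tlift.
pose G c d := \sum_(l : bool) \sum_(m : bool)
  tens (emb (i (+) j (+) m) (a1 * sig H l c)) (emb (i (+) j) (a2^:l * d^:(l (+) m))).
have bG : bilin G.
  apply: bilin_sum_fun => l; apply: bilin_sum_fun => m.
  split=> [v c x y|u c x y].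
    by rewrite linearP mulrDr -scalerAr linearP tl.
  by rewrite linearP mulrDr -scalerAr linearP tr.
transitivity (tlift G (comul H (sig H i b))).
  apply: eq_tlift => c d /=; rewrite linear_sum; apply: eq_bigr => l _.
  have [tlH _] := tens_bilin H H.
  have -> : \sum_(n : bool) (-1) ^+ (l && n) *: tens (a1 * c^:n) (a2^:l * d) =
      tens (a1 * sig H l c) (a2^:l * d).
    by rewrite sigE addrC mulrDr -scalerAr tlH big_bool /= andbT andbF scale1r.
  rewrite /= tlift_tens; last exact: bilin_delta_term.
  by apply: eq_bigr => m _; rewrite hprojM.
rewrite sweedler_sig // .
under [RHS]eq_bigr => l _.
  rewrite sweedler_emb; last first.
    split=> [v c x y|u c x y] /=.
      by rewrite mulrDr -scalerAr tl.
    by rewrite mulrDr -scalerAr tr.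
  over.
rewrite -tlift_sum; apply: eq_tlift => u v /=; rewrite /G; apply: eq_bigr => l _.
rewrite !big_bool /= !embM !sig_sig !sig_hproj !hproj_sig.
by case: (i); case: (j); case: (l) => //=; rewrite addrC.
Qed.

(** The antipode sends a s^i to s^(i + |a|) S(a); the power of s is then moved to the right, which
    costs a [sig]. *)
Lemma smash_anti_linear : linear (fun z : A => \sum_(i : bool) \sum_(j : bool)
  emb (i (+) j) (sig H (i (+) j) (antipode H (z i)^:j))).
Proof.
move=> c z w; rewrite scaler_sumr -big_split; apply: eq_bigr => i _ /=.
rewrite scaler_sumr -big_split; apply: eq_bigr => j _ /=.
by rewrite !ffunE !linearP.
Qed.

Definition smash_anti : 'End(A) := linear_hom smash_anti_linear.

Lemma smash_anti_emb i a : smash_anti (emb i a) =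
  \sum_(j : bool) emb (i (+) j) (sig H (i (+) j) (antipode H a^:j)).
Proof.
rewrite linear_homE (bigD1 i) //= [X in _ + X]big1 => [|j /negPf ji].
  rewrite addr0; apply: eq_bigr => j _.
  by rewrite ffunE eqxx.
by rewrite big1 // => l _; rewrite ffunE eq_sym ji !linear0.
Qed.

Lemma smash_antir z :
  tlift (fun u v => u * smash_anti v) (smash_delta z) = smash_eps z *: 1.
Proof.
move: z; apply: emb_ind => [c x y|c x y|i a]; first by rewrite !linearP.
  by rewrite linearP scalerDl scalerA.
rewrite sweedler_emb; last first.
  split=> [v c x y|u c x y] /=; first by rewrite mulrDl scalerAl.
  by rewrite linearP mulrDr scalerAr.
rewrite smash_eps_emb -emb1 -linearZ /= -antipoder linear_tlift.
apply: eq_tlift => u v.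
have e j : emb (i (+) j) u * smash_anti (emb i v^:j) =
    emb false (u * antipode H v^:j).
  rewrite smash_anti_emb (bigD1 j) //= big1 => [|l /negPf lj].
    by rewrite (hprojE gH) eqxx addr0 embM sig_sig addbb sig0.
  by rewrite (hprojE gH) lj !linear0.
rewrite !big_bool /= !e -linearD /= -mulrDr -linearD /= addrC.
by rewrite (hproj_add gH).
Qed.

Lemma smash_antil z :
  tlift (fun u v => smash_anti u * v) (smash_delta z) = smash_eps z *: 1.
Proof.
move: z; apply: emb_ind => [c x y|c x y|i a]; first by rewrite !linearP.
  by rewrite linearP scalerDl scalerA.
rewrite sweedler_emb; last first.
  split=> [v c x y|u c x y] /=; last by rewrite mulrDr scalerAr.
  by rewrite linearP mulrDl scalerAl.
pose S2 := fun u v : H => antipode H u * v.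
have bS : bilin S2.
  split=> [v c x y|u c x y]; rewrite /S2 /=; last by rewrite mulrDr scalerAr.
  by rewrite linearP mulrDl scalerAl.
transitivity (tlift (fun u v => \sum_(r : bool) \sum_(j : bool)
    emb r (sig H (i (+) r) (S2 u^:(j (+) r) v^:j))) (comul H a)).
  apply: eq_tlift => u v.
  have e j : smash_anti (emb (i (+) j) u) * emb i v^:j = \sum_(m : bool)
      emb (j (+) m) (sig H (i (+) (j (+) m)) (S2 u^:m v^:j)).
    rewrite smash_anti_emb mulr_suml; apply: eq_bigr => m _.
    rewrite embM -sigM.
    have -> : i (+) j (+) m (+) i = j (+) m by case: (i); case: (j); case: (m).
    by rewrite -addbA.
  by rewrite !big_bool /= !e !big_bool /= [X in X + _ = _]addrC [LHS]addrACA.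
rewrite tlift_sum.
transitivity (\sum_(r : bool) emb r (sig H (i (+) r) (tlift S2 (comul H a^:r)))).
  apply: eq_bigr => r _; rewrite sweedler_hproj // !linear_sum /= tlift_sum.
  by apply: eq_bigr => j _; rewrite !linear_tlift.
rewrite big_bool /= !antipodel !counit_hproj scale0r !linear0 add0r addbF.
by rewrite !linearZ /= sig1 emb1 smash_eps_emb.
Qed.

Definition smash_hopf : hopfAlgebra k :=
  HopfAlgebra smash_deltaA smash_epsl smash_epsr smash_delta1 smash_deltaM
    smash_eps1 smash_epsM smash_antil smash_antir.

End BosonizationHopf.

(** * Weakly initial pairs *)

Definition has_weight (k : fieldType) (A : falgType k) (e : 'Hom(A, k^o))
    (M : fdmod A) (m : M) : Prop :=
  forall a, act M a m = (e a : k) *: m.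

Section WeakInitial.

Variables (k : fieldType) (A : falgType k) (y : A) (e : 'Hom(A, k^o)).

Definition admissible (K : fdmod A) (x : K) : Prop :=
  acyclic y K /\ has_weight e x.

Definition maps_to (K : fdmod A) (x : K) (M : fdmod A) (m : M) : Prop :=
  exists2 f : 'Hom(K, M), equivariant f & f x = m.

Lemma maps_to_trans (K : fdmod A) (x : K) (L : fdmod A) (z : L) (M : fdmod A) (m : M) :
  maps_to x z -> maps_to z m -> maps_to x m.
Proof.
case=> f fe fx [g ge gz]; exists (g \o f)%VF; last by rewrite comp_lfunE fx.
by move=> a u; rewrite !comp_lfunE fe ge.
Qed.

Lemma admissible_prod (K L : fdmod A) (x : K) (z : L) :
  admissible x -> admissible z ->
  exists w : prod_mod K L, [/\ admissible w, maps_to w x & maps_to w z].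
Proof.
case=> Kac xe [Lac ze]; exists (x, z); split.
- split=> [[u v] uv0|a]; last first.
    by apply: injective_projections; rewrite ?prod_mod1 ?prod_mod2 ?xe ?ze.
  have [u' uE] : exists u', u = act K y u'.
    by apply: Kac; have := prod_mod1 y ((u, v) : prod_mod K L); rewrite uv0.
  have [v' vE] : exists v', v = act L y v'.
    by apply: Lac; have := prod_mod2 y ((u, v) : prod_mod K L); rewrite uv0.
  exists (u', v'); apply: injective_projections; first by rewrite prod_mod1.
  by rewrite prod_mod2.
- have lf : linear (fun w : prod_mod K L => w.1) by [].
  exists (linear_hom lf); last by rewrite linear_homE.
  by move=> a w; rewrite (linear_homE lf (act _ a w)) (linear_homE lf w) prod_mod1.
have lf : linear (fun w : prod_mod K L => w.2) by [].
exists (linear_hom lf); last by rewrite linear_homE.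
by move=> a w; rewrite (linear_homE lf (act _ a w)) (linear_homE lf w) prod_mod2.
Qed.

Lemma admissible0 : @admissible (free_mod A 0) 0.
Proof.
split=> [m _|a]; first by exists 0; apply/ffunP => -[].
by apply/ffunP => -[].
Qed.

(** Each [Q i] is inherited by any pair that maps to one having it, and a product of pairs maps to
    all its factors. *)
Lemma admissible_join (n : nat) (Q : 'I_n -> forall K : fdmod A, K -> Prop) :
  (forall i (K : fdmod A) (x : K) (L : fdmod A) (z : L),
     maps_to z x -> Q i K x -> Q i L z) ->
  (forall i, exists (K : fdmod A) (x : K), admissible x /\ Q i K x) ->
  exists (K : fdmod A) (x : K), admissible x /\ forall i, Q i K x.
Proof.
elim: n Q => [|n IHn] Q Qm Qex.
  by exists (free_mod A 0), 0; split=> [|[]//]; apply: admissible0.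
have [K [x [xa Qx]]] := IHn (fun i => Q (lift ord0 i)) (fun i => Qm _) (fun i => Qex _).
have [L [z [za Qz]]] := Qex ord0.
have [w [wa wx wz]] := admissible_prod xa za.
exists (prod_mod K L), w; split=> // i; case: (unliftP ord0 i) => [j ->|->].
  exact: Qm (Qx j).
exact: Qm Qz.
Qed.

Lemma weight_map_linear (M : fdmod A) (m : M) :
  linear (fun a => act M a m - (e a : k) *: m).
Proof.
move=> c a b; rewrite act_linear add_lfunE scale_lfunE linearP scalerDl opprD.
by rewrite addrACA -scalerA scalerBr.
Qed.

Lemma weight_space_linear (M : fdmod A) :
  linear (fun m : M => linear_hom (weight_map_linear m)).
Proof.
move=> c m m'; apply/lfunP => a; rewrite add_lfunE scale_lfunE !linear_homE.
by rewrite linearP scalerDr opprD addrACA scalerBr !scalerA mulrC.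
Qed.

Definition weight_space (M : fdmod A) : {vspace M} :=
  lker (linear_hom (@weight_space_linear M)).

Lemma weight_spaceP (M : fdmod A) (m : M) : m \in weight_space M <-> has_weight e m.
Proof.
rewrite memv_ker linear_homE; split=> [/eqP/lfunP m0 a|mw].
  have := m0 a; rewrite linear_homE zero_lfunE => /eqP.
  by rewrite subr_eq0 => /eqP.
by apply/eqP/lfunP => a; rewrite linear_homE zero_lfunE mw subrr.
Qed.

(** It is enough to reach a basis of the weight space: equivariant maps can be combined linearly. *)
Lemma maps_to_weight_space (M : fdmod A) : acyclic y M ->
  exists (K : fdmod A) (x : K), admissible x /\
    forall m : M, has_weight e m -> maps_to x m.
Proof.
move=> Mac; pose b := vbasis (weight_space M).
have bw i : has_weight e b`_i.
  apply/weight_spaceP; have [lt|ge] := ltnP i (\dim (weight_space M)).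
    by apply: vbasis_mem; rewrite mem_nth ?size_tuple.
  by rewrite nth_default ?mem0v // size_tuple.
have [K [x [xa xb]]] : exists (K : fdmod A) (x : K), admissible x /\
    forall i : 'I_(\dim (weight_space M)), maps_to x b`_i.
  apply: (admissible_join (Q := fun i K x => maps_to x b`_i)).
    by move=> i K x L z zx; apply: maps_to_trans.
  move=> i; exists M, b`_i; split; first by split.
  by exists \1%VF; rewrite ?id_lfunE // => a u; rewrite !id_lfunE.
exists K, x; split=> // m /weight_spaceP mw.
have /fin_all_exists2[f fe fx] := xb.
exists (\sum_i coord b i m *: f i).
  move=> a u; rewrite !sum_lfunE linear_sum; apply: eq_bigr => i _.
  by rewrite !scale_lfunE fe linearZ.
rewrite sum_lfunE [RHS](coord_vbasis mw); apply: eq_bigr => i _.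
by rewrite scale_lfunE fx.
Qed.

(** Direct summands of an acyclic module are acyclic and the components of a weight vector are
    weight vectors, so maps found for the two summands can be added. *)
Lemma maps_to_decomposition (K : fdmod A) (x : K) :
  (forall (M : fdmod A) (m : M), indecomposable M -> acyclic y M ->
     has_weight e m -> maps_to x m) ->
  forall (M : fdmod A) (m : M), acyclic y M -> has_weight e m -> maps_to x m.
Proof.
move=> xI M; have [n] := ubnP (\dim {:M}); elim: n M => // n IHn M ltn m Mac mw.
have [iM|niM] := Classical_Prop.classic (indecomposable M); first exact: xI.
have [M0|Mn0] := Classical_Prop.classic ((fullv : {vspace M}) = 0%VS).
  exists 0; first by move=> a u; rewrite !zero_lfunE linear0.
  by rewrite zero_lfunE; apply/esym/eqP; rewrite -memv0 -M0 memvf.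
have [[U [W [sU sW UW [UW0 U0 W0]]]]|nex] := Classical_Prop.classic
    (exists U W : {vspace M}, [/\ submod U, submod W, (U + W)%VS = fullv &
       [/\ (U :&: W)%VS = 0%VS, U <> 0%VS & W <> 0%VS]]); last first.
  case: niM; split=> // U W sU sW UW UW0.
  have [|U0] := Classical_Prop.classic (U = 0%VS); first by left.
  have [|W0] := Classical_Prop.classic (W = 0%VS); first by right.
  by case: nex; exists U, W.
have dM : (\dim {:M} = \dim U + \dim W)%N by rewrite -UW dimv_disjoint_sum.
have dU : (0 < \dim U)%N by rewrite lt0n dimv_eq0; apply/eqP.
have dW : (0 < \dim W)%N by rewrite lt0n dimv_eq0; apply/eqP.
have split_eq u w u' w' : u \in U -> w \in W -> u' \in U -> w' \in W ->
    u + w = u' + w' -> u = u' /\ w = w'.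
  move=> uU wW uU' wW' euw.
  have d : u - u' = w' - w.
    by apply/eqP; rewrite subr_eq addrAC eq_sym subr_eq euw addrC.
  have : u - u' \in (U :&: W)%VS by rewrite memv_cap memvB //= d memvB.
  rewrite UW0 memv0 => /eqP d0; split; apply/eqP.
    by rewrite -subr_eq0 d0.
  by rewrite eq_sym -subr_eq0 -d d0.
have UWP v : exists u w, [/\ u \in U, w \in W & v = u + w].
  have : v \in (U + W)%VS by rewrite UW memvf.
  by move=> /memv_addP[u uU [w wW ->]]; exists u, w.
have [u [w [uU wW muw]]] := UWP m.
have sub_ac (V V' : {vspace M}) (sV : submod V) (sV' : submod V') :
    (V + V')%VS = fullv -> (V :&: V')%VS = 0%VS -> acyclic y (sub_mod sV).
  move=> VV' VV0 z yz0.
  have [t zt] : exists t, vsval z = act M y t.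
    by apply: Mac; rewrite -sub_modE yz0 linear0.
  have : t \in (V + V')%VS by rewrite VV' memvf.
  case/memv_addP=> t1 t1V [t2 t2V tE].
  exists (vsproj V t1); apply: (can_inj (@vsvalK _ _ V)).
  rewrite [RHS]sub_modE vsprojK // zt tE linearD /=.
  suff /eqP -> : act M y t2 == 0 by rewrite addr0.
  rewrite -memv0 -VV0 memv_cap sV' // andbT.
  have -> : act M y t2 = vsval z - act M y t1 by rewrite zt tE linearD /= addrAC subrr add0r.
  by rewrite memvB ?subvsP ?sV.
have sub_w a : act M a u = (e a : k) *: u /\ act M a w = (e a : k) *: w.
  apply: split_eq; rewrite ?sU ?sW ?memvZ //.
  by rewrite -linearD /= -muw mw muw scalerDr.
have sub_map (V : {vspace M}) (sV : submod V) (v : M) : acyclic y (sub_mod sV) ->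
    (\dim V < \dim {:M})%N -> v \in V -> (forall a, act M a v = (e a : k) *: v) ->
    maps_to x v.
  move=> Vac ltV vV vw; apply: (@maps_to_trans _ _ (sub_mod sV) (vsproj V v)).
    apply: IHn => //; first by rewrite dimvf (leq_trans ltV).
    move=> a; apply: (can_inj (@vsvalK _ _ V)).
    by rewrite sub_modE linearZ /= vsprojK // vw.
  have lf : linear (fun z : sub_mod sV => vsval z) by exact: linearP.
  exists (linear_hom lf); last by rewrite linear_homE vsprojK.
  by move=> a z; rewrite (linear_homE lf (act _ a z)) (linear_homE lf z) sub_modE.
have [f fe fx] : maps_to x u.
  apply: (sub_map U sU) => //; first exact: (sub_ac U W sU sW).
    by rewrite dM -[X in (X < _)%N]addn0 ltn_add2l.
  by move=> a; case: (sub_w a).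
have [g ge gx] : maps_to x w.
  apply: (sub_map W sW) => //; first by apply: (sub_ac W U sW sU); rewrite ?(addvC W) ?(capvC W).
    by rewrite dM -[X in (X < _)%N]add0n ltn_add2r.
  by move=> a; case: (sub_w a).
exists (f + g); last by rewrite add_lfunE fx gx.
by move=> a z; rewrite !add_lfunE fe ge linearD.
Qed.

(* [x] is the direct sum of the vectors of weight [e] in bases of the weight
   spaces of the finitely many indecomposables which are acyclic. *)
Lemma weakly_initial : finite_rep_type A ->
  exists (K : fdmod A) (x : K), admissible x /\
    forall (M : fdmod A) (m : M), acyclic y M -> has_weight e m -> maps_to x m.
Proof.
case=> n [L Lind].
have [K [x [xa xL]]] : exists (K : fdmod A) (x : K), admissible x /\
    forall i : 'I_n, acyclic y (L i) -> forall m : L i, has_weight e m -> maps_to x m.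
  apply: (admissible_join (Q := fun i (K : fdmod A) (x : K) => acyclic y (L i) ->
      forall m : L i, has_weight e m -> maps_to x m)).
    by move=> i K x M z zx xL Lac m mw; apply: maps_to_trans zx (xL Lac m mw).
  move=> i; have [Lac|nLac] := Classical_Prop.classic (acyclic y (L i)).
    by have [K [x [xa xL]]] := maps_to_weight_space Lac; exists K, x.
  by exists (free_mod A 0), 0; split=> //; apply: admissible0.
exists K, x; split=> //; apply: maps_to_decomposition => M m Mind Mac mw.
have [i [f fbij fe]] := Lind M Mind.
have finj := bij_inj fbij.
have kf : lker f == 0%VS.
  by apply/lker0P.
have fK z : f (f^-1 z)%VF = z.
  by have [g _ gK] := fbij; rewrite -[z]gK lker0_lfunK.
apply: (@maps_to_trans _ _ (L i) (f m)); last first.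
  exists (f^-1)%VF; last by rewrite lker0_lfunK.
  by move=> a z; apply: finj; rewrite fe !fK.
apply: xL => [z yz0|a]; last by rewrite -fe mw linearZ.
have [z' zE] : exists z', (f^-1)%VF z = act M y z'.
  by apply: Mac; apply: finj; rewrite fe fK yz0 linear0.
by exists (f z'); rewrite -fe -zE fK.
Qed.

End WeakInitial.

(** * Modules over the bosonization *)

Section SmashModules.

Variables (k : fieldType) (H : superHopfAlgebra k).

Local Notation A := (smash_hopf H).

Section FromInvolution.

Variables (M : fdmod H) (t : 'End(M)).
Hypothesis tt : forall m, t (t m) = m.
Hypothesis ta : forall a m, t (act M a m) = act M (sig H true a) (t m).

Lemma inv_act_linear (z : A) :
  linear (fun m => act M (z false) m + act M (z true) (t m)).
Proof. by move=> c m n; rewrite !linearP scalerDr addrACA. Qed.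

Definition inv_act (z : A) : 'End(M) := linear_hom (inv_act_linear z).

Lemma inv_actE z m : inv_act z m = act M (z false) m + act M (z true) (t m).
Proof. exact: linear_homE. Qed.

Lemma inv_actl : linear inv_act.
Proof.
move=> c z w; apply/lfunP => m; rewrite add_lfunE scale_lfunE !inv_actE !ffunE.
by rewrite !act_linear !add_lfunE !scale_lfunE scalerDr addrACA.
Qed.

Lemma inv_act1 : inv_act 1 = \1%VF.
Proof.
apply/lfunP => m; rewrite inv_actE !ffunE act1 !id_lfunE.
have -> : act M 0 = 0 by have := act_linear M (-1) 0 0; rewrite !scaleN1r oppr0 addr0 addNr.
by rewrite zero_lfunE addr0.
Qed.

Lemma inv_actM z w : inv_act (z * w) = (inv_act z \o inv_act w)%VF.
Proof.
apply/lfunP => m; rewrite comp_lfunE !inv_actE !smash_mulE !big_bool /= !sig0.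
rewrite !linearD /= !(add_lfunE (act M _)) !ta tt !actM !comp_lfunE.
by rewrite [LHS]addrACA [LHS]addrC; congr (_ + _); apply: addrC.
Qed.

Definition inv_mod : fdmod A := FdMod inv_actl inv_act1 inv_actM.

Lemma inv_modE z (m : inv_mod) :
  act inv_mod z m = act M (z false) m + act M (z true) (t m).
Proof. exact: inv_actE. Qed.

End FromInvolution.

Lemma inv_mod_emb (M : fdmod H) (t : 'End(M)) tt ta i a m :
  act (@inv_mod M t tt ta) (emb i a) m = act M a (if i then t m else m).
Proof.
have act0 : act M 0 = 0.
  by have := act_linear M (-1) 0 0; rewrite !scaleN1r oppr0 addr0 addNr.
by rewrite inv_modE !ffunE; case: i => /=; rewrite act0 zero_lfunE ?addr0 ?add0r.
Qed.

Section Restriction.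

Variable N : fdmod A.

Lemma res_linear : linear (fun a : H => act N (emb false a)).
Proof. by move=> c a b; rewrite linearP act_linear. Qed.

Lemma res1 : act N (emb false 1) = \1%VF.
Proof. by rewrite emb1 act1. Qed.

Lemma resM a b : act N (emb false (a * b)) =
  (act N (emb false a) \o act N (emb false b))%VF.
Proof. by rewrite -actM embM sig0. Qed.

Definition res_mod : fdmod H := FdMod res_linear res1 resM.

End Restriction.

Section Induction.

Variable M : fdmod H.

Lemma twist_linear : linear (fun a : H => act M (sig H true a)).
Proof. by move=> c a b; rewrite linearP act_linear. Qed.

Lemma twist1 : act M (sig H true 1) = \1%VF.
Proof. by rewrite sig1 act1. Qed.

Lemma twistM a b :
  act M (sig H true (a * b)) = (act M (sig H true a) \o act M (sig H true b))%VF.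
Proof. by rewrite sigM actM. Qed.

(** The summand s M of the module induced by M, on which H acts through the parity automorphism; s
    exchanges M and s M. *)
Definition twist_mod : fdmod H := FdMod twist_linear twist1 twistM.

Let P := prod_mod M twist_mod.

Lemma swap_linear : linear (fun z : P => (z.2, z.1) : P).
Proof. by []. Qed.

Definition swap : 'End(P) := linear_hom swap_linear.

Lemma swapE z : swap z = (z.2, z.1).
Proof. exact: linear_homE. Qed.

Lemma swap_swap z : swap (swap z) = z.
Proof. by rewrite !swapE -surjective_pairing. Qed.

Lemma swap_act a z : swap (act P a z) = act P (sig H true a) (swap z).
Proof.
rewrite !swapE; apply: injective_projections.
  by rewrite [RHS]prod_mod1; exact (prod_mod2 (M := M) (N := twist_mod) a z).
by rewrite [RHS]prod_mod2 [RHS]/= sig_sig sig0; exact (prod_mod1 (M := M) (N := twist_mod) a z).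
Qed.

Definition ind_mod : fdmod A := inv_mod swap_swap swap_act.

End Induction.

Variable y : H.
Hypotheses (k2 : 2%:R != 0 :> k) (yodd : y \in homog H true).

(** The pair is found among H-modules, where finiteness is assumed, and then induced. Maps out of
    the induced module come from H-linear maps by Frobenius reciprocity. *)
Lemma weakly_initial_smash : finite_rep_type H ->
  exists (K : fdmod A) (x : K), [/\ acyclic (emb false y : A) K, is_invariant x &
    forall (N : fdmod A) (n : N), acyclic (emb false y : A) N -> is_invariant n ->
    exists2 f : 'Hom(K, N), equivariant f & f x = n].
Proof.
move=> Hfrt.
have [K0 [x0 [[K0ac x0w] x0i]]] := @weakly_initial _ _ y (counit H) Hfrt.
have sy : sig H true y = - y by rewrite (sig_homog _ yodd) expr1 scaleN1r.
(* The extension z |-> f0 z.1 + s f0 z.2 used below sends (h x0, h x0) to h n + h s n = 2 h n,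
   whence the value of h. *)
pose h : k := 2%:R^-1.
pose x : ind_mod K0 := (h *: x0, h *: x0).
exists (ind_mod K0), x; split.
- move=> [u v] uv0.
  have [u' uE] : exists u', u = act K0 y u'.
    by apply: K0ac; move: (congr1 fst uv0); rewrite inv_mod_emb prod_mod1.
  have [v' vE] : exists v', v = act K0 y v'.
    apply: K0ac; move: (congr1 snd uv0); rewrite inv_mod_emb prod_mod2 /= sy.
    by rewrite linearN opp_lfunE => /eqP; rewrite oppr_eq0 => /eqP.
  exists (u', - v'); rewrite inv_mod_emb; apply: injective_projections.
    by rewrite prod_mod1.
  by rewrite prod_mod2 /= sy [act K0 (- y)]linearN opp_lfunE linearN opprK.
- apply: emb_ind => [c z w|c z w|i a].
  + by rewrite act_linear add_lfunE scale_lfunE.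
  + by rewrite linearP scalerDl scalerA.
  rewrite inv_mod_emb smash_eps_emb.
  have -> : (if i then swap K0 x else x) = x by case: i; rewrite ?swapE.
  apply: injective_projections; first by rewrite prod_mod1 linearZ /= x0w !scalerA mulrC.
  by rewrite prod_mod2 linearZ /= x0w counit_sig !scalerA mulrC.
move=> N n Nac ninv.
have [f0 f0e f0x] : maps_to x0 (n : res_mod N).
  apply: x0i => [m m0|a]; first by have [m' ->] := Nac m m0; exists m'.
  by rewrite [LHS]ninv smash_eps_emb.
pose s : A := emb true 1.
have lf : linear (fun z : ind_mod K0 => f0 z.1 + act N s (f0 z.2) : N).
  by move=> c z w; rewrite /= !linearP scalerDr addrACA.
have f0E a v : f0 (act K0 a v) = act N (emb false a) (f0 v) by rewrite f0e.
exists (linear_hom lf); last first.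
  rewrite linear_homE /= linearZ /= f0x linearZ /= ninv smash_eps_emb counit1 scale1r.
  by rewrite -mulr2n -scaler_nat scalerA mulfV // scale1r.
move=> z m; rewrite (linear_homE lf m) (linear_homE lf (act _ z m)).
move: z; apply: emb_ind => [c z w|c z w|i a].
- by rewrite act_linear add_lfunE scale_lfunE /= !linearP scalerDr addrACA.
- by rewrite act_linear add_lfunE scale_lfunE.
rewrite inv_mod_emb prod_mod1 prod_mod2 /= !f0E linearD /= -!act_comp !embM.
rewrite mul1r !sig_sig /= sig0; case: i; rewrite ?swapE /= sig1 mulr1 //.
by rewrite addrC.
Qed.

End SmashModules.

(** * Odd forms *)

(** The factor [l || m] removes the even-even term, and the projection removes the two mixed
    ones. *)
Lemma hproj_even_sum (k : fieldType) (V : vectType k) (E : bool -> {vspace V})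
    (P : bool -> bool -> V) (d : k) :
  is_grading E -> (forall l m, P l m \in E (l (+) m)) ->
  hproj E false (\sum_(l : bool) \sum_(m : bool) ((l || m)%:R * d) *: P l m) =
  d *: P true true.
Proof.
move=> gE PE; rewrite !big_bool /= mul0r scale0r addr0 !mul1r !linearD !linearZ /=.
rewrite (hproj_id gE (PE true true)) (hproj_neg0 gE (PE true false)).
by rewrite (hproj_neg0 gE (PE false true)) !scaler0 !addr0.
Qed.

Section Functionals.

Variables (k : fieldType) (H : superHopfAlgebra k).
Hypotheses (k2 : 2%:R != 0 :> k) (cH : supercocommutative H).

Local Notation "x ^: i" := (hproj (homog H) i x) (at level 2, format "x ^: i").
Local Notation O := (sdual H).
Local Notation U := (underline H).

Let gH := homog_grading H.

Implicit Types f g : O.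

Lemma sdual_mulE f g x : (f * g) x = tlift (fun u v => f u * g v : k^o) (comul H x).
Proof. exact: sd_mulE. Qed.

Lemma sdual_supercomm i j f g : f \in sd_homog H i -> g \in sd_homog H j ->
  f * g = (-1) ^+ (i && j) *: (g * f).
Proof.
move=> fi gj; apply/lfunP => x; rewrite scale_lfunE !sdual_mulE -{1}cH.
rewrite /tswap linear_tlift -tliftZ; apply: eq_tlift => u v.
have bfg : bilin (fun u v : H => f u * g v : k^o) := bilin_form f g.
rewrite linear_sum (bigD1 j) //= linear_sum (bigD1 i) //= big1 => [|m /negPf mi]; last first.
  rewrite linearZ /= tlift_tens // (sd_hproj_homog _ fi) (hprojE gH) eq_sym mi.
  by rewrite linear0 mul0r scaler0.
rewrite big1 => [|l /negPf lj]; last first.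
  rewrite linear_sum big1 // => m _; rewrite linearZ /= tlift_tens //.
  rewrite (sd_hproj_homog _ gj) (hprojE gH) eq_sym lj.
  by rewrite linear0 mulr0 scaler0.
rewrite !addr0 linearZ /= tlift_tens // -(sd_hproj_homog _ fi) -(sd_hproj_homog _ gj).
by rewrite andbC mulrC.
Qed.

Lemma underlineP u :
  (u \in U) = (comul H u \in tensv (homog H false) (homog H false)).
Proof. by rewrite -memv_preim. Qed.

Lemma odd_mul_underline f g u : u \in U ->
  f \in sd_homog H true \/ g \in sd_homog H true -> (f * g) u = 0.
Proof.
rewrite underlineP => uU fg; rewrite sdual_mulE.
pose L : {linear tensor H H -> k^o} := tlift (fun a b => f a * g b : k^o).
apply/eqP; rewrite -memv0; apply: (tensvP (L := L)) uU => a b aH bH.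
rewrite memv0 /L /= tlift_tens; last exact: bilin_form.
case: fg => /sd_homogP e; first by rewrite e ?mul0r.
by rewrite e ?mulr0.
Qed.

(** Supercommutativity moves the odd factor to the end, where it meets an even component of the
    coproduct of u. *)
Lemma odd_factor_underline f g h u : u \in U -> g \in sd_homog H true ->
  (f * g * h) u = 0.
Proof.
move=> uU gT.
have e i h' : h' \in sd_homog H i -> (f * g * h') u = 0.
  move=> hi; rewrite -mulrA (sdual_supercomm gT hi) -scalerAr scale_lfunE mulrA.
  by rewrite (odd_mul_underline uU (or_intror gT)) scaler0.
rewrite -(hproj_add (sd_grading H) h) mulrDr add_lfunE.
by rewrite (e false _ (hproj_mem _ _ _)) (e true _ (hproj_mem _ _ _)) addr0.
Qed.

Definition coord_proj (i : 'I_(\dim {:H})) (l : bool) : O :=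
  hproj (sd_homog H) l (sd_coord i).

Lemma coord_proj_homog i l : coord_proj i l \in sd_homog H l.
Proof. exact: hproj_mem. Qed.

(* Double annihilator: [U] is the preimage of [H_0 (x) H_0] under the coproduct. *)
Lemma vanish_underline f : (forall u, u \in U -> f u = 0) ->
  exists c : 'I_(\dim {:H}) -> 'I_(\dim {:H}) -> k,
  f = \sum_i \sum_j \sum_(l : bool) \sum_(m : bool)
        ((l || m)%:R * c i j) *: (coord_proj i l * coord_proj j m).
Proof.
move=> fU; pose W := tensv (homog H false) (homog H false).
pose q : 'End(tensor H H) := (\1 - projv W)%VF.
pose Lam := (q \o comul H)%VF.
have LamU x : Lam x = 0 -> x \in U.
  rewrite /Lam comp_lfunE /q add_lfunE opp_lfunE id_lfunE => /eqP.
  by rewrite subr_eq0 underlineP => /eqP ->; apply: memv_proj.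
(* As f kills U, which contains ker Lam, it factors through Lam, explicitly by the partial inverse
   [Lam^-1]. The factor [q] makes G vanish on H_0 (x) H_0, so only terms with an odd factor
   survive. *)
pose G : 'Hom(tensor H H, k^o) := (f \o Lam^-1 \o q)%VF.
have GW t : t \in W -> G t = 0.
  move=> tW; rewrite /G !comp_lfunE [q t](_ : _ = 0) ?linear0 //.
  by rewrite /q add_lfunE opp_lfunE id_lfunE projv_id // subrr.
have fG x : f x = G (comul H x).
  rewrite /G !comp_lfunE -[q (comul H x)](comp_lfunE q (comul H)) -/Lam.
  apply/eqP; rewrite -subr_eq0 -linearB /=; apply/eqP/fU/LamU.
  by rewrite linearB /= limg_lfunVK ?subrr // memv_img // memvf.
pose b := vbasis {:H}.
exists (fun i j => G (tens b`_i b`_j)); apply/lfunP => x.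
rewrite fG -[comul H x]tlift_id linear_tlift.
have GE a a' : G (tens a a') = \sum_i \sum_j
    coord b i a * coord b j a' * G (tens b`_i b`_j).
  rewrite {1}(coord_vbasis (memvf a)) {1}(coord_vbasis (memvf a')).
  rewrite (bilin_sum _ _ _ _ (tens_bilin H H)) linear_sum; apply: eq_bigr => i _.
  by rewrite linear_sum; apply: eq_bigr => j _; rewrite linearZ.
rewrite sum_lfunE.
transitivity (\sum_(i < \dim {:H}) \sum_(j < \dim {:H}) \sum_(l : bool) \sum_(m : bool)
    tlift (fun u v => ((l || m)%:R * G (tens b`_i b`_j) : k) *:
      (coord_proj i l u * coord_proj j m v : k^o)) (comul H x)); last first.
  apply: eq_bigr => i _; rewrite sum_lfunE; apply: eq_bigr => j _.
  rewrite sum_lfunE; apply: eq_bigr => l _; rewrite sum_lfunE; apply: eq_bigr => m _.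
  by rewrite scale_lfunE sdual_mulE tliftZ.
under [RHS]eq_bigr => i _.
  under eq_bigr => j _.
    under eq_bigr => l _ do rewrite -tlift_sum.
    rewrite -tlift_sum; over.
  rewrite -tlift_sum; over.
rewrite -tlift_sum; apply: eq_tlift => u v.
have [tl tr] := tens_bilin H H.
have GDr a v1 v2 : G (tens a (v1 + v2)) = G (tens a v1) + G (tens a v2).
  by have := tr a 1 v1 v2; rewrite !scale1r => ->; rewrite linearD.
have GDl a v1 v2 : G (tens (v1 + v2) a) = G (tens v1 a) + G (tens v2 a).
  by have := tl a 1 v1 v2; rewrite !scale1r => ->; rewrite linearD.
transitivity (\sum_(l : bool) \sum_(m : bool) (l || m)%:R * G (tens u^:l v^:m)).
  rewrite /= -{1}(hproj_add gH u) -{1}(hproj_add gH v) GDl !GDr !big_bool /=.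
  have -> : G (tens u^:false v^:false) = 0.
    by apply: GW; apply: memv_tens; apply: hproj_mem.
  rewrite mulr0 addr0 add0r !mul1r.
  by rewrite [RHS]addrC; congr (_ + _); rewrite addrC.
have coordE i l w : coord_proj i l w = coord b i w^:l.
  by rewrite [LHS]sd_hprojE lfunE.
under eq_bigr => l _ do under eq_bigr => m _ do rewrite GE mulr_sumr.
rewrite -[RHS](eq_bigr _ (fun i _ => erefl _)).
under [RHS]eq_bigr => i _ do rewrite exchange_big /=.
rewrite [RHS]exchange_big; apply: eq_bigr => l _ /=.
under [RHS]eq_bigr => i _ do rewrite exchange_big /=.
rewrite [RHS]exchange_big; apply: eq_bigr => m _ /=.
apply: eq_bigr => i _; rewrite mulr_sumr; apply: eq_bigr => j _.
by rewrite !coordE /GRing.scale /= -[RHS]mulrA [X in _ = _ * X]mulrC.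
Qed.

(** A form vanishing on U is a combination of products with an odd factor, and such products still
    vanish on U after further multiplication. *)
Lemma vanish_underline_mul f g u : (forall v, v \in U -> f v = 0) -> u \in U ->
  (f * g) u = 0 /\ (g * f) u = 0.
Proof.
move=> /vanish_underline[c ->] uU.
have odd1 f1 f2 : f1 \in sd_homog H true -> (f1 * f2) u = 0.
  by move=> f1T; rewrite -[f1]mul1r; apply: odd_factor_underline.
have odd2 f1 f2 : f2 \in sd_homog H true -> (f1 * f2) u = 0.
  by move=> f2T; rewrite -[f1 * f2]mulr1; apply: odd_factor_underline.
rewrite !mulr_suml !mulr_sumr !sum_lfunE.
split; rewrite big1 // => i _; rewrite ?mulr_suml ?mulr_sumr sum_lfunE big1 // => j _;
  rewrite ?mulr_suml ?mulr_sumr sum_lfunE big1 // => l _;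
  rewrite ?mulr_suml ?mulr_sumr sum_lfunE big1 // => m _.
  rewrite -scalerAl scale_lfunE; have := (coord_proj_homog i l, coord_proj_homog j m).
  case: l => [[hl _]|]; first by rewrite -mulrA odd1 ?scaler0.
  case: m => [[_ hm]|_]; first by rewrite odd_factor_underline ?scaler0.
  by rewrite mul0r scale0r.
rewrite -scalerAr scale_lfunE; have := (coord_proj_homog i l, coord_proj_homog j m).
case: m => [[_ hm]|]; first by rewrite mulrA odd2 ?scaler0.
case: l => [[hl _]|_]; first by rewrite mulrA odd_factor_underline ?scaler0.
by rewrite mul0r scale0r.
Qed.

(** In the binomial expansion of (t + x)^(n+1) each term contains t^2 or x^n. *)
Lemma exp_sum_commute (R : nzRingType) (I : eqType) (r : seq I) (t : I -> R) :
  (forall i, t i * t i = 0) -> (forall i j, t i * t j = t j * t i) ->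
  exists n, (\sum_(i <- r) t i) ^+ n = 0.
Proof.
move=> t2 tC; elim: r => [|i r [n rn]].
  by exists 1%N; rewrite big_nil expr1.
exists n.+1; rewrite big_cons; set x := \sum_(j <- r) t j in rn *.
have cx : GRing.comm (t i) x.
  by rewrite /GRing.comm /x mulr_sumr mulr_suml; apply: eq_bigr => j _.
rewrite exprDn_comm // big1 // => j _; have [jn|nj] := ltnP j n.
  rewrite subSn 1?ltnW // -[(n - j)%N]prednK ?subn_gt0 // !exprS mulrA t2.
  by rewrite !mul0r mul0rn.
have [m ->] : exists m, nat_of_ord j = (m + n)%N by exists (j - n)%N; rewrite subnK.
by rewrite exprD rn !mulr0 mul0rn.
Qed.

Lemma odd_sqr f : f \in sd_homog H true -> f * f = 0.
Proof.
move=> fT; have := sdual_supercomm fT fT; rewrite expr1 scaleN1r => /eqP.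
rewrite -subr_eq0 opprK -mulr2n -scaler_nat scaler_eq0 (negPf k2) /=.
by move/eqP.
Qed.

(* Such an [f] is a sum of products of two odd forms, and odd forms have square
   zero. *)
Lemma even_vanish_nilpotent f : f \in sd_homog H false ->
  (forall u, u \in U -> f u = 0) -> exists n, f ^+ n = 0.
Proof.
move=> f0 /vanish_underline[c fE].
pose t (ij : 'I_(\dim {:H}) * 'I_(\dim {:H})) : O :=
  c ij.1 ij.2 *: (coord_proj ij.1 true * coord_proj ij.2 true).
have ev i j : coord_proj i true * coord_proj j true \in sd_homog H false.
  by apply: (@sd_homogM _ _ true true); apply: coord_proj_homog.
have sq i j : (coord_proj i true * coord_proj j true) *
    (coord_proj i true * coord_proj j true) = 0.
  rewrite mulrA -[X in X * _]mulrA.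
  rewrite [coord_proj j true * _](sdual_supercomm (coord_proj_homog _ _) (coord_proj_homog _ _)).
  rewrite -scalerAr -scalerAl mulrA odd_sqr ?coord_proj_homog //.
  by rewrite !mul0r scaler0.
have fsum : f = \sum_(ij <- enum {: 'I_(\dim {:H}) * 'I_(\dim {:H})}) t ij.
  rewrite big_enum -(pair_bigA _ (fun i j => t (i, j))) /=.
  have <- : hproj (sd_homog H) false f = f by apply: (hproj_id (sd_grading H)).
  rewrite {1}fE linear_sum; apply: eq_bigr => i _.
  rewrite linear_sum; apply: eq_bigr => j _; rewrite /t /=.
  apply: (hproj_even_sum (P := fun l m => coord_proj i l * coord_proj j m) _ (sd_grading H)).
  by move=> l m; apply: sd_homogM; apply: coord_proj_homog.
rewrite fsum; apply: exp_sum_commute => [[i j]|[i j] [i' j']]; rewrite /t /=.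
  by rewrite -scalerAl -scalerAr sq !scaler0.
rewrite -!scalerAl -!scalerAr (sdual_supercomm (ev i j) (ev i' j')) scale1r.
by rewrite !scalerA mulrC.
Qed.

(** The dual form of Delta U being contained in U (x) U. Pairs of forms separate tensors, and
    composing f and g with [projv U] changes them by forms vanishing on U, whose products vanish on
    U as well. *)
Lemma sweedler_underline (W : lmodType k) (F : H -> H -> W) u : u \in U -> bilin F ->
  tlift F (comul H u) = tlift (fun a b => F (projv U a) (projv U b)) (comul H u).
Proof.
move=> uU bF; have [tl tr] := tens_bilin H H.
suff e : comul H u = tlift (fun a b => tens (projv U a) (projv U b)) (comul H u).
  by rewrite {1}e linear_tlift; apply: eq_tlift => a b /=; rewrite tlift_tens.
apply: (tens_sep (phi := fun f : O => f : {linear H -> k^o})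
                 (psi := fun f : O => f : {linear H -> k^o})).
- by move=> v v0; rewrite (coord_vbasis (memvf v)) big1 // => i _;
    have : sd_coord i v = 0 := v0 (sd_coord i); rewrite lfunE /= => ->; rewrite scale0r.
- by move=> v v0; rewrite (coord_vbasis (memvf v)) big1 // => i _;
    have : sd_coord i v = 0 := v0 (sd_coord i); rewrite lfunE /= => ->; rewrite scale0r.
move=> f g; have bfg : bilin (fun u v : H => f u * g v : k^o) := bilin_form f g.
rewrite linear_tlift.
pose f' : O := (f \o projv U)%VF; pose g' : O := (g \o projv U)%VF.
transitivity ((f' * g') u); last first.
  rewrite sdual_mulE; apply: eq_tlift => a b /=.
  by rewrite tlift_tens // !comp_lfunE.
rewrite -sdual_mulE; apply/eqP; rewrite -subr_eq0.
have -> : (f * g) u - (f' * g') u = ((f - f') * g) u + (f' * (g - g')) u.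
  by rewrite mulrBl mulrBr !add_lfunE !opp_lfunE addrA subrK.
have z (h : O) v : v \in U -> (h - (h \o projv U)%VF : O) v = 0.
  by move=> vU; rewrite add_lfunE opp_lfunE comp_lfunE projv_id // subrr.
rewrite (vanish_underline_mul g (z f) uU).1 (vanish_underline_mul f' (z g) uU).2.
by rewrite addr0.
Qed.

End Functionals.

(** * The underlying ordinary Hopf algebra *)

Section UnderlineHopf.

Variables (k : fieldType) (H : superHopfAlgebra k).
Hypothesis cH : supercocommutative H.

Local Notation "x ^: i" := (hproj (homog H) i x) (at level 2, format "x ^: i").
Local Notation U := (underline H).

Let gH := homog_grading H.
Let B : falgType k := subvs_of U.
Let pi : H -> B := vsproj U.

Lemma underline_even u : u \in U -> u \in homog H false.
Proof.
rewrite underlineP => uU; rewrite -(counitl u).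
pose L : {linear tensor H H -> H} := tlift (fun u v => counit H u *: v).
have bL : bilin (fun u v : H => counit H u *: v).
  split=> [v c a b|w c a b] /=; first by rewrite linearP scalerDl scalerA.
  by rewrite scalerDr !scalerA mulrC.
apply: (tensvP (L := L)) uU => a b aH bH; rewrite /L /= tlift_tens //.
exact: memvZ.
Qed.

Lemma vsval_mul (u v : B) : vsval (u * v) = vsval u * vsval v.
Proof. by []. Qed.

Lemma underline1 : 1 \in U.
Proof. by rewrite underlineP comul1 memv_tens ?homog1. Qed.

Lemma vsval_one : vsval (1 : B) = 1.
Proof. by apply/eqP; rewrite -[_ == _]/(algid U == 1) algid_eq1 underline1. Qed.

Lemma vsval_scale1 c : vsval (c *: (1 : B)) = c *: 1.
Proof. by rewrite -[LHS]/(c *: vsval (1 : B)) vsval_one. Qed.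

Let piK u : u \in U -> vsval (pi u) = u.
Proof. exact: vsprojK. Qed.

Let pi_val (u : B) : pi (vsval u) = u.
Proof. exact: vsvalK. Qed.

Let val_pi x : vsval (pi x) = projv U x.
Proof. by rewrite /pi /vsproj unlock. Qed.

Let pi1 : pi 1 = 1.
Proof. by rewrite -vsval_one pi_val. Qed.

Let pi_lin : linear pi.
Proof. exact: linearP. Qed.

Let piZ c x : pi (c *: x) = c *: pi x.
Proof. exact: linearZ. Qed.

Lemma under_delta_linear :
  linear (fun u : B => tlift (fun a b => tens (pi a) (pi b)) (comul H (vsval u))).
Proof. by move=> c u v; rewrite !linearP. Qed.

(** [pi] is merely some linear projection onto U; [sweedler_proj] makes the choice invisible on
    coproducts of elements of U. *)
Definition under_delta : 'Hom(B, tensor B B) := linear_hom under_delta_linear.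

Lemma sweedler_under (W : lmodType k) (F : B -> B -> W) u : bilin F ->
  tlift F (under_delta u) = tlift (fun a b => F (pi a) (pi b)) (comul H (vsval u)).
Proof.
move=> bF; rewrite linear_homE linear_tlift; apply: eq_tlift => a b /=.
by rewrite tlift_tens.
Qed.

Lemma sweedler_proj (W : lmodType k) (F : H -> H -> W) (u : B) : bilin F ->
  tlift (fun a b => F (vsval (pi a)) (vsval (pi b))) (comul H (vsval u)) =
  tlift F (comul H (vsval u)).
Proof.
move=> bF; rewrite (sweedler_underline cH (subvsP u) bF).
by apply: eq_tlift => a b; rewrite !val_pi.
Qed.

Let bilin_pi (W : lmodType k) (F : B -> B -> W) : bilin F ->
  bilin (fun a b => F (pi a) (pi b)).
Proof. by move=> bF; apply: (bilin_precomp pi_lin pi_lin bF). Qed.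

Lemma under_deltaA u :
  tlift (fun a b => tens a (under_delta b)) (under_delta u) =
  tlift (fun a b => tlift (fun c d => tens c (tens d b)) (under_delta a))
    (under_delta u).
Proof.
have [tl tr] := tens_bilin B B.
have [tl3 tr3] := tens_bilin B (tensor B B).
have b2 (b : B) : bilin (fun c d : B => tens c (tens d b)).
  split=> [v c x y|v c x y]; first exact: tl3.
  by rewrite tl tr3.
rewrite !sweedler_under; first last.
- by split=> [v c x y|v c x y]; [exact: tl3 | rewrite linearP tr3].
- split=> [v c x y|v c x y] /=; first by rewrite !linearP.
  rewrite -tliftZ -tliftD; apply: eq_tlift => a b.
  by rewrite tr tr3.
pose F3 (a c d : H) := tens (pi a) (tens (pi c) (pi d)).
have l1 c d : linear (fun a => F3 a c d) by move=> e x y; rewrite /F3 pi_lin tl3.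
have l2 a d : linear (fun c => F3 a c d) by move=> e x y; rewrite /F3 pi_lin tl tr3.
have l3 a c : linear (fun d => F3 a c d) by move=> e x y; rewrite /F3 pi_lin tr tr3.
transitivity (tlift (fun a b => tlift (fun c d => F3 a c d) (comul H b)) (comul H (vsval u))).
  rewrite -(@sweedler_proj _ (fun a b => tlift (fun c d => F3 a c d) (comul H b))).
    apply: eq_tlift => a b; rewrite linear_homE (tlift_linear _ _ (tr3 _)).
    by apply: eq_tlift => c d; rewrite /F3 pi_val.
  split=> [v e x y|v e x y] /=; last by rewrite !linearP.
  rewrite -tliftZ -tliftD; apply: eq_tlift => c d.
  exact: l1.
rewrite (super_coassoc _ l1) => [|a]; last by split=> [d|c]; [apply: l2|apply: l3].
rewrite -(@sweedler_proj _ (fun a b => tlift (fun c d => F3 c d b) (comul H a))).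
  apply: eq_tlift => a b; rewrite sweedler_under //.
  by apply: eq_tlift => c d; rewrite /F3 pi_val.
split=> [v e x y|v e x y] /=; first by rewrite !linearP.
rewrite -tliftZ -tliftD; apply: eq_tlift => c d.
exact: l3.
Qed.

Lemma under_eps_linear : linear (fun u : B => counit H (vsval u)).
Proof. by move=> c u v; rewrite !linearP. Qed.

Definition under_eps : 'Hom(B, k^o) := linear_hom under_eps_linear.

Lemma under_epsE u : under_eps u = counit H (vsval u).
Proof. exact: linear_homE. Qed.

Let bilin_epsl : bilin (fun u v : H => counit H u *: v).
Proof.
split=> [v c a b|w c a b] /=; first by rewrite linearP scalerDl scalerA.
by rewrite scalerDr !scalerA mulrC.
Qed.

Let bilin_epsr : bilin (fun u v : H => counit H v *: u).
Proof.
split=> [v c a b|w c a b] /=; last by rewrite linearP scalerDl scalerA.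
by rewrite scalerDr !scalerA mulrC.
Qed.

Lemma under_epsl u : tlift (fun a b => under_eps a *: b) (under_delta u) = u.
Proof.
rewrite sweedler_under; last first.
  split=> [v c a b|w c a b] /=; first by rewrite linearP scalerDl scalerA.
  by rewrite scalerDr !scalerA mulrC.
rewrite -[RHS]pi_val -[in RHS](counitl (vsval u)) -(sweedler_proj u bilin_epsl).
rewrite (tlift_linear _ _ pi_lin); apply: eq_tlift => a b.
by rewrite under_epsE piZ pi_val.
Qed.

Lemma under_epsr u : tlift (fun a b => under_eps b *: a) (under_delta u) = u.
Proof.
rewrite sweedler_under; last first.
  split=> [v c a b|w c a b] /=; last by rewrite linearP scalerDl scalerA.
  by rewrite scalerDr !scalerA mulrC.
rewrite -[RHS]pi_val -[in RHS](counitr (vsval u)) -(sweedler_proj u bilin_epsr).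
rewrite (tlift_linear _ _ pi_lin); apply: eq_tlift => a b.
by rewrite under_epsE piZ pi_val.
Qed.

Lemma under_delta1 : under_delta 1 = tens 1 1.
Proof.
rewrite linear_homE vsval_one comul1 tlift_tens ?pi1 //.
exact: (bilin_pi (tens_bilin B B)).
Qed.

Lemma under_eps1 : under_eps 1 = 1.
Proof. by rewrite under_epsE vsval_one counit1. Qed.

Lemma under_epsM u v : under_eps (u * v) = under_eps u * under_eps v.
Proof. by rewrite !under_epsE vsval_mul counitM. Qed.

(** The components of u can be taken in U, hence even, so the sign rule contributes nothing. *)
Lemma sweedler_underM (W : lmodType k) (F : H -> H -> W) (u : B) x : bilin F ->
  tlift F (comul H (vsval u * x)) =
  tlift (fun a b => tlift (fun c d => F (vsval (pi a) * c) (vsval (pi b) * d))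
    (comul H x)) (comul H (vsval u)).
Proof.
move=> [Fl Fr]; pose G (a b : H) := tlift (fun c d =>
  \sum_(i : bool) \sum_(j : bool) (-1) ^+ (i && j) *: F (a * c^:j) (b^:i * d)) (comul H x).
transitivity (tlift G (comul H (vsval u))).
  rewrite comulM /tmul linear_tlift; apply: eq_tlift => a b /=.
  rewrite linear_tlift; apply: eq_tlift => c d /=.
  rewrite linear_sum; apply: eq_bigr => i _ /=; rewrite linear_sum; apply: eq_bigr => j _ /=.
  by rewrite linearZ /= tlift_tens.
have bG c d : bilin (fun a b : H => \sum_(i : bool) \sum_(j : bool)
    (-1) ^+ (i && j) *: F (a * c^:j) (b^:i * d)).
  apply: bilin_sum_fun => i; apply: bilin_sum_fun => j.
  split=> [v e a b|v e a b] /=.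
    by rewrite mulrDl -scalerAl Fl scalerDr !scalerA mulrC.
  by rewrite linearP mulrDl -scalerAl Fr scalerDr !scalerA mulrC.
rewrite -sweedler_proj; last first.
  split=> [v|v]; apply: linear_tlift_param => c d; [exact: (bG c d).1|exact: (bG c d).2].
apply: eq_tlift => a b; apply: eq_tlift => c d.
have bE : vsval (pi b) \in homog H false by apply/underline_even/subvsP.
have F0 z : F z 0 = 0 by have := Fr z (-1) 0 0; rewrite !scaleN1r oppr0 addr0 addNr.
rewrite !big_bool /= (hproj_id gH bE) (hproj_neg0 gH bE) mul0r !F0 !scaler0 !add0r.
rewrite !scale1r -[in RHS](hproj_add gH c) mulrDr addrC.
by have := Fl (vsval (pi b) * d) 1 (vsval (pi a) * c^:false) (vsval (pi a) * c^:true);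
  rewrite !scale1r.
Qed.

Lemma under_deltaM u v : under_delta (u * v) =
  tlift (fun a1 a2 => tlift (fun b1 b2 => tens (a1 * b1) (a2 * b2))
    (under_delta v)) (under_delta u).
Proof.
have [tl tr] := tens_bilin B B.
have bt := bilin_pi (tens_bilin B B).
rewrite linear_homE vsval_mul sweedler_underM // sweedler_under; last first.
  split=> [w e a b|w e a b] /=; rewrite -tliftZ -tliftD; apply: eq_tlift => c d.
    by rewrite mulrDl -scalerAl tl.
  by rewrite mulrDl -scalerAl tr.
apply: eq_tlift => a b; rewrite sweedler_under; last first.
  split=> [w e c d|w e c d] /=.
    by rewrite mulrDr -scalerAr tl.
  by rewrite mulrDr -scalerAr tr.
rewrite -(@sweedler_proj _ (fun c d => tens (pi (vsval (pi a) * c)) (pi (vsval (pi b) * d)))).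
  by apply: eq_tlift => c d; rewrite -!vsval_mul !pi_val.
split=> [w e c d|w e c d] /=.
  by rewrite mulrDr -scalerAr pi_lin tl.
by rewrite mulrDr -scalerAr pi_lin tr.
Qed.

Lemma under_coc u : tlift (fun a b => tens b a) (under_delta u) = under_delta u.
Proof.
have [tl tr] := tens_bilin B B.
rewrite sweedler_under; last by split=> *; [apply: tr | apply: tl].
rewrite [RHS]linear_homE -{2}cH /tswap linear_tlift.
pose F (a b : H) : tensor B B := \sum_(i : bool) \sum_(j : bool)
  (-1) ^+ (i && j) *: tens (pi b^:j) (pi a^:i).
transitivity (tlift F (comul H (vsval u))); last first.
  apply: eq_tlift => a b /=; rewrite linear_sum; apply: eq_bigr => i _ /=.
  rewrite linear_sum; apply: eq_bigr => j _ /=.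
  by rewrite linearZ /= tlift_tens //; apply: (bilin_pi (tens_bilin B B)).
rewrite -[RHS]sweedler_proj; last first.
  apply: bilin_sum_fun => i; apply: bilin_sum_fun => j.
  split=> [v e a b|v e a b] /=.
    by rewrite linearP pi_lin tr scalerDr !scalerA mulrC.
  by rewrite linearP pi_lin tl scalerDr !scalerA mulrC.
apply: eq_tlift => a b; rewrite /F !big_bool /=.
have ev c : vsval (pi c) \in homog H false by apply/underline_even/subvsP.
rewrite !(hproj_id gH (ev _)) !(hproj_neg0 gH (ev _)) (_ : pi 0 = 0) ?pi_val; last exact: linear0.
by rewrite !tens0l !tens0r !scaler0 !add0r scale1r.
Qed.

Let antil_B (a : B) : tlift (fun c d => antipode H (vsval c) * vsval d) (under_delta a) =
  under_eps a *: 1.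
Proof.
have bS := bilin_mul (antipode H) idfun.
rewrite sweedler_under; last first.
  split=> [v e x y|v e x y] /=.
    by rewrite linearP mulrDl -scalerAl.
  by rewrite mulrDr -scalerAr.
by rewrite (sweedler_proj a bS) /= antipodel under_epsE.
Qed.

Let theta_in_linear (T : 'End(B)) :
  linear (fun u : B => tlift (fun a b : B => a * T b) (under_delta u)).
Proof. by move=> c u v; rewrite !linearP. Qed.

Let theta_linear : linear (fun T => linear_hom (theta_in_linear T)).
Proof.
move=> c S T; apply/lfunP => u; rewrite add_lfunE scale_lfunE !linear_homE.
apply: (linear_tlift_param (F := fun (X : 'End(B)) (a b : B) => a * X b)) => a b e X Y.
by rewrite add_lfunE scale_lfunE mulrDr scalerAr.
Qed.

Let theta : 'End('End(B)) := linear_hom theta_linear.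

Let thetaE T u : theta T u = tlift (fun a b : B => a * T b) (under_delta u).
Proof. by rewrite linear_homE linear_homE. Qed.

Let vsval_theta (T : 'End(B)) u : vsval (T u) =
  tlift (fun a b => antipode H (vsval a) * vsval (theta T b)) (under_delta u).
Proof.
pose F (a c d : B) := antipode H (vsval a) * (vsval c * vsval (T d)).
transitivity (tlift (fun a b => tlift (fun c d => F a c d) (under_delta b)) (under_delta u)).
  rewrite (coassoc_trilinear _ _ (under_deltaA u)); first last.
  - move=> a; split=> [v e x y|v e x y]; rewrite /F.
      by rewrite linearP mulrDl mulrDr -!(scalerAl, scalerAr).
    by rewrite !linearP !mulrDr -!scalerAr.
  - by move=> b c e x y; rewrite /F !linearP mulrDl -scalerAl.
  rewrite -[in LHS](under_epsl u) !linear_tlift; apply: eq_tlift => a b /=.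
  rewrite !linearZ /= -[LHS]mul1r -scalerAr scalerAl -antil_B tlift_mulr.
  by apply: eq_tlift => c d; rewrite /F mulrA.
apply: eq_tlift => a b; rewrite thetaE linear_tlift tlift_mull.
by apply: eq_tlift.
Qed.

(** The operator T |-> (u |-> u_1 T(u_2)) on End U is injective, as the antipode of H undoes it
    ([vsval_theta]), hence bijective by finite dimension. The T sent to the counit takes values in
    U, and [vsval_theta] identifies it with the antipode: T(u) = S(u_1) eps(u_2). *)
Lemma antipode_underline u : u \in U -> antipode H u \in U.
Proof.
have k0 : lker theta == 0%VS.
  apply/lker0P => S T e; apply/lfunP => v; apply: (can_inj (@vsvalK _ _ U)).
  by rewrite !vsval_theta e.
have le : linear (fun v : B => under_eps v *: (1 : B)).
  by move=> c v w; rewrite linearP scalerDl scalerA.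
move=> uU; pose T := (theta^-1)%VF (linear_hom le).
suff -> : antipode H u = vsval (T (pi u)) by apply: subvsP.
rewrite vsval_theta /T (lker0_lfunVK k0).
rewrite -[in LHS](piK uU) -[in LHS](under_epsr (pi u)) !linear_tlift.
apply: eq_tlift => a b /=.
by rewrite (linear_homE le) linearZ vsval_scale1 /= -scalerAr mulr1.
Qed.

Lemma under_anti_linear : linear (fun u : B => pi (antipode H (vsval u))).
Proof. by move=> c u v; rewrite !linearP pi_lin. Qed.

Definition under_anti : 'End(B) := linear_hom under_anti_linear.

Lemma under_antiE u : vsval (under_anti u) = antipode H (vsval u).
Proof. by rewrite linear_homE piK ?antipode_underline ?subvsP. Qed.

Lemma under_antil u :
  tlift (fun a b => under_anti a * b) (under_delta u) = under_eps u *: 1.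
Proof.
apply: (can_inj (@vsvalK _ _ U)); rewrite linear_tlift vsval_scale1 /= -antil_B.
by apply: eq_tlift => a b; rewrite -[LHS]/(vsval (under_anti a) * vsval b) under_antiE.
Qed.

Lemma under_antir u :
  tlift (fun a b => a * under_anti b) (under_delta u) = under_eps u *: 1.
Proof.
have bS := bilin_mul idfun (antipode H).
apply: (can_inj (@vsvalK _ _ U)); rewrite linear_tlift vsval_scale1 /=.
rewrite under_epsE -antipoder -(sweedler_proj u bS) /= sweedler_under; last first.
  split=> [v e x y|v e x y].
    by rewrite linearP mulrDl scalerAl.
  by rewrite !linearP mulrDr scalerAr.
by apply: eq_tlift => a b; rewrite -[LHS]/(vsval (pi a) * vsval (under_anti (pi b))) under_antiE.
Qed.

Definition under_hopf : hopfAlgebra k :=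
  HopfAlgebra under_deltaA under_epsl under_epsr under_delta1 under_deltaM
    under_eps1 under_epsM under_antil under_antir.

Let left_mul_linear : linear (fun u : under_hopf => amull (vsval (u : B))).
Proof. by move=> c u v; rewrite !linearP. Qed.

Let left_mul1 : amull (vsval (1 : B)) = \1%VF.
Proof. by rewrite vsval_one amull1. Qed.

Let left_mulM (u v : under_hopf) : amull (vsval (u * v : B)) =
  (amull (vsval (u : B)) \o amull (vsval (v : B)))%VF.
Proof. exact: amull_comp. Qed.

Let left_mod : fdmod under_hopf := FdMod left_mul_linear left_mul1 left_mulM.

(* Left U-linear retraction of H onto U, killing the odd part. *)
Lemma underline_retraction : exists r : 'Hom(H, B),
  [/\ forall (u : B) x, r (vsval u * x) = u * r x, r 1 = 1 &
      forall x, x \in homog H true -> r x = 0].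
Proof.
have [|r rM r1] := @self_injective _ under_hopf under_coc left_mod (1 : H) (linear_hom pi_lin).
  by move=> a; rewrite linear_homE lfunE /= mulr1 pi_val.
(* Composing with the even projection preserves U-linearity because U is even. *)
exists (r \o hproj (homog H) false)%VF; split=> [u x||x xH].
- rewrite !comp_lfunE -rM lfunE /=; congr (r _).
  have uE : vsval u \in homog H false by apply/underline_even/subvsP.
  rewrite -[x in LHS](hproj_add gH) mulrDr linearD /=.
  rewrite (hproj_id gH (homogM uE (hproj_mem _ _ x))).
  by rewrite (hproj_neg0 gH (homogM uE (hproj_mem _ true x))) addr0.
- by rewrite comp_lfunE (hproj_id gH (homog1 H)).
- by rewrite comp_lfunE (hproj_neg0 gH xH) linear0.
Qed.

End UnderlineHopf.

(** * Invariant forms *)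

Section Translations.

Variables (k : fieldType) (H : superHopfAlgebra k).
Hypotheses (k2 : 2%:R != 0 :> k) (cH : supercocommutative H).

Local Notation O := (sdual H).
Local Notation U := (underline H).

Let gH := homog_grading H.
Let B : falgType k := subvs_of U.

Implicit Types f g : O.

Definition uinv (f : O) : Prop :=
  forall (u : B) x, f (vsval u * x) = counit H (vsval u) * f x.

Lemma uinv1 : uinv 1.
Proof. by move=> u x; rewrite [LHS]counitM. Qed.

Lemma uinvM f g : uinv f -> uinv g -> uinv (f * g).
Proof.
move=> fi gi u x; rewrite !sdual_mulE.
have bfg : bilin (fun a b : H => f a * g b : k^o) := bilin_form f g.
rewrite (sweedler_underM cH _ _ bfg).
pose e : k := tlift (fun a b => f a * g b : k^o) (comul H x).
have be : bilin (fun a b : H => counit H a * counit H b * e : k^o).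
  split=> [v c a b|v c a b]; rewrite linearP /= /GRing.scale /=.
    by rewrite !mulrDl !mulrA.
  by rewrite mulrDr mulrDl !mulrA [_ * c]mulrC.
transitivity (tlift (fun a b => counit H a * counit H b * e : k^o) (comul H (vsval u))).
  rewrite -(sweedler_proj cH u be); apply: eq_tlift => a b.
  rewrite /e [RHS](tlift_mull (A := k^o)); apply: eq_tlift => c d.
  by rewrite fi gi mulrACA.
rewrite -[in RHS](counitl (vsval u)) linear_tlift [RHS](tlift_mulr (A := k^o)).
by apply: eq_tlift => a b; rewrite linearZ.
Qed.

Lemma uinvP c f g : uinv f -> uinv g -> uinv (c *: f + g).
Proof.
move=> fi gi u x; rewrite !add_lfunE !scale_lfunE fi gi /GRing.scale /=.
by rewrite mulrDr mulrCA.
Qed.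

(* Geometric series in the nilpotent element [1 - f]. *)
Lemma uinv_inverse f : uinv f -> f \in sd_homog H false ->
  (forall u, u \in U -> f u = counit H u) ->
  exists2 g, uinv g & f * g = 1 /\ g * f = 1.
Proof.
move=> fi fe fU; pose e : O := 1 - f.
have [n en] : exists n, e ^+ n = 0.
  apply: (even_vanish_nilpotent k2 cH).
    by rewrite rpredB //; apply: sd_homog1.
  by move=> u uU; rewrite add_lfunE opp_lfunE fU // subrr.
have ei : uinv e.
  by have := uinvP (-1) fi uinv1; rewrite scaleN1r addrC.
have fE : f = 1 - e by rewrite /e opprB addrC subrK.
exists (\sum_(i < n) e ^+ i).
  elim/big_rec: _ => [|i x _ xi]; first by move=> u x; rewrite !zero_lfunE mulr0.
  rewrite -[e ^+ i]scale1r; apply: uinvP xi.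
  by elim: (val i) => [|m IHm]; [rewrite expr0; apply: uinv1 | rewrite exprS; apply: uinvM].
have := subrX1 e n; rewrite en sub0r => /eqP; rewrite -eqr_opp opprK -mulNr opprB -fE.
move=> /eqP fg; split=> //; rewrite [RHS]fg.
apply/esym/commr_sum => i _; apply: commrX; apply: commrB => //.
exact: commr1.
Qed.

Variable y : H.
Hypotheses (yodd : y \in homog H true) (yprim : comul H y = tens y 1 + tens 1 y).

(** The parity automorphism comes from moving the odd y across the second component of x. *)
Lemma sweedler_mul_prim (W : lmodType k) (F : H -> H -> W) x : bilin F ->
  tlift F (comul H (x * y)) =
  tlift (fun a b => F (a * y) (sig H true b) + F a (b * y)) (comul H x).
Proof.
move=> bF; have [tl tr] := tmul_bilin H.
rewrite comulM -[comul H x]tlift_id (tlift_linear _ _ (tl _)) !linear_tlift.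
apply: eq_tlift => a b /=; rewrite tlift_tens; last first.
  have [Fl Fr] := bF; split=> [v c u w|v c u w].
    by rewrite mulrDl -scalerAl !Fl scalerDr addrACA.
  by rewrite linearP mulrDl -scalerAl !Fr scalerDr addrACA.
rewrite yprim -[tens y 1]scale1r tr scale1r linearD /=.
have F0l z : F 0 z = 0 by have := bF.1 z (-1) 0 0; rewrite !scaleN1r oppr0 addr0 addNr.
rewrite !tmul_tens !big_bool /= !linearD /= !linearZ /= !tlift_tens //.
rewrite (hproj_id gH yodd) (hproj_neg0 gH yodd) (hproj_id gH (homog1 H)) (hproj_neg0 gH (homog1 H)).
rewrite !mulr0 !F0l !scaler0 !mulr1 !addr0 !add0r !scale1r; congr (_ + _).
  by rewrite sigE expr1 [X in _ = F _ X]addrC bF.2.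
have := bF.2 a 1 (hproj (homog H) true b * y) (hproj (homog H) false b * y).
by rewrite !scale1r => <-; rewrite -mulrDl addrC hproj_add.
Qed.

Lemma form_mul_prim f g x : (f * g) (x * y) =
  tlift (fun a b => f (a * y) * g (sig H true b) : k^o) (comul H x) +
  tlift (fun a b => f a * g (b * y) : k^o) (comul H x).
Proof. by rewrite sdual_mulE sweedler_mul_prim ?tliftD //; apply: bilin_form. Qed.

Definition rtrans_fun (a : H) (f : O) : O := (f \o amulr a)%VF.

Lemma rtrans_linear a : linear (rtrans_fun a).
Proof.
move=> c f g; apply/lfunP => x.
by rewrite !(comp_lfunE, add_lfunE, scale_lfunE).
Qed.

Definition rtrans a : 'End(O) := linear_hom (rtrans_linear a).

Lemma rtransE a f x : rtrans a f x = f (x * a).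
Proof. by rewrite linear_homE comp_lfunE lfunE. Qed.

Lemma rtrans_is_linear : linear rtrans.
Proof.
move=> c a b; apply/lfunP => f; apply/lfunP => x.
by rewrite !(add_lfunE, scale_lfunE) !rtransE mulrDr -scalerAr linearP.
Qed.

Lemma rtrans1 : rtrans 1 = \1%VF.
Proof. by apply/lfunP => f; apply/lfunP => x; rewrite rtransE id_lfunE mulr1. Qed.

Lemma rtransM a b : rtrans (a * b) = (rtrans a \o rtrans b)%VF.
Proof.
by apply/lfunP => f; apply/lfunP => x; rewrite comp_lfunE !rtransE mulrA.
Qed.

Definition rtrans_mod : fdmod H := FdMod rtrans_is_linear rtrans1 rtransM.

Lemma parity_linear : linear (fun f : rtrans_mod => (f \o sig H true)%VF : rtrans_mod).
Proof.
move=> c f g; apply/lfunP => x.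
by rewrite !(comp_lfunE, add_lfunE, scale_lfunE).
Qed.

Definition parity : 'End(rtrans_mod) := linear_hom parity_linear.

Lemma parityE (f : O) x : (parity f : O) x = f (sig H true x).
Proof. by rewrite linear_homE comp_lfunE. Qed.

Lemma parityK f : parity (parity f) = f.
Proof. by apply/lfunP => x; rewrite !parityE sig_sig sig0. Qed.

Lemma parity_act a f :
  parity (act rtrans_mod a f) = act rtrans_mod (sig H true a) (parity f).
Proof. by apply/lfunP => x; rewrite parityE !rtransE parityE sigM sig_sig sig0. Qed.

(** Right translations are chosen because they commute with left multiplication by U, so that the
    U-invariant forms become a submodule. *)
Definition form_mod : fdmod (smash_hopf H) := @inv_mod k H rtrans_mod parity parityK parity_act.

Lemma form_modE z (f : O) x :
  (act form_mod z f : O) x = f (x * z false) + f (sig H true (x * z true)).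
Proof. by rewrite inv_modE add_lfunE !rtransE parityE. Qed.

Lemma uinv_defect_linear (f : O) :
  linear (fun u : B => ((f \o amull (vsval u))%VF - counit H (vsval u) *: f : O)).
Proof.
move=> c u v; apply/lfunP => x.
rewrite !(add_lfunE, scale_lfunE, opp_lfunE, comp_lfunE) !lfunE /= !linearP /=.
by rewrite !mulrDl -!scalerAl !linearP /= scalerBr !scalerDl !scalerA opprD addrACA.
Qed.

Definition uinv_defect f : 'Hom(B, O) := linear_hom (uinv_defect_linear f).

Lemma uinv_defectE f u x :
  (uinv_defect f u : O) x = f (vsval u * x) - counit H (vsval u) * f x.
Proof.
by rewrite linear_homE add_lfunE opp_lfunE scale_lfunE comp_lfunE lfunE.
Qed.

Lemma uinv_defect_is_linear : linear (fun f : form_mod => uinv_defect f).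
Proof.
move=> c f g; apply/lfunP => u; apply/lfunP => x.
rewrite add_lfunE scale_lfunE [RHS]add_lfunE [X in _ = X + _]scale_lfunE !uinv_defectE.
rewrite !add_lfunE !scale_lfunE /GRing.scale /= mulrBr mulrDr opprD addrACA.
by rewrite [_ * (c * _)]mulrCA.
Qed.

Definition uinv_space : {vspace form_mod} := lker (linear_hom uinv_defect_is_linear).

Lemma uinv_spaceP f : reflect (uinv f) (f \in uinv_space).
Proof.
rewrite memv_ker (linear_homE uinv_defect_is_linear).
apply: (iffP eqP) => [f0 u x|fi].
  apply/subr0_eq; rewrite -uinv_defectE f0.
  by rewrite !zero_lfunE.
apply/lfunP => u; apply/lfunP => x.
by rewrite uinv_defectE fi subrr !zero_lfunE.
Qed.

Lemma uinv_submod : submod uinv_space.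
Proof.
move=> z f /uinv_spaceP fi; apply/uinv_spaceP => u x.
have uE : vsval u \in homog H false by apply/underline_even/subvsP.
rewrite !form_modE -!mulrA sigM (sig_homog _ uE) scale1r !fi.
by rewrite mulrDr.
Qed.

(** Taken from the ordinary Hopf algebra U, where [hantiM] applies without signs. *)
Lemma antipode_underM (u v : B) : antipode H (vsval u * vsval v) =
  antipode H (vsval v) * antipode H (vsval u).
Proof.
have e : under_anti H (u * v) = under_anti H v * under_anti H u.
  exact: (@hantiM k (under_hopf cH) u v).
by rewrite -vsval_mul -(under_antiE cH) e vsval_mul !(under_antiE cH).
Qed.

Lemma hproj_even_mul i u x : u \in homog H false ->
  hproj (homog H) i (u * x) = u * hproj (homog H) i x.
Proof.
by move=> uE; rewrite -[u in LHS](hproj_id gH uE) hprojM (hproj_id gH uE).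
Qed.

(** * An odd U-invariant form with value 1 at y *)

Section OddForm.

Variable r : 'Hom(H, B).
Hypotheses (rM : forall (u : B) x, r (vsval u * x) = u * r x) (r1 : r 1 = 1).
Hypothesis (rodd : forall x, x \in homog H true -> r x = 0).

(** S(r(x_1)) x_2 divides x by its image in U, so that every linear form composed with [coinv] is
    U-invariant. *)
Let coinv x : H := tlift (fun a b => antipode H (vsval (r a)) * b) (comul H x).

Let coinv_bilin : bilin (fun a b => antipode H (vsval (r a)) * b).
Proof.
split=> [v c a b|v c a b]; first by rewrite !linearP mulrDl -scalerAl.
by rewrite mulrDr -scalerAr.
Qed.

Let coinv_linear : linear coinv.
Proof. by move=> c a b; rewrite /coinv !linearP. Qed.

Let coinvM (u : B) x : coinv (vsval u * x) = counit H (vsval u) *: coinv x.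
Proof.
rewrite /coinv (sweedler_underM cH _ _ coinv_bilin) tlift_exchange -(tliftZ _ (W := H)).
apply: eq_tlift => c d.
transitivity (antipode H (vsval (r c)) *
    tlift (fun a b => antipode H a * b) (comul H (vsval u)) * d).
  rewrite -(sweedler_proj cH u (bilin_mul (antipode H) idfun)) /=.
  rewrite tlift_mull tlift_mulr; apply: eq_tlift => a b.
  by rewrite rM vsval_mul antipode_underM !mulrA.
by rewrite antipodel -scalerAr mulr1 scalerAl.
Qed.

Let coinv_y : coinv y = y.
Proof.
rewrite /coinv yprim linearD /= !tlift_tens // rodd // r1 vsval_one.
have -> : antipode H 1 = 1.
  by have := antipodel (1 : H); rewrite comul1 tlift_tens ?counit1 ?scale1r ?mulr1 //;
     apply: (bilin_mul (antipode H) idfun).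
by rewrite !linear0 mul0r add0r mul1r.
Qed.

Lemma uinv_odd_form : y != 0 ->
  exists2 b : O, uinv b & b \in sd_homog H true /\ b y = 1.
Proof.
move=> y0; have [i ci] : exists i, coord (vbasis {:H}) i y != 0.
  apply/existsP; apply: contraR y0; rewrite negb_exists => /forallP c0.
  rewrite (coord_vbasis (memvf y)) big1 // => i _.
  by have := c0 i; rewrite negbK => /eqP ->; rewrite scale0r.
(* A coordinate that does not vanish at y, made U-invariant by [coinv] and odd by the projection;
   [coinv] fixes y. *)
pose b := (sd_coord i \o linear_hom coinv_linear \o hproj (homog H) true)%VF : O.
have bE x : b x = coord (vbasis {:H}) i (coinv (hproj (homog H) true x)).
  by rewrite !comp_lfunE lfunE /= linear_homE.
exists ((coord (vbasis {:H}) i y)^-1 *: b).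
  move=> u x; rewrite !scale_lfunE !bE.
  have uE : vsval u \in homog H false by apply/underline_even/subvsP.
  rewrite hproj_even_mul // coinvM linearZ /=.
  by rewrite /GRing.scale /= mulrCA.
split.
  apply/memvZ/sd_homogP => x xH; rewrite bE.
  have -> : hproj (homog H) true x = 0 by apply: (hproj_neg0 gH xH).
  by rewrite (_ : coinv 0 = 0) ?linear0 // /coinv !linear0.
by rewrite scale_lfunE bE (hproj_id gH yodd) coinv_y /GRing.scale /= mulVf.
Qed.

End OddForm.

Hypothesis yy : y * y = 0.

Lemma rtrans_even_mul f g : g \in sd_homog H false -> rtrans y g = 0 ->
  rtrans y (f * g) = rtrans y f * g.
Proof.
move=> ge gy; apply/lfunP => x; rewrite rtransE form_mul_prim sdual_mulE.
rewrite [X in _ + X]tlift_eq0 ?addr0 => [|a b]; last first.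
  by rewrite -(rtransE y g) gy zero_lfunE mulr0.
apply: eq_tlift => a b; rewrite rtransE; congr (_ * _).
by rewrite (sd_hproj_homog _ ge) hproj_sig scale1r -(sd_hproj_homog _ ge).
Qed.

(* With [D f = f (_ * y)], the Leibniz rule [D (f * b) = f * D b - D f * b] makes
   multiplication by [b] a contraction up to the unit [D b]. *)
Lemma uinv_acyclic b : uinv b -> b \in sd_homog H true -> b y = 1 ->
  acyclic (emb false y : smash_hopf H) (sub_mod uinv_submod).
Proof.
move=> bi bo by1; pose g := rtrans y b.
have gi : uinv g by move=> u x; rewrite !rtransE -mulrA bi.
have ge : g \in sd_homog H false.
  apply/sd_homogP => x xo; rewrite rtransE (sd_hproj_homog _ bo).
  by rewrite (hproj_neg0 gH (homogM xo yodd)) linear0.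
have gU u : u \in U -> g u = counit H u.
  by move=> uU; rewrite rtransE -(vsprojK uU) bi by1 mulr1.
(* [g] is D b. It restricts to the counit on U since b(u y) = eps(u) b(y) = eps(u). *)
have [h hi [gh hg]] := uinv_inverse gi ge gU.
have gy : rtrans y g = 0.
  by apply/lfunP => x; rewrite !rtransE -mulrA yy mulr0 linear0 zero_lfunE.
move=> m my; pose f : O := vsval m.
have fi : uinv f by apply/uinv_spaceP/subvsP.
have fy : rtrans y f = 0.
  by have := congr1 vsval my; rewrite sub_modE [act _ _ _]inv_mod_emb linear0.
pose f' := f * h.
have f'i : uinv f' by apply: uinvM.
have f'g : f' * g = f by rewrite /f' -mulrA hg mulr1.
(* (D f') g = D(f' g) = D f = 0, and g is a unit. *)
have f'y : rtrans y f' = 0.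
  by rewrite -[LHS]mulr1 -gh mulrA -rtrans_even_mul // f'g fy mul0r.
have fE : f = rtrans y (f' * b).
  rewrite -f'g; apply/lfunP => x; rewrite rtransE form_mul_prim sdual_mulE.
  rewrite [X in X + _]tlift_eq0 ?add0r => [|c d]; last first.
    by rewrite -(rtransE y f') f'y zero_lfunE mul0r.
  by apply: eq_tlift => c d; rewrite rtransE.
have f'bi : (f' * b : form_mod) \in uinv_space by apply/uinv_spaceP/uinvM.
exists (vsproj uinv_space (f' * b : form_mod)); apply: (can_inj (@vsvalK _ _ uinv_space)).
by rewrite sub_modE vsprojK // [act _ _ _]inv_mod_emb -fE.
Qed.

(** Left multiplication by [emb false h] acts on the two coefficients of z separately. *)
Lemma smash_left_integral (z : smash_hopf H) i h :
  (forall w : smash_hopf H, w * z = heps (smash_hopf H) w *: z) ->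
  h * z i = counit H h *: z i.
Proof.
move=> zi; have := congr1 (fun w : smash H => w i) (zi (emb false h)).
rewrite [heps _ _]smash_eps_emb [X in _ = X]ffunE => <-.
rewrite smash_mulE big_bool !ffunE /= mul0r add0r sig0.
by case: i.
Qed.

(** The image of x = sum_i L_i v_i is the counit, which is 1 at 1, so some (L_i phi(v_i))(1) is
    nonzero. As H acts by right translation, this is a sum of values of forms at the coefficients of
    L_i. *)
Lemma exists_detected_integral : y != 0 -> finite_rep_type H ->
  exists (l : H) (f : O),
    [/\ forall h, h * l = counit H h *: l, uinv f & f l != 0].
Proof.
move=> y0 Hfrt; have [r [rM r1 rodd]] := underline_retraction cH.
have [b bi [bo by1]] := uinv_odd_form rM r1 rodd y0.
have [K [x [Kac xi Kuniv]]] := weakly_initial_smash k2 yodd Hfrt.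
have sy : sig H true y = - y by rewrite (sig_homog _ yodd) expr1 scaleN1r.
have e1 i : emb i 0 = 0 :> smash H by rewrite linear0.
have [n [L [v [Li xE]]]] : exists n (L : 'I_n -> smash_hopf H) (v : 'I_n -> K),
    (forall i a, a * L i = heps (smash_hopf H) a *: L i) /\ x = \sum_i act K (L i) (v i).
  apply: (@univ_trace k (smash_hopf H) (emb true 1) (emb false y) k2 _ _ _ _ _ K x Kac xi Kuniv).
  - by rewrite embM sig1 mulr1 emb1.
  - by rewrite !embM sy sig0 mul1r mulr1 linearN.
  - by rewrite embM sig0 yy e1.
  - rewrite [LHS]smash_delta_emb smash_delta_termE comul1 tlift_tens; last exact: bilin_delta_term.
    by rewrite big_bool /= !hproj1 e1 tens0r add0r.
  rewrite [LHS]smash_delta_emb smash_delta_termE yprim linearD /=.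
  rewrite !tlift_tens; try exact: (bilin_delta_term H false).
  rewrite !big_bool /= !hproj1 (hproj_id gH yodd) (hproj_neg0 gH yodd) e1 !tens0r.
  by rewrite add0r addr0 emb1.
have one_in : (1 : O) \in uinv_space by apply/uinv_spaceP/uinv1.
pose N := sub_mod uinv_submod.
have [phi phie phix] : exists2 phi : 'Hom(K, N),
    equivariant phi & phi x = vsproj uinv_space (1 : O).
  apply: Kuniv; first exact: (uinv_acyclic bi bo by1).
  apply: emb_ind => [c z w|c z w|i a].
  - by rewrite act_linear add_lfunE scale_lfunE.
  - by rewrite linearP scalerDl scalerA.
  apply: (can_inj (@vsvalK _ _ uinv_space)).
  rewrite sub_modE [act _ _ _]inv_mod_emb linearZ /= vsprojK // smash_eps_emb.
  have -> : (if i then parity (1 : O) else (1 : O)) = 1.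
    by case: i => //; apply/lfunP => w; rewrite parityE [LHS]counit_sig.
  by apply/lfunP => w; rewrite [LHS]rtransE scale_lfunE [LHS]counitM mulrC.
have sum1 : \sum_i (vsval (act N (L i) (phi (v i))) : O) 1 = 1.
  pose ev (w : N) : k^o := (vsval w : O) 1.
  have evl : linear ev by move=> c w w'; rewrite /ev linearP add_lfunE scale_lfunE.
  transitivity (linear_hom evl (phi x)).
    rewrite xE [phi _]linear_sum [RHS]linear_sum; apply: eq_bigr => i _.
    by rewrite /= (linear_homE evl) phie.
  by rewrite (linear_homE evl) phix /ev vsprojK // [LHS]counit1.
have [i Li0] : exists i, (vsval (act N (L i) (phi (v i))) : O) 1 != 0.
  apply/existsP; apply: contraR (oner_neq0 k); rewrite negb_exists => /forallP c0.
  rewrite -[X in X == _]sum1 big1 // => i _.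
  by have := c0 i; rewrite negbK => /eqP.
pose f : O := vsval (phi (v i)).
have fi : uinv f by apply/uinv_spaceP/subvsP.
have : f (L i false) + parity f (L i true) != 0.
  move: Li0; rewrite sub_modE form_modE !mul1r.
  by rewrite parityE.
(* At least one of the two coefficients of L_i is detected; for the coefficient of s the form is
   composed with parity, which preserves U-invariance. *)
case: (altP (f (L i false) =P 0)) => [->|f0 _]; last first.
  by exists (L i false), f; split=> // h; apply: smash_left_integral.
rewrite add0r => p0; exists (L i true), (parity f); split=> //.
  by move=> h; apply: smash_left_integral.
move=> u w; rewrite !parityE sigM.
have uE : vsval u \in homog H false by apply/underline_even/subvsP.
by rewrite (sig_homog _ uE) scale1r fi.
Qed.

(* Push a left integral [l] of H forward along the retraction [r], twisted by
   a form [f] which detects it. *)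
Lemma underline_semisimple : y != 0 -> finite_rep_type H -> semisimple (subvs_of U).
Proof.
move=> y0 Hfrt; have [r [rM r1 rodd]] := underline_retraction cH.
have [l [f [li fi fl]]] := exists_detected_integral y0 Hfrt.
have gl : linear (fun x => counit H (vsval (r x))) by move=> c a b; rewrite !linearP.
pose g : O := linear_hom gl.
have gE x : g x = counit H (vsval (r x)) by apply: (linear_homE gl).
have gi : uinv g by move=> u x; rewrite !gE rM vsval_mul counitM.
have ge : g \in sd_homog H false.
  by apply/sd_homogP => x xo; rewrite gE rodd // !linear0.
have gU u : u \in U -> g u = counit H u.
  move=> uU; have -> : u = vsval (vsproj U u) * 1 by rewrite vsprojK ?mulr1.
  by rewrite gE rM r1 !mulr1.
(* The counit after r is g, so pushing l forward with weight f itself would give (g * f)(l). The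
   inverse of g corrects this to (g * f')(l) = f(l). *)
have [h hi [gh _]] := uinv_inverse gi ge gU.
pose f' := h * f; have f'i : uinv f' by apply: uinvM.
have gf' : g * f' = f by rewrite /f' mulrA gh mul1r.
pose lam : B := tlift (fun a b => f' b *: r a) (comul H l).
(* Apply x |-> f'(x_2) r(x_1) to w l = eps(w) l: the U-invariance of f' leaves w_1 eps(w_2) = w in
   front of r(l_1). *)
have lamI (w : B) : w * lam = counit H (vsval w) *: lam.
  have bF : bilin (fun a b => f' b *: r a).
    split=> [v c a b|v c a b].
      by rewrite linearP scalerDr !scalerA mulrC.
    by rewrite linearP scalerDl scalerA.
  have rl : linear r by apply: linearP.
  have cl c a b : counit H (c *: a + b) = c * counit H a + counit H b by rewrite linearP.
  have bG : bilin (fun a b : H => tlift (fun c d => (counit H b * f' d) *: r (a * c)) (comul H l)).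
    split=> [v|v]; apply: linear_tlift_param => c d e a b.
      by rewrite mulrDl -scalerAl rl scalerDr !scalerA [e * _]mulrC.
    by rewrite cl mulrDl scalerDl scalerA mulrA.
  have -> : counit H (vsval w) *: lam =
      tlift (fun a b => f' b *: r a) (comul H (counit H (vsval w) *: l)).
    by rewrite !linearZ.
  rewrite -li.
  rewrite (sweedler_underM cH _ _ bF).
  transitivity (tlift (fun a b => tlift (fun c d => (counit H b * f' d) *: r (a * c)) (comul H l))
      (comul H (vsval w))); last first.
    rewrite -(sweedler_proj cH w bG); apply: eq_tlift => a b; apply: eq_tlift => c d.
    by rewrite f'i.
  rewrite tlift_exchange /lam tlift_mull; apply: eq_tlift => c d.
  rewrite -scalerAr -rM -[in LHS](counitr (vsval w)).
  rewrite tlift_mulr (tlift_linear _ _ rl) -(tliftZ _ (W := B)); apply: eq_tlift => a b.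
  have rZ c' x : r (c' *: x) = c' *: r x by rewrite linearZ.
  by rewrite -scalerAl rZ scalerA mulrC.
have lam0 : counit H (vsval lam) = f l.
  rewrite -gf' sdual_mulE /lam !linear_tlift; apply: eq_tlift => a b.
  by rewrite /= !linearZ /= gE mulrC.
apply: (@integral_semisimple k (under_hopf cH) ((f l)^-1 *: lam)) => [a|].
  rewrite -scalerAr lamI [heps _ a]under_epsE !scalerA.
  by congr (_ *: _); apply: mulrC.
rewrite [heps _ _]under_epsE.
have -> : counit H (vsval ((f l)^-1 *: lam)) = (f l)^-1 * counit H (vsval lam).
  by rewrite !linearZ.
by rewrite lam0 mulVf.
Qed.

End Translations.

Theorem proposition4p3 (k : closedFieldType) (p : nat) (G : finSuperGroup k)
    (p_char : p \in [pchar k]) (p_gt5 : (5 < p)%N)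
    (G_neq : (underline (measures G) : {vspace measures G}) <> fullv)
    (H_frt : finite_rep_type (measures G))
    (y : measures G) (y_prim : y \in odd_primitives (measures G))
    (y_neq0 : y <> 0) (yy0 : superbracket y y = 0) :
  semisimple (subvs_of (underline (measures G))).
Proof.
have k2 : 2%:R != 0 :> k.
  rewrite -(dvdn_pcharf p_char); apply/negP => /(dvdn_leq (ltn0Sn 1)).
  by rewrite leqNgt (leq_trans _ p_gt5).
have cH : supercocommutative (measures G).
  exact: dual_supercocommutative (coordAlg_comm (f := G)).
move: y_prim; rewrite memv_cap => /andP[/primitivesP yprim yodd].
have yy : y * y = 0.
  move: yy0; rewrite (superbracket_homog yodd yodd) /= expr1 scaleN1r opprK.
  by rewrite -mulr2n -scaler_nat => /eqP; rewrite scaler_eq0 (negPf k2) => /eqP.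
by apply: (underline_semisimple k2 cH yodd yprim yy) => //; apply/eqP.
Qed.
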